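(* Let $f\in L\log L$. Then $T(f)=0$ in $L^1$ (i.e. a.e. on $(-1,1)$) if and only if there is a constant $c\in\mathbb C$ such that $f(x)=c/\sqrt{1-x^2}$ for a.e. $x\in(-1,1)$.
   Context: All functions are complex-valued, Lebesgue measurable on $(-1,1)$, identified when equal a.e.; $L^1=L^1(-1,1)$. The decreasing rearrangement of $f$ is $f^*(t)=\inf\{\lambda\ge 0: |\{x\in(-1,1):|f(x)|>\lambda\}|\le t\}$, $0<t<2$. The Zygmund space $L\log L=L\log L(-1,1)$ consists of all measurable $f$ with $\|f\|_{L\log L}:=\int_0^2 f^*(t)\log\big(\tfrac{2e}{t}\big)\,dt<\infty$ (equivalently $\int_{-1}^1|f|\log^+|f|<\infty$); it is contained in $L^1$. For $f\in L^1$ the finite Hilbert transform is $$T(f)(t)=\lim_{\varepsilon\to0^+}\frac1\pi\Big(\int_{-1}^{t-\varepsilon}+\int_{t+\varepsilon}^1\Big)\frac{f(x)}{x-t}\,dx ,$$ which exists for a.e. $t\in(-1,1)$ and is measurable; $T$ maps $L\log L$ boundedly into $L^1$. *)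

(* Defs.v *)
From HB Require Import structures.
From mathcomp Require Import all_boot all_order all_algebra.
From mathcomp Require Import complex.
From mathcomp Require Import all_classical all_reals all_analysis.

Set Implicit Arguments.
Unset Strict Implicit.
Unset Printing Implicit Defensive.

Import Order.TTheory GRing.Theory Num.Theory.
Import numFieldNormedType.Exports.

Local Open Scope classical_set_scope.
Local Open Scope ring_scope.
Local Open Scope complex_scope.

(* R carrying the sigma-algebra of Lebesgue (and not only Borel) measurable
   sets, i.e. the domain of completed_lebesgue_measure. *)
Notation lebesgueType R :=
  (caratheodory_type ((wlength (@idfun (Real.sort R)))^*)%mu).
Notation lebmu R := (@completed_lebesgue_measure R).

Definition I11 (R : realType) : set R := [set` `]-1, 1[%R].

Definition cmeasurable (R : realType) (D : set R) (f : R -> R[i]) : Prop :=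
  measurable_fun (D : set (lebesgueType R)) (fun x : lebesgueType R => complex.Re (f x)) /\
  measurable_fun (D : set (lebesgueType R)) (fun x : lebesgueType R => complex.Im (f x)).

Definition cintegral (R : realType) (D : set R) (f : R -> R[i]) : R[i] :=
  (\int[lebmu R]_(x in D) complex.Re (f x)) +i* (\int[lebmu R]_(x in D) complex.Im (f x)).

Definition superlevel (R : realType) (f : R -> R[i]) (l : R) : set R :=
  [set x : R | I11 x /\ l < Normc.normc (f x)].

(* Extended-real valued, so that no junk value arises should the infimum be
   taken over the empty set. *)
Definition rearrangement (R : realType) (f : R -> R[i]) (t : R) : \bar R :=
  ereal_inf
    [set l%:E | l in [set l : R | 0 <= l /\ (lebmu R (superlevel f l) <= t%:E)%E]].

Definition LlogL_norm (R : realType) (f : R -> R[i]) : \bar R :=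
  (\int[lebmu R]_(t in ([set` `]0, 2[%R] : set R))
     (rearrangement f t * (ln (2 * expR 1 / t))%:E))%E.

Definition LlogL (R : realType) (f : R -> R[i]) : Prop :=
  cmeasurable (@I11 R) f /\ (LlogL_norm f < +oo)%E.

(* R[i]^o carries the topology of R[i] given by the complex modulus. *)
Definition truncated_hilbert (R : realType) (f : R -> R[i]) (t e : R) : R[i]^o :=
  (pi^-1)%:C *
  (cintegral [set` `]-1, t - e[%R] (fun x => f x / (x - t)%:C) +
   cintegral [set` `]t + e, 1[%R] (fun x => f x / (x - t)%:C)).

(* lim is total: this is the finite Hilbert transform of f at t only where
   hilbert_exists f t holds. *)
Definition finite_hilbert (R : realType) (f : R -> R[i]) (t : R) : R[i] :=
  lim (truncated_hilbert f t e @[e --> 0^'+]).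

Definition hilbert_exists (R : realType) (f : R -> R[i]) (t : R) : Prop :=
  cvg (truncated_hilbert f t e @[e --> 0^'+]).

(* Main.v *)
Require Import Defs.
From HB Require Import structures.
From mathcomp Require Import all_boot all_order all_algebra.
From mathcomp Require Import complex ring lra.
From mathcomp Require Import all_classical all_reals all_analysis measurable_realfun.

(** The finite Hilbert transform is skew-symmetric, and w(x) = sqrt(1 - x^2)
    times a polynomial of degree k is sent by T to a polynomial of degree k + 1.
    Hence, if T f = 0, formally
      int f T(w x^k) = - int (w x^k) T f = 0
    for all k, so that f is orthogonal to polynomials of every positive degree;
    since 1/w is annihilated by T (an explicit antiderivative of
    1 / ((x - t) w(x)) vanishes at both ends), it is orthogonal to the same
    polynomials, and f - c/w, with c chosen to give it mean zero, has only
    vanishing moments and is therefore zero.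

    The skew-symmetry holds for the truncated transforms T_e, so the point is to
    show that int g T_e f -> 0 for bounded g as soon as T_e f -> 0 almost
    everywhere.  By Egorov's theorem this reduces to the smallness of
    int f T_e(g 1_B) for B of small measure.  Here L log L enters, by duality
    with the exponential class: if |h| <= 1, the truncated kernel differs from
    the conjugate Fejer kernel by an integrable bump, the harmonic conjugate V
    of a trigonometric polynomial U with |U| <= 1 satisfies
    mean (e^V cos U) <= 1, and so int exp |T_e h| is bounded uniformly in e and
    h, while int |T_e h| is small with the L^1 norm of h.

    The integrals are those of the completed Lebesgue measure; the argument is
    run for the real and imaginary parts, replaced by Borel versions. *)

Import Order.TTheory GRing.Theory Num.Theory.
Import numFieldNormedType.Exports.
Local Open Scope classical_set_scope.
Local Open Scope ring_scope.
Local Open Scope complex_scope.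

Set Implicit Arguments.
Unset Strict Implicit.
Unset Printing Implicit Defensive.

(** * Derivatives and elementary trigonometric bounds *)

(** Vanishing of [T f] almost everywhere gives no convergence of [T_e f] in L^1, and no integrable
    majorant is at hand; skew-symmetry moves the operator onto bounded functions, but their
    transforms are still unbounded. The exponential bound, uniform in e, is therefore the analytic
    core. It stays elementary because only finite trigonometric sums on [-pi, pi] occur: two points
    of (-1, 1) differ by less than 2, so the periodic kernel is singular only on the diagonal.
    Truncation at 1/n is matched with the Fejer kernel of order n, which bounds the integral of the
    bump independently of n. As |U| <= 1 forces cos U >= 1/2, the means of e^V cos U and e^(-V) cos
    U bound that of e^|V|; smallness for small mass comes from comparing e^V + e^(-V) with its
    minimum 2. The rearrangement norm enters only through the measures d_k of the sets |f| > 2^k: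
    twice the norm dominates the sum of 2^k d_k ln (2e / d_k), and the tails of this convergent
    series give the equi-integrability. *)

Section derivation_rules.
Context {R : realType}.
Implicit Types f g : R -> R.

Lemma isder_cst (a x : R) : is_derive x 1 (fun _ : R => a) 0.
Proof. exact: is_derive_cst. Qed.

Lemma isder_id (x : R) : is_derive x 1 (fun y : R => y) 1.
Proof. exact: is_derive_id. Qed.

Lemma isder_add f g (x a b : R) : is_derive x 1 f a -> is_derive x 1 g b ->
  is_derive x 1 (fun y => f y + g y) (a + b).
Proof. by move=> *; exact: is_deriveD. Qed.

Lemma isder_opp f (x a : R) : is_derive x 1 f a ->
  is_derive x 1 (fun y => - f y) (- a).
Proof. by move=> *; exact: is_deriveN. Qed.

Lemma isder_mul f g (x a b : R) : is_derive x 1 f a -> is_derive x 1 g b ->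
  is_derive x 1 (fun y => f y * g y) (f x * b + g x * a).
Proof. by move=> *; apply: is_deriveM. Qed.

Lemma isder_comp f g (x a b : R) : is_derive (g x) 1 f a -> is_derive x 1 g b ->
  is_derive x 1 (fun y => f (g y)) (a * b).
Proof. by move=> hf hg; exact: is_derive1_comp. Qed.

Lemma isder_exp f n (x a : R) : is_derive x 1 f a ->
  is_derive x 1 (fun y => f y ^+ n) (n%:R * f x ^+ n.-1 * a).
Proof.
move=> hf; rewrite (_ : (fun y => _) = f ^+ n); last by rewrite exprfctE.
exact: is_deriveX.
Qed.

Lemma isder_inv f (x a : R) : f x != 0 -> is_derive x 1 f a ->
  is_derive x 1 (fun y => (f y)^-1) (- (f x) ^- 2 * a).
Proof. by move=> *; exact: is_deriveV. Qed.

Lemma isder_sin f (x a : R) : is_derive x 1 f a ->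
  is_derive x 1 (fun y => sin (f y)) (cos (f x) * a).
Proof. by move=> hf; apply: (isder_comp _ hf); exact: is_derive_sin. Qed.

Lemma isder_cos f (x a : R) : is_derive x 1 f a ->
  is_derive x 1 (fun y => cos (f y)) (- sin (f x) * a).
Proof. by move=> hf; apply: (isder_comp _ hf); exact: is_derive_cos. Qed.

Lemma isder_expR f (x a : R) : is_derive x 1 f a ->
  is_derive x 1 (fun y => expR (f y)) (expR (f x) * a).
Proof. by move=> hf; apply: (isder_comp _ hf); exact: is_derive_expR. Qed.

Lemma isder_atan f (x a : R) : is_derive x 1 f a ->
  is_derive x 1 (fun y => atan (f y)) ((1 + f x ^+ 2)^-1 * a).
Proof. by move=> hf; apply: (isder_comp _ hf); exact: is_derive1_atan. Qed.

Lemma isder_ln f (x a : R) : 0 < f x -> is_derive x 1 f a ->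
  is_derive x 1 (fun y => ln (f y)) ((f x)^-1 * a).
Proof. by move=> f0 hf; apply: (isder_comp _ hf); exact: is_derive1_ln. Qed.

Lemma isder_sqrt f (x a : R) : 0 < f x -> is_derive x 1 f a ->
  is_derive x 1 (fun y => Num.sqrt (f y)) ((2 * Num.sqrt (f x))^-1 * a).
Proof. by move=> f0 hf; apply: (isder_comp _ hf); exact: is_derive1_sqrt. Qed.

Lemma isder_sum (I : eqType) (s : seq I) (F : I -> R -> R) (x : R) (D : I -> R) :
  (forall i, is_derive x 1 (F i) (D i)) ->
  is_derive x 1 (fun y => \sum_(i <- s) F i y) (\sum_(i <- s) D i).
Proof.
move=> FD; elim: s => [|i s IH].
  rewrite big_nil (_ : (fun y => _) = fun _ => 0); first exact: isder_cst.
  by apply/funext => y; rewrite big_nil.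
rewrite big_cons (_ : (fun y => _) = fun y => F i y + \sum_(j <- s) F j y).
  exact: isder_add.
by apply/funext => y; rewrite big_cons.
Qed.

Lemma isder_derivable f (x a : R) : is_derive x 1 f a -> derivable f x 1.
Proof. by case. Qed.

Lemma isder_derive1 f (x a : R) : is_derive x 1 f a -> (f^`())%classic x = a.
Proof. by move=> h; rewrite derive1E; case: h. Qed.

Lemma isder_continuous f (x a : R) : is_derive x 1 f a -> {for x, continuous f}.
Proof.
by case=> fx _; apply/differentiable_continuous/derivable1_diffP.
Qed.

Lemma isder_ge0_ge f (df : R -> R) (a b : R) : a <= b ->
  (forall y : R, is_derive y 1 f (df y)) -> (forall y, a <= y <= b -> 0 <= df y) ->
  f a <= f b.
Proof.
move=> ab fd df0; rewrite -subr_ge0.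
have [|c hc ->] := @MVT_segment _ f df a b ab (fun y _ => fd y).
  by apply: continuous_subspaceT => y; exact: isder_continuous.
by rewrite mulr_ge0 ?subr_ge0// df0//; move: hc; rewrite in_itv.
Qed.

End derivation_rules.

(* Plain [apply] would let typeclass inference close the premises with the
   library's instances, whose derivatives are stated with scaling. *)
Ltac isder_step := first
  [ simple notypeclasses refine (isder_cst _ _)
  | simple notypeclasses refine (isder_id _)
  | simple notypeclasses refine (isder_add _ _)
  | simple notypeclasses refine (isder_opp _)
  | simple notypeclasses refine (isder_exp _ _)
  | simple notypeclasses refine (isder_sin _)
  | simple notypeclasses refine (isder_cos _)
  | simple notypeclasses refine (isder_expR _)
  | simple notypeclasses refine (isder_atan _)
  | simple notypeclasses refine (isder_ln _ _)
  | simple notypeclasses refine (isder_sqrt _ _)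
  | simple notypeclasses refine (isder_inv _ _)
  | simple notypeclasses refine (isder_mul _ _) ].
Ltac isder_auto :=
  simple notypeclasses refine (is_derive_eq _ _); [ | repeat isder_step | ].

Section trigonometric_bounds.
Context {R : realType}.
Implicit Types x s : R.

Lemma sin_le_id x : 0 <= x -> sin x <= x.
Proof.
move=> x0; rewrite -subr_ge0.
rewrite (_ : 0 = (fun y : R => y - sin y) 0); last by rewrite sin0 subr0.
apply: (@isder_ge0_ge _ (fun y : R => y - sin y) (fun y => 1 - cos y)) => // y.
Qed.

Lemma cos_ge_quadratic x : 1 - x ^+ 2 / 2 <= cos x.
Proof.
wlog x0 : x / 0 <= x.
  move=> h; have [|/ltW x0] := leP 0 x; first exact: h.
  by rewrite -cosN -(sqrrN x) h// oppr_ge0.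
rewrite -subr_ge0.
rewrite (_ : 0 = (fun y : R => cos y - (1 - y ^+ 2 / 2)) 0); last first.
  by rewrite cos0 expr0n/=; ring.
apply: (@isder_ge0_ge _ (fun y : R => cos y - (1 - y ^+ 2 / 2))
  (fun y => y - sin y)) => // [y|y /andP[y0 _]].
  by isder_auto => /=; field.
by rewrite subr_ge0 sin_le_id.
Qed.

Lemma mul_cos_le_sin s : 0 <= s <= 1 -> s * cos s <= sin s.
Proof.
move=> /andP[s0 s1]; rewrite -subr_ge0.
rewrite (_ : 0 = (fun y : R => sin y - y * cos y) 0); last first.
  by rewrite sin0 mul0r subr0.
apply: (@isder_ge0_ge _ (fun y : R => sin y - y * cos y)
  (fun y => y * sin y)) => // [y|y /andP[y0 ys]].
  by isder_auto => /=; ring.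
rewrite mulr_ge0// sin_ge0_pi// y0/=.
by have := pi_ge2 R; lra.
Qed.

Lemma half_le_sin s : 0 <= s <= 1 -> s / 2 <= sin s.
Proof.
move=> /[dup] s01 /mul_cos_le_sin; apply: le_trans; move/andP : s01 => [s0 s1].
rewrite ler_wpM2l// (le_trans _ (cos_ge_quadratic s))//.
by nra.
Qed.

(** With [u = 2 * s] this compares [1 / u] with half of [cot (u / 2)], its periodic counterpart. The
    numerator [sin s - s * cos s] is at most [s ^+ 3 / 2], the denominator [2 * s * sin s] at least
    [s ^+ 2]. *)
Lemma inv_sub_half_cot s : 0 < s <= 1 ->
  `|(2 * s)^-1 - cos s / (2 * sin s)| <= 1.
Proof.
move=> /andP[s0 s1].
have s01 : 0 <= s <= 1 by rewrite (ltW s0).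
have h1 := mul_cos_le_sin s01; have h2 := half_le_sin s01.
have h3 := cos_ge_quadratic s; have h4 := sin_le_id (ltW s0).
have sn0 : 0 < sin s by apply: lt_le_trans h2; rewrite divr_gt0.
rewrite (_ : _ - _ = (sin s - s * cos s) / (2 * s * sin s)); last first.
  by field; rewrite !gt_eqF.
have d0 : 0 < 2 * s * sin s by rewrite !mulr_gt0.
rewrite ger0_norm ?divr_ge0 ?subr_ge0 ?(ltW d0)//.
by rewrite ler_pdivrMr// mul1r; nra.
Qed.

End trigonometric_bounds.

(** * Fejer kernels and the truncated Hilbert kernel *)

Section fejer.
Context {R : realType}.
Implicit Types (n k : nat) (u s : R).

(** The Cesaro weights 1 - k/n, doubled for positive frequencies because the sum runs over k >= 0
    only; [fejer n] then has mean 1 over a period. *)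
Definition fejer_weight n k : R := if k == 0%N then 1 else 2 * (1 - k%:R / n%:R).

Definition fejer n u : R := \sum_(k < n) fejer_weight n k * cos (k%:R * u).

Definition conj_fejer n u : R := \sum_(k < n) fejer_weight n k * sin (k%:R * u).

(** The weights of the Dirichlet kernel. *)
Let c1 k : R := if k == 0%N then 1 else 2.

(** Written in the half angle [s] and multiplied by [sin s], so that the closed form involves no
    division and telescopes by the addition formulas. *)
Lemma dirichlet_closed n s :
  sin s * (\sum_(k < n.+1) c1 k * cos (k%:R * (2 * s))) = sin ((2 * n%:R + 1) * s).
Proof.
elim: n => [|n IH].
  rewrite big_ord1 /c1/= mulr0 add0r mul0r cos0 !mulr1; congr sin; ring.
rewrite big_ord_recr/= mulrDr IH /c1/=.
rewrite (_ : (2 * n.+1%:R + 1) * s = n.+1%:R * (2 * s) + s); last by ring.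
rewrite (_ : (2 * n%:R + 1) * s = n.+1%:R * (2 * s) - s); last first.
  by rewrite -natr1; ring.
by rewrite sinB sinD; ring.
Qed.

Lemma conj_dirichlet_closed n s :
  sin s * (\sum_(k < n.+1) c1 k * sin (k%:R * (2 * s))) =
  cos s - cos ((2 * n%:R + 1) * s).
Proof.
elim: n => [|n IH].
  rewrite big_ord1 /c1/= mul0r sin0 !mulr0 add0r mul1r subrr//.
rewrite big_ord_recr/= mulrDr IH /c1/=.
rewrite (_ : (2 * n.+1%:R + 1) * s = n.+1%:R * (2 * s) + s); last by ring.
rewrite (_ : (2 * n%:R + 1) * s = n.+1%:R * (2 * s) - s); last first.
  by rewrite -natr1; ring.
by rewrite cosB cosD; ring.
Qed.

(** The Fejer sum is the average of the first n Dirichlet sums; this recursion drives both closed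
    forms. *)
Let fejer_sumS (f : nat -> R) n :
  n.+1%:R * (\sum_(k < n.+1) fejer_weight n.+1 k * f k) =
  n%:R * (\sum_(k < n) fejer_weight n k * f k) + \sum_(k < n.+1) c1 k * f k.
Proof.
rewrite !mulr_sumr big_ord_recr/= [X in _ = _ + X]big_ord_recr/= addrA -big_split/=.
congr +%R; last first.
  rewrite mulrA; congr *%R.
  rewrite /fejer_weight /c1; case: n => [|n] /=; first by rewrite mulr1.
  rewrite -(natr1 n.+1); field.
  by apply: lt0r_neq0; have := ler0n R n; lra.
apply: eq_bigr => -[k kn] _ /=; rewrite !mulrA -mulrDl; congr *%R.
rewrite /fejer_weight /c1; case: k kn => [|k] /= kn; first by rewrite -natr1; ring.
case: n kn => // n _.
rewrite -(natr1 n.+1); field.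
by apply/andP; split; apply: lt0r_neq0; have := ler0n R n; lra.
Qed.

Lemma fejer_closed n s :
  sin s ^+ 2 * (n%:R * fejer n (2 * s)) = sin (n%:R * s) ^+ 2.
Proof.
elim: n => [|n IH].
  by rewrite !mul0r sin0 mulr0 expr0n.
rewrite /fejer (fejer_sumS (fun k => cos (k%:R * (2 * s)))) mulrDr IH.
rewrite (expr2 (sin s)) -(mulrA (sin s)) dirichlet_closed.
rewrite (_ : (2 * n%:R + 1) * s = n%:R * s + (n%:R * s + s)); last by ring.
rewrite -(natr1 n) mulrDl mul1r !sinD !cosD.
have := cos2Dsin2 s.
move: (sin s) (cos s) (sin (n%:R * s)) (cos (n%:R * s)) => a b c d h.
(* What separates the two sides is a multiple of [cos s ^+ 2 + sin s ^+ 2 - 1]. *)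
transitivity ((c * b + d * a) ^+ 2 + c ^+ 2 * (1 - (b ^+ 2 + a ^+ 2))).
  ring.
by rewrite h; ring.
Qed.

Lemma conj_fejer_closed n s :
  sin s ^+ 2 * (n%:R * conj_fejer n (2 * s)) =
  n%:R * (sin s * cos s) - sin (2 * n%:R * s) / 2.
Proof.
elim: n => [|n IH].
  by rewrite mulr0 !mul0r mulr0 sin0 mul0r subrr.
rewrite /conj_fejer (fejer_sumS (fun k => sin (k%:R * (2 * s)))) mulrDr IH.
rewrite (expr2 (sin s)) -(mulrA (sin s)) conj_dirichlet_closed.
set X := (2 * n%:R + 1) * s.
rewrite (_ : 2 * n%:R * s = X - s); last by rewrite /X; ring.
rewrite (_ : 2 * n.+1%:R * s = X + s); last by rewrite /X -natr1; ring.
by rewrite sinB sinD -natr1; field.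
Qed.

Lemma norm_fejer_weight_le n k : (k < n)%N -> `|fejer_weight n k| <= 2.
Proof.
move=> kn; rewrite /fejer_weight; case: ifP => _; first by rewrite normr1 ler1n.
have n0 : (0 < n%:R :> R) by rewrite ltr0n (leq_ltn_trans _ kn).
have h : k%:R / n%:R <= 1 :> R by rewrite ler_pdivrMr// mul1r ler_nat ltnW.
have h0 : 0 <= k%:R / n%:R :> R by rewrite divr_ge0.
rewrite ger0_norm; lra.
Qed.

Lemma fejer_weight_ge0 n k : (k < n)%N -> 0 <= fejer_weight n k.
Proof.
move=> kn; rewrite /fejer_weight; case: ifP => // _.
rewrite mulr_ge0// subr_ge0 ler_pdivrMr ?mul1r ?ler_nat ?(ltnW kn)//.
by rewrite ltr0n (leq_ltn_trans _ kn).
Qed.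

Lemma fejer_ge0 n u : 0 <= fejer n u.
Proof.
pose s := u / 2; have -> : u = 2 * s by rewrite /s; field.
(* Where [sin s] vanishes the closed form says nothing; there [cos (2 k s)] is the square of
   [cos (k s)], so every term is nonnegative. *)
have [s0|s0] := eqVneq (sin s) 0.
  rewrite /fejer; apply: sumr_ge0 => k _; rewrite mulr_ge0 ?fejer_weight_ge0//.
  have sk (j : nat) : sin (j%:R * s) = 0.
    elim: j => [|j IH]; first by rewrite mul0r sin0.
    by rewrite -natr1 mulrDl mul1r sinD IH s0 mul0r mulr0 addr0.
  rewrite (_ : k%:R * (2 * s) = k%:R * s + k%:R * s); last by ring.
  by rewrite cosD sk mul0r subr0 -expr2 sqr_ge0.
have [->|n0] := posnP n; first by rewrite /fejer big_ord0.
have nR : 0 < n%:R :> R by rewrite ltr0n.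
rewrite -(pmulr_rge0 _ nR) -(@pmulr_rge0 _ (sin s ^+ 2)).
  by rewrite fejer_closed sqr_ge0.
by rewrite lt_neqAle sqr_ge0 andbT eq_sym expf_neq0.
Qed.

Lemma norm_conj_fejer_le n u : `|conj_fejer n u| <= 2 * n%:R.
Proof.
rewrite /conj_fejer (le_trans (ler_norm_sum _ _ _))//.
rewrite (le_trans (y := \sum_(k < n) (2 : R)))//; last first.
  by rewrite sumr_const card_ord mulr_natr.
apply: ler_sum => k _; rewrite normrM -[leRHS]mulr1 ler_pM//.
  exact: norm_fejer_weight_le.
exact: sin_max.
Qed.

Lemma norm_fejer_le n u : `|fejer n u| <= 2 * n%:R.
Proof.
rewrite /fejer (le_trans (ler_norm_sum _ _ _))//.
rewrite (le_trans (y := \sum_(k < n) (2 : R)))//; last first.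
  by rewrite sumr_const card_ord mulr_natr.
apply: ler_sum => k _; rewrite normrM -[leRHS]mulr1 ler_pM//.
  exact: norm_fejer_weight_le.
exact: cos_max.
Qed.

Lemma conj_fejerN n u : conj_fejer n (- u) = - conj_fejer n u.
Proof.
rewrite /conj_fejer -sumrN; apply: eq_bigr => k _.
by rewrite mulrN sinN mulrN.
Qed.

(** The strict inequality selects exactly the two open intervals of the truncation. Being bounded,
    this kernel can be used with Fubini. *)
Definition trunc_inv e u : R := if e < `|u| then u^-1 else 0.

Lemma trunc_invN e u : trunc_inv e (- u) = - trunc_inv e u.
Proof. by rewrite /trunc_inv normrN invrN; case: ifP => //; rewrite oppr0. Qed.

(** The summand 1 pays for the cotangent, the bump for the Fejer remainder, of order 1/(n u^2) when
    u > 1/n, and for the conjugate kernel, of order n below. Its primitive is an arctangent of total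
    variation independent of n. *)
Definition kernel_gap n u : R := 1 + 8 * n%:R / (1 + (n%:R * u) ^+ 2).

Lemma kernel_gapN n u : kernel_gap n (- u) = kernel_gap n u.
Proof. by rewrite /kernel_gap mulrN sqrrN. Qed.

Lemma kernel_gap_ge0 n u : 0 <= kernel_gap n u.
Proof. by rewrite /kernel_gap addr_ge0// divr_ge0// addr_ge0// sqr_ge0. Qed.

Lemma norm_kernel_gap_le n u : `|kernel_gap n u| <= 1 + 8 * n%:R.
Proof.
rewrite ger0_norm ?kernel_gap_ge0// /kernel_gap lerD2l.
by rewrite ler_pdivrMr ?ltr_wpDr ?sqr_ge0// ler_peMr// lerDl sqr_ge0.
Qed.

Lemma trunc_inv_sub_conj_fejer n u : (0 < n)%N -> `|u| <= 2 ->
  `|trunc_inv n%:R^-1 u - conj_fejer n u / 2| <= kernel_gap n u.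
Proof.
move=> n0 u2.
wlog u0 : u u2 / 0 <= u.
  move=> h; have [|/ltW u0] := leP 0 u; first exact: h.
  have := h (- u); rewrite normrN oppr_ge0 trunc_invN conj_fejerN mulNr -opprD.
  by rewrite normrN /kernel_gap mulrN sqrrN; apply.
have nR : 0 < n%:R :> R by rewrite ltr0n.
have nu : 0 <= (n%:R * u) ^+ 2 by rewrite sqr_ge0.
rewrite /trunc_inv (ger0_norm u0); case: ltP => h.
- have u0' : 0 < u by apply: lt_trans h; rewrite invr_gt0.
  move: u2; rewrite (ger0_norm u0) => u2.
  pose s := u / 2; have us : u = 2 * s by rewrite /s; field.
  have s01 : 0 < s <= 1 by rewrite /s; apply/andP; split; lra.
  have sn : s / 2 <= sin s by apply: half_le_sin; lra.
  have sn0 : 0 < sin s by apply: lt_le_trans sn; lra.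
  have hc := conj_fejer_closed n s.
  (* The closed form divided by [2 * n * sin s ^+ 2]: half a cotangent and an oscillating
     remainder. *)
  have -> : conj_fejer n u / 2 =
      cos s / (2 * sin s) - sin (2 * n%:R * s) / (4 * n%:R * sin s ^+ 2).
    apply: (@mulfI _ (2 * n%:R * sin s ^+ 2)).
      by rewrite !mulf_neq0 ?expf_neq0 ?gt_eqF.
    transitivity (sin s ^+ 2 * (n%:R * conj_fejer n (2 * s))).
      by rewrite -us; field.
    by rewrite hc; field; rewrite !gt_eqF.
  rewrite opprB addrCA addrC (le_trans (ler_normD _ _))// /kernel_gap lerD//.
    by rewrite us inv_sub_half_cot.
  rewrite normrM (ger0_norm (x := (_ * _ * _)^-1)); last first.
    by rewrite invr_ge0 !mulr_ge0 ?sqr_ge0// ltW.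
  have nu1 : 1 <= (n%:R * u) ^+ 2.
    by rewrite expr_ge1// ?mulr_ge0// ?(ltW nR)// -ler_pdivrMl// mulr1 ltW.
  apply: (@le_trans _ _ ((4 * n%:R * sin s ^+ 2)^-1)).
    by rewrite ler_piMl ?sin_max// invr_ge0 !mulr_ge0 ?sqr_ge0// ltW.
  rewrite ler_pdivlMr ?ltr_wpDr// mulrC ler_pdivrMr ?mulr_gt0 ?exprn_gt0//.
  (* Since [n * u >= 1] here, [1 + (n * u) ^+ 2] is at most twice the square; then [u <= 4 * sin s]
     finishes. *)
  apply: (@le_trans _ _ (2 * (n%:R * u) ^+ 2)); first by lra.
  rewrite (_ : 8 * _ * (4 * _ * _) = 2 * (n%:R * (4 * sin s)) ^+ 2); last by ring.
  rewrite ler_pM2l// lerXn2r ?nnegrE ?mulr_ge0 ?(ltW nR) ?(ltW sn0)//.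
  by rewrite ler_pM2l// us; lra.
(* Below 1/n the truncated kernel is zero, half the conjugate kernel is at most n, and the bump is
   at least 4 n. *)
- rewrite sub0r normrN normrM (ger0_norm (x := 2^-1)) ?invr_ge0//.
  have nu1 : (n%:R * u) ^+ 2 <= 1.
    by rewrite expr_le1// ?mulr_ge0// ?(ltW nR)// -ler_pdivlMl// mulr1.
  have := norm_conj_fejer_le n u => hq.
  rewrite /kernel_gap ler_wpDl// (@le_trans _ _ n%:R)//; first by lra.
  rewrite ler_pdivlMr ?ltr_wpDr//; nra.
Qed.

End fejer.

Section smooth_integrals.
Context {R : realType}.
Notation mu := (@lebesgue_measure R).
Implicit Types f F : R -> R.

Lemma continuous_itv_integrable f (a b : R) : continuous f ->
  mu.-integrable `[a, b] (EFin \o f).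
Proof.
move=> cf; apply: continuous_compact_integrable; first exact: segment_compact.
exact: continuous_subspaceT.
Qed.

Lemma smooth_FTC2 f F (a b : R) : a <= b -> continuous f ->
  (forall x : R, is_derive x 1 F (f x)) ->
  \int[mu]_(x in `[a, b]) f x = F b - F a.
Proof.
move=> ab cf dF; have cF : continuous F by move=> x; exact: (isder_continuous (dF x)).
move: ab; rewrite le_eqVlt => /predU1P[->|ab].
  by rewrite set_interval.set_itv1 Rintegral_set1 subrr.
rewrite /Rintegral (@continuous_FTC2 _ f F)//.
- exact: continuous_subspaceT.
- split => [x _||].
  + exact: (isder_derivable (dF x)).
  + apply: cvg_at_right_filter; exact: cF.
  + apply: cvg_at_left_filter; exact: cF.
- by move=> x _; exact: (isder_derive1 (dF x)).
Qed.

End smooth_integrals.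

Lemma sin_natpi {R : realType} k : sin (k%:R * pi) = 0 :> R.
Proof.
elim: k => [|k IH]; first by rewrite mul0r sin0.
by rewrite -natr1 mulrDl mul1r sinDpi IH oppr0.
Qed.

(* With [z = s e^(i th)] and [p = \sum_k (a k - i b k) z^k], the functions
   below are the real and imaginary parts of [p z], and the integrand of
   [mean_exp_harmonic] is the real part of the holomorphic [exp (- i p)]. *)
Section mean_value.
Context {R : realType}.
Notation mu := (@lebesgue_measure R).
Context (n : nat) (a b : nat -> R).
Implicit Types s th : R.

Let U s th := \sum_(k < n) s ^+ k * (a k * cos (k%:R * th) + b k * sin (k%:R * th)).
Let V s th := \sum_(k < n) s ^+ k * (a k * sin (k%:R * th) - b k * cos (k%:R * th)).
Let Us s th := \sum_(k < n) k%:R * s ^+ k.-1 * (a k * cos (k%:R * th) + b k * sin (k%:R * th)).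
Let Vs s th := \sum_(k < n) k%:R * s ^+ k.-1 * (a k * sin (k%:R * th) - b k * cos (k%:R * th)).

Let E s th := expR (V s th) * cos (U s th).
Let Es s th := expR (V s th) * (Vs s th * cos (U s th) - Us s th * sin (U s th)).

Let dsU s th : is_derive s 1 (U^~ th) (Us s th).
Proof.
apply: isder_sum => k.
by isder_auto => /=; rewrite mulr0 add0r mulr1 mulrC.
Qed.

Let dsV s th : is_derive s 1 (V^~ th) (Vs s th).
Proof. by apply: isder_sum => k; isder_auto => /=; rewrite mulr0 add0r mulr1 mulrC. Qed.

Let dsE s th : is_derive s 1 (E^~ th) (Es s th).
Proof.
simple notypeclasses refine (is_derive_eq _ _); [|
  exact: (isder_mul (isder_expR (dsV s th)) (isder_cos (dsU s th)))|].
by rewrite /Es; ring.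
Qed.

Let dtU s th : is_derive th 1 (U s) (- (s * Vs s th)).
Proof.
rewrite /Vs mulr_sumr -sumrN; apply: isder_sum => k.
isder_auto => /=; case: (nat_of_ord k) => [|j] /=; first by ring.
by rewrite exprS; ring.
Qed.

Let dtV s th : is_derive th 1 (V s) (s * Us s th).
Proof.
rewrite /Us mulr_sumr; apply: isder_sum => k.
isder_auto => /=; case: (nat_of_ord k) => [|j] /=; first by ring.
by rewrite exprS; ring.
Qed.

(** A Cauchy-Riemann equation in polar form: the angular derivative of the conjugate function is
    [- s] times the radial derivative [Es]. *)
Let dtG s th :
  is_derive th 1 (fun t => expR (V s t) * sin (U s t)) (- (s * Es s th)).
Proof.
simple notypeclasses refine (is_derive_eq _ _); [|
  exact: (isder_mul (isder_expR (dtV s th)) (isder_sin (dtU s th)))|].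
by rewrite /Es; ring.
Qed.

(** A common bound on the disc of radius 2, which leaves room around the segment from 0 to 1 for
    differentiating under the integral. *)
Let M := \sum_(k < n) (k%:R + 1) * 2 ^+ k * (`|a k| + `|b k|).

Let M0 : 0 <= M.
Proof.
by apply: sumr_ge0 => k _; rewrite !mulr_ge0 ?addr_ge0 ?exprn_ge0.
Qed.

Let trig_bound (x y c d : R) : `|c| <= 1 -> `|d| <= 1 ->
  `|x * c + y * d| <= `|x| + `|y|.
Proof.
move=> c1 d1; rewrite (le_trans (ler_normD _ _))// !normrM lerD//.
  by rewrite ler_piMr.
by rewrite ler_piMr.
Qed.

Let term_bound (k : nat) (s c r : R) : `|s| <= 2 -> `|c| <= r -> 0 <= r ->
  `|s ^+ k * c| <= (k%:R + 1) * 2 ^+ k * r /\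
  `|k%:R * s ^+ k.-1 * c| <= (k%:R + 1) * 2 ^+ k * r.
Proof.
move=> s2 cr r0; split.
  rewrite normrM ler_pM// normrX (@le_trans _ _ (2 ^+ k))//.
    by rewrite lerXn2r// nnegrE.
  by rewrite ler_peMl// lerDr.
rewrite !normrM ler_pM// (ger0_norm (x := k%:R))// ler_pM// ?lerDl// normrX.
apply: (@le_trans _ _ (2 ^+ k.-1)); first by rewrite lerXn2r// nnegrE.
by rewrite ler_weXn2l// ?leq_pred// ler1n.
Qed.

Let boundU s th : `|s| <= 2 -> `|U s th| <= M /\ `|Us s th| <= M.
Proof.
move=> s2; split; rewrite (le_trans (ler_norm_sum _ _ _))//; apply: ler_sum => k _.
- apply: (term_bound k s2 _ _).1; last by rewrite addr_ge0.
  by apply: trig_bound; rewrite ?cos_max ?sin_max.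
- apply: (term_bound k s2 _ _).2; last by rewrite addr_ge0.
  by apply: trig_bound; rewrite ?cos_max ?sin_max.
Qed.

Let boundV s th : `|s| <= 2 -> `|V s th| <= M /\ `|Vs s th| <= M.
Proof.
move=> s2; split; rewrite (le_trans (ler_norm_sum _ _ _))//; apply: ler_sum => k _.
- apply: (term_bound k s2 _ _).1; last by rewrite addr_ge0.
  by rewrite -mulNr -(normrN (b k)); apply: trig_bound; rewrite ?cos_max ?sin_max.
- apply: (term_bound k s2 _ _).2; last by rewrite addr_ge0.
  by rewrite -mulNr -(normrN (b k)); apply: trig_bound; rewrite ?cos_max ?sin_max.
Qed.

Let boundEs s th : `|s| <= 2 -> `|Es s th| <= expR M * (2 * M).
Proof.
move=> s2; have [v1 v2] := boundV th s2; have [u1 u2] := boundU th s2.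
rewrite /Es normrM ler_pM//.
  by rewrite ger0_norm ?expR_ge0// ler_expR (le_trans (ler_norm _)).
rewrite -mulNr (le_trans (trig_bound _ _ (cos_max _) (sin_max _)))// normrN.
lra.
Qed.

Let continuousV s : continuous (V s).
Proof. by move=> th; exact: (isder_continuous (dtV s th)). Qed.

Let continuousU s : continuous (U s).
Proof. by move=> th; exact: (isder_continuous (dtU s th)). Qed.

Let continuousE s : continuous (E s).
Proof.
move=> th.
exact: (isder_continuous (isder_mul (isder_expR (dtV s th)) (isder_cos (dtU s th)))).
Qed.

Let dtUs s th : exists d : R, is_derive th 1 (Us s) d.
Proof.
by eexists; simple notypeclasses refine (isder_sum _ _) => k; repeat isder_step.
Qed.

Let dtVs s th : exists d : R, is_derive th 1 (Vs s) d.
Proof.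
by eexists; simple notypeclasses refine (isder_sum _ _) => k; repeat isder_step.
Qed.

Let continuousEs s : continuous (Es s).
Proof.
move=> th; have [us dus] := dtUs s th; have [vs dvs] := dtVs s th.
have dv := dtV s th; have du := dtU s th.
exact: (isder_continuous (isder_mul (isder_expR dv) (isder_add
  (isder_mul dvs (isder_cos du)) (isder_opp (isder_mul dus (isder_sin du)))))).
Qed.

Let I s := \int[mu]_(th in `[- pi, pi]) E s th.

(** [- s * Es] is the angular derivative of a function taking equal values at [- pi] and [pi]. The
    factor [s] stays, since the identity is empty at 0; it is cancelled later at a positive
    radius. *)
Let intEs0 s : s * \int[mu]_(th in `[- pi, pi]) Es s th = 0.
Proof.
have npi : - pi <= pi :> R by rewrite ge0_cp// pi_ge0.
apply: oppr_inj; rewrite oppr0 -mulNr -RintegralZl//; last first.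
  exact: continuous_itv_integrable.
have hder (th : R) :
    is_derive th 1 (fun t => expR (V s t) * sin (U s t)) (- s * Es s th).
  by rewrite mulNr.
have hc : continuous (fun th => - s * Es s th).
  by move=> th; apply: cvgM; [exact: cvg_cst|exact: continuousEs].
rewrite (smooth_FTC2 npi hc hder).
have -> : U s (- pi) = U s pi.
  apply: eq_bigr => k _; rewrite mulrN cosN sinN sin_natpi !mulr0 oppr0 mulr0.
  by rewrite !addr0.
have -> : V s (- pi) = V s pi.
  by apply: eq_bigr => k _; rewrite mulrN cosN sinN sin_natpi oppr0.
by rewrite subrr.
Qed.

Let dI s : `|s| < 2 -> is_derive s 1 I (\int[mu]_(th in `[- pi, pi]) Es s th).
Proof.
move=> s2; have Is : `]-2, 2[%classic s by rewrite /= in_itv/= -ltr_norml.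
have h1 : measurable (`[- pi, pi]%classic : set (measurableTypeR R)) by [].
have h2 x : `]-2, 2[%classic x ->
    mu.-integrable `[- pi, pi] (EFin \o E x).
  by move=> _; exact: continuous_itv_integrable.
have h3 x y : `]-2, 2[%classic x -> `[- pi, pi]%classic y -> derivable (E ^~ y) x 1.
  by move=> _ _; exact: (isder_derivable (dsE x y)).
have h4 (y : R) : 0 <= expR M * (2 * M) by rewrite !mulr_ge0// expR_ge0.
have h5 : mu.-integrable `[- pi, pi] (EFin \o (fun y : R => expR M * (2 * M))).
  by apply: continuous_itv_integrable; exact: cst_continuous.
have h6 x y : `]-2, 2[%classic x -> `[- pi, pi]%classic y ->
    `|partial1of2 E x y| <= expR M * (2 * M).
  rewrite /= in_itv/= -ltr_norml => x2 _.
  by rewrite /partial1of2 (isder_derive1 (dsE x y)) boundEs// ltW.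
split; first exact: (derivable_under_integral h1 Is h2 h3 h4 h5 h6).
rewrite -derive1E (differentiation_under_integral h1 Is h2 h3 h4 h5 h6).
by apply: eq_Rintegral => y _; rewrite /partial1of2 (isder_derive1 (dsE s y)).
Qed.

(** The circle means of a harmonic function do not depend on the radius: their derivative vanishes
    at every positive radius below 2, so radius 1 may be replaced by radius 0. *)
Lemma mean_exp_harmonic :
  \int[mu]_(th in `[- pi, pi])
    (expR (\sum_(k < n) (a k * sin (k%:R * th) - b k * cos (k%:R * th))) *
     cos (\sum_(k < n) (a k * cos (k%:R * th) + b k * sin (k%:R * th)))) =
  2 * pi * (if n is 0%N then 1 else expR (- b 0%N) * cos (a 0%N)).
Proof.
transitivity (I 1).
  apply: eq_Rintegral => th _; rewrite /E /U /V.
  by congr (expR _ * cos _); apply: eq_bigr => k _; rewrite expr1n mul1r.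
have -> : I 1 = I 0.
  apply/eqP; rewrite -subr_eq0.
  have [//|c||c] := @MVT R I (fun s => \int[mu]_(th in `[- pi, pi]) Es s th) 0 1.
  - rewrite in_itv/= => /andP[c0 c1]; apply: dI.
    by rewrite ger0_norm ?(ltW c0)// (lt_trans c1)// ltr1n.
  - apply: derivable_within_continuous => x; rewrite in_itv/= => /andP[x0 x1].
    by apply: (isder_derivable (dI _)); rewrite ger0_norm// (le_lt_trans x1)// ltr1n.
  - rewrite in_itv/= => /andP[c0 _] ->; rewrite subr0 mulr1.
    by have /eqP := intEs0 c; rewrite mulf_eq0 gt_eqF.
(* At radius 0 only frequency 0 survives, because [0 ^+ 0 = 1]; for [n = 0] both sums are empty. *)
transitivity (\int[mu]_(th in `[- pi, pi])
    (if n is 0%N then 1 else expR (- b 0%N) * cos (a 0%N)) : R).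
  apply: eq_Rintegral => th _; rewrite /E /U /V.
  case: n => [|m]; first by rewrite !big_ord0 expR0 cos0 mulr1.
  rewrite !big_ord_recl /= !big1 ?addr0 ?mul0r ?expr0 ?cos0 ?sin0.
  - by rewrite !mul1r !mulr0 !mulr1 add0r addr0.
  - by move=> i _; rewrite expr0n/= mul0r.
  - by move=> i _; rewrite expr0n/= mul0r.
rewrite Rintegral_cst// mulrC; congr *%R.
have /= -> := @lebesgue_measure_itv R `[- pi, pi]%R.
have npi : - pi < pi :> R by have := pi_gt0 R; lra.
by rewrite lte_fin npi/= opprK; ring.
Qed.

End mean_value.

(** * Integration lemmas *)

Section integrable_bounded.
Context d {T : measurableType d} {R : realType} (mu : {measure set T -> \bar R}).
Implicit Types (A : set T) (f h : T -> R).

Lemma integrable_EFin_measurable A f :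
  mu.-integrable A (EFin \o f) -> measurable_fun A f.
Proof. by move=> /integrableP[/measurable_EFinP]. Qed.

Lemma integrable_mul_bounded A f h (C : R) : measurable A ->
  mu.-integrable A (EFin \o f) -> measurable_fun A h ->
  (forall x, A x -> `|h x| <= C) ->
  mu.-integrable A (fun x => (f x * h x)%:E).
Proof.
move=> mA intf mh hC; have mf := integrable_EFin_measurable intf.
apply: (@le_integrable _ _ _ mu _ mA _ (fun x => (C%:E * (f x)%:E)%E)).
- exact/measurable_EFinP/measurable_funM.
- move=> x Ax; rewrite -EFinM/= lee_fin !normrM [leRHS]mulrC.
  by rewrite ler_wpM2l// (le_trans (hC x Ax))// ler_norm.
- exact: integrableZl.
Qed.

Lemma integrable_bounded A h (C : R) : measurable A -> (mu A < +oo)%E ->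
  measurable_fun A h -> (forall x, A x -> `|h x| <= C) ->
  mu.-integrable A (EFin \o h).
Proof.
move=> mA Aoo mh hC; apply: measurable_bounded_integrable => //.
exists C; split; first by rewrite num_real.
by move=> M CM x Ax; exact: le_trans (hC x Ax) (ltW CM).
Qed.

Lemma integrable_le A f h : measurable A -> mu.-integrable A (EFin \o f) ->
  measurable_fun A h -> (forall x, A x -> `|h x| <= f x) ->
  mu.-integrable A (EFin \o h).
Proof.
move=> mA intf mh hf; apply: le_integrable intf => //.
  exact/measurable_EFinP.
by move=> x Ax; rewrite lee_fin (le_trans (hf x Ax))// ler_norm.
Qed.

Lemma integrable_add A f h : measurable A -> mu.-integrable A (EFin \o f) ->
  mu.-integrable A (EFin \o h) -> mu.-integrable A (fun x => (f x + h x)%:E).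
Proof. by move=> mA fi hi; apply: eq_integrable (integrableD mA fi hi). Qed.

Lemma integrable_sub A f h : measurable A -> mu.-integrable A (EFin \o f) ->
  mu.-integrable A (EFin \o h) -> mu.-integrable A (fun x => (f x - h x)%:E).
Proof. by move=> mA fi hi; apply: eq_integrable (integrableB mA fi hi). Qed.

Lemma integrable_scale A f (c : R) : measurable A ->
  mu.-integrable A (EFin \o f) -> mu.-integrable A (fun x => (c * f x)%:E).
Proof. by move=> mA fi; apply: eq_integrable (integrableZl mA c fi). Qed.

Lemma integrable_ext A f h : measurable A -> (forall x, A x -> f x = h x) ->
  mu.-integrable A (EFin \o f) -> mu.-integrable A (EFin \o h).
Proof.
move=> mA fh; apply: eq_integrable => // x xA.
by rewrite /= fh//; exact: set_mem.
Qed.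

End integrable_bounded.

(** * Fubini's theorem for a bounded kernel between two integrable functions *)

Section kernel_fubini.
Context d1 d2 {T1 : measurableType d1} {T2 : measurableType d2} {R : realType}.
Context (m1 : {sigma_finite_measure set T1 -> \bar R})
          (m2 : {sigma_finite_measure set T2 -> \bar R}).
Context (A : set T1) (B : set T2) (f : T1 -> R) (g : T2 -> R)
          (K : T1 -> T2 -> R) (C : R).
Context (mA : measurable A) (mB : measurable B)
  (intf : m1.-integrable A (EFin \o f)) (intg : m2.-integrable B (EFin \o g))
  (mK : measurable_fun setT (fun z : T1 * T2 => K z.1 z.2))
  (KC : forall x y, `|K x y| <= C).

(** Extension by zero turns the integrals over [A] and [B] into integrals over the whole spaces. *)
Let F (z : T1 * T2) : \bar R := ((f \_ A) z.1 * ((g \_ B) z.2 * K z.1 z.2))%:E.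

Let intfA : m1.-integrable setT (EFin \o (f \_ A)).
Proof. by rewrite -restrict_EFin; exact: (integrable_mkcond _ mA).1. Qed.

Let intgB : m2.-integrable setT (EFin \o (g \_ B)).
Proof. by rewrite -restrict_EFin; exact: (integrable_mkcond _ mB).1. Qed.

Let measurable_section1 x : measurable_fun setT (K x).
Proof. exact: (measurableT_comp mK (measurable_pair1 x)). Qed.

Let measurable_section2 y : measurable_fun setT (K ^~ y).
Proof. exact: (measurableT_comp mK (measurable_pair2 y)). Qed.

Let intgK x : m2.-integrable setT (fun y => ((g \_ B) y * K x y)%:E).
Proof. exact: (@integrable_mul_bounded _ _ _ _ _ _ _ C). Qed.

Let intfK y : m1.-integrable setT (fun x => ((f \_ A) x * K x y)%:E).
Proof. exact: (@integrable_mul_bounded _ _ _ _ _ _ _ C). Qed.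

Let measurableF : measurable_fun setT F.
Proof.
have mf := integrable_EFin_measurable intfA.
have mg := integrable_EFin_measurable intgB.
apply/measurable_EFinP; apply: measurable_funM.
  exact: measurableT_comp mf measurable_fst.
apply: measurable_funM => //.
exact: measurableT_comp mg measurable_snd.
Qed.

Let C0 : (exists x : T1 * T2, True) -> 0 <= C.
Proof. by move=> [[x y] _]; exact: le_trans (KC x y). Qed.

Let integrableF : (m1 \x m2)%E.-integrable setT F.
Proof.
apply/integrable12ltyP; first exact: measurableF.
pose N := (\int[m2]_y `|((g \_ B) y)%:E|)%E.
have Nfin : (N < +oo)%E by move: intgB => /integrableP[].
have N0 : (0 <= N)%E by exact: integral_ge0.
apply: (@le_lt_trans _ _ (\int[m1]_x (`|(f \_ A) x|%:E * (`|C|%:E * N)))%E).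
  apply: ge0_le_integral => //.
  - by move=> x _; exact: integral_ge0.
  - apply: (@measurable_fun_fubini_tonelli_F _ _ _ _ _ _ (abse \o F)).
      exact: measurableT_comp.
    by move=> z; rewrite /F/= lee_fin.
  - apply: emeasurable_funM => //; apply/measurable_EFinP.
    apply: measurableT_comp => //; exact: integrable_EFin_measurable intfA.
  - move=> x _; rewrite /F/=.
    have mg : measurable_fun setT (fun y => `|((g \_ B) y)%:E|%E).
      by apply: measurableT_comp => //; exact: measurable_int intgB.
    have -> : (`|(f \_ A) x|%:E * (`|C|%:E * N) =
        \int[m2]_y (`|(f \_ A) x|%:E * (`|C|%:E * `|((g \_ B) y)%:E|)))%E.
      rewrite ge0_integralZl//; last by apply: measurable_funeM.
      by rewrite ge0_integralZl// lee_fin.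
    apply: ge0_le_integral => //.
    + apply/measurable_EFinP; apply: measurableT_comp => //.
      apply: measurable_funM => //.
      exact: (@integrable_EFin_measurable _ _ _ _ _
        (fun y => (g \_ B) y * K x y) (intgK x)).
    + by do 2 apply: measurable_funeM.
    + move=> y _; rewrite -!EFinM lee_fin !normrM ler_wpM2l// mulrC ler_wpM2r//.
      by rewrite (le_trans (KC x y))// ler_norm.
under eq_integral do rewrite muleC.
rewrite ge0_integralZl ?mule_ge0 ?lee_fin//; last first.
  apply/measurable_EFinP; apply: measurableT_comp => //.
  exact: integrable_EFin_measurable intfA.
rewrite lte_mul_pinfty//.
- by rewrite mule_ge0// lee_fin.
- by rewrite fin_numM// ge0_fin_numE.
- by move: intfA => /integrableP[].
Qed.

Let inner1 x : (\int[m2]_y F (x, y) = ((f \_ A) x * \int[m2]_(y in B) (g y * K x y))%:E)%E.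
Proof.
rewrite /F/=; under eq_integral do rewrite EFinM.
rewrite integralZl// EFinM; congr (_ * _)%E.
rewrite /Rintegral [in RHS]integral_mkcond fineK.
  apply: eq_integral => y _; rewrite !patchE; case: ifP => //; rewrite mul0r//.
have := integrable_fin_num measurableT (intgK x).
rewrite (_ : (\int[m2]_x0 _)%E = (\int[m2]_x0 ((fun y => (g y * K x y)%:E) \_ B) x0)%E)//.
by apply: eq_integral => y _; rewrite !patchE; case: ifP => //; rewrite mul0r//.
Qed.

Let inner2 y : (\int[m1]_x F (x, y) = ((g \_ B) y * \int[m1]_(x in A) (f x * K x y))%:E)%E.
Proof.
rewrite /F/=; under eq_integral do rewrite mulrCA EFinM.
rewrite integralZl// EFinM; congr (_ * _)%E.
rewrite /Rintegral [in RHS]integral_mkcond fineK.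
  apply: eq_integral => x _; rewrite !patchE; case: ifP => //; rewrite mul0r//.
have := integrable_fin_num measurableT (intfK y).
rewrite (_ : (\int[m1]_x0 _)%E = (\int[m1]_x0 ((fun x => (f x * K x y)%:E) \_ A) x0)%E)//.
by apply: eq_integral => x _; rewrite !patchE; case: ifP => //; rewrite mul0r//.
Qed.

Lemma kernel_integrable :
  m1.-integrable A (fun x => (f x * \int[m2]_(y in B) (g y * K x y))%:E).
Proof.
apply/(integrable_mkcond _ mA).
have := integrable_fubini_F integrableF.
apply: eq_integrable => // x _; rewrite /fubini_F inner1 !patchE.
by case: ifP => //; rewrite mul0r.
Qed.

Lemma kernel_fubini :
  \int[m1]_(x in A) (f x * \int[m2]_(y in B) (g y * K x y)) =
  \int[m2]_(y in B) (g y * \int[m1]_(x in A) (f x * K x y)).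
Proof.
have := Fubini integrableF.
under eq_integral do rewrite inner1.
under [in RHS]eq_integral do rewrite inner2.
move=> h; rewrite /Rintegral integral_mkcond [in RHS]integral_mkcond; congr fine.
transitivity (\int[m1]_x ((f \_ A) x * \int[m2]_(y in B) (g y * K x y))%:E)%E.
  by apply: eq_integral => x _; rewrite !patchE; case: ifP => //; rewrite mul0r.
rewrite h.
by apply: eq_integral => x _; rewrite !patchE; case: ifP => //; rewrite mul0r.
Qed.

End kernel_fubini.

Section interval_integrals.
Context {R : realType}.
Notation mu := (@lebesgue_measure R).

Lemma measurable_I11 : measurable (@I11 R : set (measurableTypeR R)).
Proof. by rewrite /I11; exact: measurable_itv. Qed.

Lemma mu_I11 : mu (@I11 R) = 2%:E.
Proof.
have /= -> := @lebesgue_measure_itv R `]-1, 1[%R.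
by rewrite lte_fin -subr_gt0 opprK addr_gt0//= -EFinB opprK.
Qed.

Lemma mu_I11_fin : (mu (@I11 R) < +oo)%E.
Proof. by rewrite mu_I11 ltry. Qed.

Lemma Rintegral_cst_I11 (c : R) : \int[mu]_(x in @I11 R) c = c * 2.
Proof.
rewrite (Rintegral_cst _ measurable_I11).
by rewrite [X in fine X](_ : _ = 2%:E)//; exact: mu_I11.
Qed.

Lemma I11P (x : R) : I11 x <-> -1 < x < 1.
Proof. by rewrite /I11/= in_itv. Qed.

Lemma Rintegral_sum d (T : measurableType d) (m : {measure set T -> \bar R})
    (A : set T) (s : seq nat) (F : nat -> T -> R) : measurable A ->
  (forall k, m.-integrable A (EFin \o F k)) ->
  \int[m]_(x in A) (\sum_(k <- s) F k x) = \sum_(k <- s) \int[m]_(x in A) F k x.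
Proof.
move=> mA FI; have SI s' : m.-integrable A (EFin \o (fun x => \sum_(k <- s') F k x)).
  elim: s' => [|k s' IH].
    apply: eq_integrable (integrable0 m A) => // x _ /=.
    by rewrite big_nil.
  apply: eq_integrable (integrable_add mA (FI k) IH) => // x _ /=.
  by rewrite big_cons.
elim: s => [|k s IH].
  rewrite big_nil; under eq_Rintegral do rewrite big_nil.
  by rewrite Rintegral_cst// mul0r.
rewrite big_cons -IH -RintegralD//.
by apply: eq_Rintegral => x _; rewrite big_cons.
Qed.

Lemma ge0_subset_Rintegral (A B : set R) (f : R -> R) :
  measurable (A : set (measurableTypeR R)) ->
  measurable (B : set (measurableTypeR R)) ->
  mu.-integrable B (EFin \o f) -> (forall x, B x -> 0 <= f x) -> A `<=` B ->
  \int[mu]_(x in A) f x <= \int[mu]_(x in B) f x.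
Proof.
move=> mA mB fI f0 AB; apply: fine_le.
- by apply: integrable_fin_num => //; apply: integrableS fI.
- exact: integrable_fin_num.
- by apply: ge0_subset_integral => //; exact: measurable_int fI.
Qed.

Lemma I11_sub_pi : @I11 R `<=` `[- pi, pi].
Proof.
move=> x /I11P /andP[x1 x2]; rewrite /= in_itv/=.
by have := pi_ge2 R => ?; apply/andP; split; lra.
Qed.

Lemma npi_le_pi : - pi <= pi :> R.
Proof. by have := pi_gt0 R => ?; lra. Qed.

Lemma mu_pi : mu `[- pi, pi] = (2 * pi)%:E.
Proof.
have /= -> := @lebesgue_measure_itv R `[- pi, pi]%R.
have npi : - pi < pi :> R by have := pi_gt0 R; lra.
by rewrite lte_fin npi/= -EFinB opprK; congr EFin; ring.
Qed.

End interval_integrals.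

Section fejer_mean.
Context {R : realType}.
Notation mu := (@lebesgue_measure R).

Lemma continuous_cosM (c : R) : continuous (fun x : R => cos (c * x)).
Proof.
move=> x; have d : is_derive x 1 (fun x : R => cos (c * x)) (- sin (c * x) * c).
  by isder_auto => /=; ring.
exact: (isder_continuous d).
Qed.

Lemma continuous_sinM (c : R) : continuous (fun x : R => sin (c * x)).
Proof.
move=> x; have d : is_derive x 1 (fun x : R => sin (c * x)) (cos (c * x) * c).
  by isder_auto => /=; ring.
exact: (isder_continuous d).
Qed.

Lemma fejerN n (u : R) : fejer n (- u) = fejer n u.
Proof. by apply: eq_bigr => k _; rewrite mulrN cosN. Qed.

Lemma continuous_fejer n (c : R) : continuous (fun x : R => fejer n (x - c)).
Proof.
have d (x : R) : exists d : R, is_derive x 1 (fun x : R => fejer n (x - c)) d.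
  by eexists; simple notypeclasses refine (isder_sum _ _) => k; repeat isder_step.
by move=> x; have [d' dx] := d x; exact: (isder_continuous dx).
Qed.

Lemma continuous_conj_fejer n (c : R) :
  continuous (fun x : R => conj_fejer n (x - c)).
Proof.
have d (x : R) : exists d : R, is_derive x 1 (fun x : R => conj_fejer n (x - c)) d.
  by eexists; simple notypeclasses refine (isder_sum _ _) => k; repeat isder_step.
by move=> x; have [d' dx] := d x; exact: (isder_continuous dx).
Qed.

Lemma fejer_mean n (c : R) : (0 < n)%N ->
  \int[mu]_(x in `[- pi, pi]) fejer n (x - c) = 2 * pi.
Proof.
move=> n0.
(* A primitive, term by term. Frequency 0 contributes [x], hence the value [2 * pi]; the others are
   periodic and cancel. *)
pose F k (x : R) := if k == 0%N then x else
   fejer_weight n k * (sin (k%:R * (x - c)) / k%:R).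
have dF (x : R) : is_derive x 1 (fun x => \sum_(k < n) F k x) (fejer n (x - c)).
  apply: isder_sum => -[k kn] /=; rewrite /F /fejer_weight.
  case: k kn => [|k] kn /=.
    by rewrite mul0r cos0 mulr1; exact: isder_id.
  by isder_auto => /=; field; rewrite ?pnatr_eq0 -?lt0n ?n0/= nat1r pnatr_eq0.
rewrite (smooth_FTC2 npi_le_pi (@continuous_fejer n c) dF).
clear dF; case: n n0 @F => // n _ F; rewrite !big_ord_recl /= opprD addrACA -sumrB.
rewrite big1 ?addr0; first by rewrite opprK; ring.
move=> [k kn] _; rewrite /F /=; set j := bump 0 k.
have -> : sin (j%:R * (- pi - c)) = sin (j%:R * (pi - c)).
  by rewrite 2!mulrBr mulrN !sinB sinN cosN sin_natpi oppr0 !mul0r.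
by rewrite subrr.
Qed.

Lemma isder_kernel_gap n (t x : R) :
  is_derive x 1 (fun x => x + 8 * atan (n%:R * (x - t))) (kernel_gap n (x - t)).
Proof. by isder_auto => /=; rewrite /kernel_gap; ring. Qed.

Lemma continuous_kernel_gap n (t : R) : continuous (fun x : R => kernel_gap n (x - t)).
Proof.
have d (x : R) : exists d : R, is_derive x 1 (fun x : R => kernel_gap n (x - t)) d.
  eexists; repeat isder_step.
  by rewrite gt_eqF// ltr_wpDr// sqr_ge0.
by move=> x; have [d' dx] := d x; exact: (isder_continuous dx).
Qed.

(** The 2 is the length of the interval, and [8 * pi] bounds the increase of [8 * atan] whatever [n]
    and [t] are. *)
Lemma kernel_gap_integral_le n (t : R) :
  \int[mu]_(x in @I11 R) kernel_gap n (x - t) <= 2 + 8 * pi.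
Proof.
have I1 : @I11 R `<=` `[-1, 1].
  by move=> x /I11P /andP[x1 x2]; rewrite /= in_itv/= !ltW.
have gapI := continuous_itv_integrable (-1) 1 (@continuous_kernel_gap n t).
apply: (@le_trans _ _ (\int[mu]_(x in `[-1, 1]) kernel_gap n (x - t))).
  apply: ge0_subset_Rintegral => //; first exact: measurable_I11.
  by move=> x _; exact: kernel_gap_ge0.
have n11 : -1 <= 1 :> R by lra.
rewrite (smooth_FTC2 n11 (@continuous_kernel_gap n t) (isder_kernel_gap n t)).
have := atan_ltpi2 (n%:R * (1 - t)); have := atan_gtNpi2 (n%:R * (-1 - t)).
lra.
Qed.

End fejer_mean.

(** * The truncated Hilbert transform and its exponential integrability *)

Section truncated_kernel.
Context {R : realType}.
Notation mu := (@lebesgue_measure R).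
Notation RT := (measurableTypeR R).

Lemma measurable_invr : measurable_fun setT (fun x : R => x^-1).
Proof.
(* The inverse is continuous only off 0, where it takes the default value 0; the singleton is
   treated apart. *)
have -> : [set: R] = [set x | x != 0] `|` [set 0].
  by apply/seteqP; split => // x _ /=; have [->|] := eqVneq x 0; [right|left].
have o : open [set x : R | x != 0].
  have -> : [set x : R | x != 0] = ~` [set 0].
    by apply/seteqP; split => x /=; [move=> /eqP|move=> /eqP].
  exact/closed_openC/closed_eq.
apply/measurable_funU.
- exact: open_measurable.
- exact: measurable_set1.
- split; last exact: measurable_fun_set1.
  apply: open_continuous_measurable_fun => // x; rewrite inE/= => x0.
  exact: inv_continuous.
Qed.

Lemma measurable_trunc_inv (e : R) : measurable_fun setT (trunc_inv e).
Proof.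
apply: measurable_fun_ifT; [|exact: measurable_invr|exact: measurable_cst].
by apply: measurable_fun_ltr => //; exact: normr_measurable.
Qed.

Lemma measurable_fun_translates (k : R -> R) : measurable_fun setT k ->
  measurable_fun setT (fun z : RT * RT => k (z.2 - z.1)).
Proof.
move=> mk; apply: (measurableT_comp mk).
by apply: measurable_funB; [exact: measurable_snd|exact: measurable_fst].
Qed.

Lemma measurable_translate (k : R -> R) (t : R) : measurable_fun setT k ->
  measurable_fun setT (fun x : R => k (x - t)).
Proof.
move=> mk; apply: (measurableT_comp mk).
by apply: measurable_funB => //; exact: measurable_cst.
Qed.

Lemma norm_trunc_inv_le (e u : R) : 0 < e -> `|trunc_inv e u| <= e^-1.
Proof.
move=> e0; rewrite /trunc_inv; case: ifPn => [eu|_].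
  by rewrite normrV ?unitfE -?normr_gt0 ?(lt_trans e0)// lef_pV2 ?posrE ?ltW//
    (lt_trans e0).
by rewrite normr0 invr_ge0 ltW.
Qed.

(** The truncation sits in the kernel, so the domain depends neither on [e] nor on [t], as Fubini
    requires; [trunc_hilbert_split] recovers the two intervals. *)
Definition rtrunc_hilbert (e : R) (f : R -> R) (t : R) : R :=
  pi^-1 * \int[mu]_(x in @I11 R) (f x * trunc_inv e (x - t)).

Lemma integrable_trunc_hilbert (e : R) (f : R -> R) (t : R) : 0 < e ->
  mu.-integrable (@I11 R) (EFin \o f) ->
  mu.-integrable (@I11 R) (fun x => (f x * trunc_inv e (x - t))%:E).
Proof.
move=> e0 fI; apply: (@integrable_mul_bounded _ _ _ _ _ _ _ e^-1) => //.
- exact: measurable_I11.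
- by apply: measurable_funTS; apply: measurable_translate; exact: measurable_trunc_inv.
- by move=> x _; exact: norm_trunc_inv_le.
Qed.

Lemma trunc_hilbert_mul_integrable (e : R) (f g : R -> R) : 0 < e ->
  mu.-integrable (@I11 R) (EFin \o f) -> mu.-integrable (@I11 R) (EFin \o g) ->
  mu.-integrable (@I11 R) (fun t => (g t * rtrunc_hilbert e f t)%:E).
Proof.
move=> e0 fI gI.
have := @kernel_integrable _ _ RT RT R mu mu (@I11 R) (@I11 R) g f
  (fun t x => trunc_inv e (x - t)) e^-1 measurable_I11 measurable_I11 gI fI
  (measurable_fun_translates (measurable_trunc_inv e))
  (fun t x => norm_trunc_inv_le (x - t) e0).
move=> /(integrable_scale pi^-1 measurable_I11).
apply: integrable_ext; first exact: measurable_I11.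
by move=> t _; rewrite /rtrunc_hilbert mulrCA.
Qed.

Lemma measurable_trunc_hilbert (e : R) (f : R -> R) : 0 < e ->
  mu.-integrable (@I11 R) (EFin \o f) ->
  measurable_fun (@I11 R) (rtrunc_hilbert e f).
Proof.
move=> e0 fI.
have i1 : mu.-integrable (@I11 R) (EFin \o (fun _ : R => 1)).
  apply: (@integrable_bounded _ _ _ _ _ _ 1) => //.
  - exact: measurable_I11.
  - exact: mu_I11_fin.
  - by move=> x _; rewrite normr1.
have /integrable_EFin_measurable := trunc_hilbert_mul_integrable e0 fI i1.
by under eq_fun do rewrite mul1r.
Qed.

Let RintegralZ (c : R) (F : R -> R) :
  mu.-integrable (@I11 R) (fun x => (F x)%:E) ->
  \int[mu]_(x in @I11 R) (c * F x) = c * \int[mu]_(x in @I11 R) F x.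
Proof. exact: (RintegralZl c measurable_I11). Qed.

(** The kernel is odd, so exchanging its two variables costs a sign; this is the source of the
    skew-symmetry. *)
Lemma trunc_hilbert_odd (e : R) (g : R -> R) (x : R) : 0 < e ->
  mu.-integrable (@I11 R) (EFin \o g) ->
  pi^-1 * \int[mu]_(t in @I11 R) (g t * trunc_inv e (x - t)) =
  - rtrunc_hilbert e g x.
Proof.
move=> e0 gI; rewrite /rtrunc_hilbert -mulrN -mulN1r.
have <- := RintegralZ (- 1) (integrable_trunc_hilbert x e0 gI).
congr (_ * _); apply: eq_Rintegral => y _.
by rewrite mulN1r -mulrN -trunc_invN opprB.
Qed.

Lemma trunc_hilbert_parseval (e : R) (f g : R -> R) : 0 < e ->
  mu.-integrable (@I11 R) (EFin \o f) -> mu.-integrable (@I11 R) (EFin \o g) ->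
  \int[mu]_(t in @I11 R) (g t * rtrunc_hilbert e f t) =
  - \int[mu]_(x in @I11 R) (f x * rtrunc_hilbert e g x).
Proof.
have pi0 : pi != 0 :> R by rewrite gt_eqF// pi_gt0.
move=> e0 fI gI.
have mK := measurable_fun_translates (measurable_trunc_inv e).
have KC := fun t x : R => norm_trunc_inv_le (x - t) e0.
have h := @kernel_fubini _ _ RT RT R mu mu (@I11 R) (@I11 R) g f
  (fun t x => trunc_inv e (x - t)) e^-1 measurable_I11 measurable_I11 gI fI mK KC.
have gfI := trunc_hilbert_mul_integrable e0 fI gI.
have fgI := trunc_hilbert_mul_integrable e0 gI fI.
have e1 t : g t * rtrunc_hilbert e f t =
    pi^-1 * (g t * \int[mu]_(x in @I11 R) (f x * trunc_inv e (x - t))).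
  by rewrite /rtrunc_hilbert mulrCA.
have e2 x : f x * rtrunc_hilbert e g x = - pi^-1 *
    (f x * \int[mu]_(t in @I11 R) (g t * trunc_inv e (x - t))).
  by rewrite mulNr [pi^-1 * (f x * _)]mulrCA (trunc_hilbert_odd x e0 gI) mulrN opprK.
have {}gfI : mu.-integrable (@I11 R)
    (fun t => (pi * (g t * rtrunc_hilbert e f t))%:E).
  exact: (integrable_scale pi measurable_I11 gfI).
have {}fgI : mu.-integrable (@I11 R)
    (fun x => (- pi * (f x * rtrunc_hilbert e g x))%:E).
  exact: (integrable_scale (- pi) measurable_I11 fgI).
transitivity (pi^-1 * \int[mu]_(t in @I11 R) (pi * (g t * rtrunc_hilbert e f t))).
  rewrite -(RintegralZ pi^-1 gfI); apply: eq_Rintegral => t _.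
  by rewrite (mulKf pi0).
transitivity (pi^-1 * \int[mu]_(x in @I11 R) (- pi * (f x * rtrunc_hilbert e g x))).
  congr *%R.
  transitivity (\int[mu]_(t in @I11 R)
      (g t * \int[mu]_(x in @I11 R) (f x * trunc_inv e (x - t)))).
    apply: eq_Rintegral => t _.
    by rewrite e1 (mulVKf pi0).
  rewrite h; apply: eq_Rintegral => x _.
  by rewrite e2 !mulNr mulrN opprK (mulVKf pi0).
rewrite -(RintegralZ pi^-1 fgI) -[RHS]mulN1r.
rewrite -[RHS](RintegralZ (-1) (trunc_hilbert_mul_integrable e0 gI fI)).
apply: eq_Rintegral => x _; by rewrite mulNr mulrN (mulKf pi0) mulN1r.
Qed.

End truncated_kernel.

(** * Bounds for the truncated transform of a bounded function, uniform in the truncation *)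

Section exponential_integrability.
Context {R : realType}.
Notation mu := (@lebesgue_measure R).
Notation RT := (measurableTypeR R).
Context (n : nat) (h : R -> R).
Context (n0 : (0 < n)%N) (mh : measurable_fun (@I11 R) h)
  (h1 : forall x, I11 x -> `|h x| <= 1).

Let mass := \int[mu]_(x in @I11 R) `|h x|.

Let hI : mu.-integrable (@I11 R) (EFin \o h).
Proof.
exact: (@integrable_bounded _ _ _ _ _ _ 1 measurable_I11 mu_I11_fin mh h1).
Qed.

Let ahI : mu.-integrable (@I11 R) (EFin \o (fun x => `|h x|)).
Proof. exact: integrable_norm hI. Qed.

Let hgI (g : R -> R) (C : R) : measurable_fun (@I11 R) g ->
  (forall x, I11 x -> `|g x| <= C) ->
  mu.-integrable (@I11 R) (fun x => (h x * g x)%:E).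
Proof. exact: (integrable_mul_bounded measurable_I11 hI). Qed.

Let measurable_cont (g : R -> R) (A : set R) : continuous g -> measurable_fun A g.
Proof. by move=> cg; apply: measurable_funTS; exact: continuous_measurable_fun. Qed.

(** Fejer-weighted Fourier coefficients of [h] extended by zero to a period: [U] is its Fejer mean
    and [V] the conjugate function. The orientation [x - t] of the kernel makes the transform close
    to [- V], whence the sums [T t + V t] below. *)
Let a k := (2 * pi)^-1 * fejer_weight n k * \int[mu]_(x in @I11 R) (h x * cos (k%:R * x)).
Let b k := (2 * pi)^-1 * fejer_weight n k * \int[mu]_(x in @I11 R) (h x * sin (k%:R * x)).

Let U (th : R) := \sum_(k < n) (a k * cos (k%:R * th) + b k * sin (k%:R * th)).
Let V (th : R) := \sum_(k < n) (a k * sin (k%:R * th) - b k * cos (k%:R * th)).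

Let cosI (k : nat) : mu.-integrable (@I11 R) (fun x => (h x * cos (k%:R * x))%:E).
Proof.
apply: (@hgI _ 1) => [|x _]; last exact: cos_max.
apply: measurable_cont; exact: continuous_cosM.
Qed.

Let sinI (k : nat) : mu.-integrable (@I11 R) (fun x => (h x * sin (k%:R * x))%:E).
Proof.
apply: (@hgI _ 1) => [|x _]; last exact: sin_max.
apply: measurable_cont; exact: continuous_sinM.
Qed.

Let RintegralZ (c : R) (F : R -> R) :
  mu.-integrable (@I11 R) (fun x => (F x)%:E) ->
  \int[mu]_(x in @I11 R) (c * F x) = c * \int[mu]_(x in @I11 R) F x.
Proof. exact: (RintegralZl c measurable_I11). Qed.

Let UE th : U th = (2 * pi)^-1 * \int[mu]_(x in @I11 R) (h x * fejer n (x - th)).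
Proof.
pose F k x := fejer_weight n k * cos (k%:R * th) * (h x * cos (k%:R * x)) +
              fejer_weight n k * sin (k%:R * th) * (h x * sin (k%:R * x)).
have i1 k := integrable_scale (fejer_weight n k * cos (k%:R * th)) measurable_I11 (cosI k).
have i2 k := integrable_scale (fejer_weight n k * sin (k%:R * th)) measurable_I11 (sinI k).
have FI k := integrable_add measurable_I11 (i1 k) (i2 k).
transitivity ((2 * pi)^-1 * \int[mu]_(x in @I11 R) (\sum_(k < n) F k x)).
  rewrite /U -(big_mkord xpredT (fun k => a k * cos (k%:R * th) + b k * sin (k%:R * th))).
  under eq_Rintegral do rewrite -(big_mkord xpredT (fun k => F k _)).
  rewrite (Rintegral_sum _ measurable_I11 FI) mulr_sumr.
  apply: eq_bigr => k _; rewrite /F (RintegralD measurable_I11 (i1 k) (i2 k)).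
  by rewrite (RintegralZ _ (cosI k)) (RintegralZ _ (sinI k)) /a /b; ring.
congr *%R; apply: eq_Rintegral => x _; rewrite /F /fejer mulr_sumr.
by apply: eq_bigr => k _; rewrite mulrBr cosB; ring.
Qed.

Let VE th : V th = - ((2 * pi)^-1 * \int[mu]_(x in @I11 R) (h x * conj_fejer n (x - th))).
Proof.
pose F k x := fejer_weight n k * cos (k%:R * th) * (h x * sin (k%:R * x)) +
              (- (fejer_weight n k * sin (k%:R * th))) * (h x * cos (k%:R * x)).
have i1 k := integrable_scale (fejer_weight n k * cos (k%:R * th)) measurable_I11 (sinI k).
have i2 k := integrable_scale (- (fejer_weight n k * sin (k%:R * th))) measurable_I11 (cosI k).
have FI k := integrable_add measurable_I11 (i1 k) (i2 k).
transitivity (- ((2 * pi)^-1 * \int[mu]_(x in @I11 R) (\sum_(k < n) F k x))).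
  rewrite /V -(big_mkord xpredT (fun k => a k * sin (k%:R * th) - b k * cos (k%:R * th))).
  under eq_Rintegral do rewrite -(big_mkord xpredT (fun k => F k _)).
  rewrite (Rintegral_sum _ measurable_I11 FI) mulr_sumr -sumrN.
  apply: eq_bigr => k _; rewrite /F (RintegralD measurable_I11 (i1 k) (i2 k)).
  by rewrite (RintegralZ _ (cosI k)) (RintegralZ _ (sinI k)) /a /b; ring.
congr (- (_ * _)); apply: eq_Rintegral => x _; rewrite /F /conj_fejer mulr_sumr.
by apply: eq_bigr => k _; rewrite mulrBr sinB; ring.
Qed.

Let pi20 : 0 < 2 * pi :> R.
Proof. by rewrite mulr_gt0// pi_gt0. Qed.

Let fejerI (A : set R) th : measurable (A : set RT) -> A `<=` `[- pi, pi] ->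
  mu.-integrable A (EFin \o (fun x => fejer n (x - th))).
Proof.
move=> mA AI; have := continuous_itv_integrable (- pi) pi (@continuous_fejer _ n th).
exact: integrableS.
Qed.

Let measurable_fejer (A : set R) th : measurable_fun A (fun x => fejer n (x - th)).
Proof. by apply: measurable_cont; exact: continuous_fejer. Qed.

Let ahfI th : mu.-integrable (@I11 R) (fun x => (`|h x| * fejer n (x - th))%:E).
Proof.
apply: (integrable_mul_bounded measurable_I11 ahI (C := 2 * n%:R)).
  exact: measurable_fejer.
by move=> x _; exact: norm_fejer_le.
Qed.

Let normU_le th : `|U th| <= (2 * pi)^-1 *
  \int[mu]_(x in @I11 R) (`|h x| * fejer n (x - th)).
Proof.
have pi2V : 0 <= (2 * pi)^-1 :> R by rewrite invr_ge0 ltW.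
rewrite UE normrM (ger0_norm pi2V) (ler_wpM2l pi2V)//.
have hfI : mu.-integrable (@I11 R) (fun x => (h x * fejer n (x - th))%:E).
  apply: (hgI (C := 2 * n%:R)); first exact: measurable_fejer.
  by move=> x _; exact: norm_fejer_le.
rewrite (le_trans (le_normr_Rintegral measurable_I11 hfI))//.
apply: le_Rintegral => //.
- exact: measurable_I11.
- exact: integrable_norm hfI.
- exact: ahfI.
- by move=> x _; rewrite normrM (ger0_norm (fejer_ge0 _ _)).
Qed.

(** The Fejer kernel is nonnegative with mean 1 and [h] is bounded by 1. *)
Let U_le1 th : `|U th| <= 1.
Proof.
rewrite (le_trans (normU_le th))// mulrC ler_pdivrMr// mul1r.
apply: (@le_trans _ _ (\int[mu]_(x in @I11 R) fejer n (x - th))).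
  apply: le_Rintegral.
  - exact: measurable_I11.
  - exact: ahfI.
  - exact: (fejerI th measurable_I11 I11_sub_pi).
  - by move=> x Ix; rewrite ler_piMl ?fejer_ge0// h1.
rewrite -(fejer_mean th n0); apply: ge0_subset_Rintegral => //.
- exact: measurable_I11.
- by apply: fejerI.
- by move=> x _; exact: fejer_ge0.
- exact: I11_sub_pi.
Qed.

Let continuousU : continuous U.
Proof.
have d (x : R) : exists d : R, is_derive x 1 U d.
  by eexists; simple notypeclasses refine (isder_sum _ _) => k; repeat isder_step.
by move=> x; have [d' dx] := d x; exact: (isder_continuous dx).
Qed.

Let continuousV : continuous V.
Proof.
have d (x : R) : exists d : R, is_derive x 1 V d.
  by eexists; simple notypeclasses refine (isder_sum _ _) => k; repeat isder_step.
by move=> x; have [d' dx] := d x; exact: (isder_continuous dx).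
Qed.

Let J := (`[- pi, pi] : set R)%classic.

Let mJ : measurable (J : set RT).
Proof. exact: measurable_itv. Qed.

Let contJ (g : R -> R) : continuous g -> mu.-integrable J (EFin \o g).
Proof. exact: continuous_itv_integrable. Qed.

Let absUI : mu.-integrable J (fun x => `|U x|%:E).
Proof. exact: integrable_norm (contJ continuousU). Qed.

(** By Fubini, averaging against a nonnegative kernel of mean 1 does not increase the L^1 norm. *)
Let intU_le : \int[mu]_(th in J) `|U th| <= mass.
Proof.
have oneI : mu.-integrable J (EFin \o (fun _ : R => 1 : R)).
  by apply: contJ; exact: cst_continuous.
have mK : measurable_fun setT (fun z : RT * RT => fejer n (z.2 - z.1)).
  apply: measurable_fun_translates; apply: continuous_measurable_fun => x.
  by have := @continuous_fejer R n 0 x; under eq_fun do rewrite subr0.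
have KC := fun t x : R => norm_fejer_le n (x - t).
have k1 := @kernel_integrable _ _ RT RT R mu mu J (@I11 R) (fun=> 1)
  (fun x => `|h x|) (fun t x => fejer n (x - t)) _ mJ measurable_I11 oneI ahI mK KC.
have k2 := @kernel_fubini _ _ RT RT R mu mu J (@I11 R) (fun=> 1)
  (fun x => `|h x|) (fun t x => fejer n (x - t)) _ mJ measurable_I11 oneI ahI mK KC.
apply: (@le_trans _ _ (\int[mu]_(th in J) ((2 * pi)^-1 *
    (1 * \int[mu]_(x in @I11 R) (`|h x| * fejer n (x - th)))))).
  apply: (le_Rintegral mJ absUI (integrable_scale _ mJ k1)).
  by move=> th _; rewrite mul1r; exact: normU_le.
rewrite (RintegralZl _ mJ k1) k2.
have -> : \int[mu]_(x in @I11 R)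
    (`|h x| * \int[mu]_(th in J) (1 * fejer n (x - th))) =
    \int[mu]_(x in @I11 R) (2 * pi * `|h x|).
  apply: eq_Rintegral => x _; rewrite [RHS]mulrC; congr *%R.
  rewrite -(fejer_mean x n0); apply: eq_Rintegral => t _.
  by rewrite mul1r -fejerN opprB.
have -> := RintegralZ (2 * pi) ahI.
by rewrite (mulKf (lt0r_neq0 pi20)).
Qed.

(** Hence [V] has no constant term, and the mean value of [expR V * cos U] is a cosine, at most
    1. *)
Let b0 : b 0%N = 0.
Proof.
rewrite /b; under eq_Rintegral do rewrite mul0r sin0 mulr0.
by rewrite (Rintegral_cst _ measurable_I11) mul0r mulr0.
Qed.

Let meanV : \int[mu]_(th in J) (expR (V th) * cos (U th)) <= 2 * pi.
Proof.
rewrite mean_exp_harmonic; case: n n0 b0 => // m _ ->.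
by rewrite oppr0 expR0 mul1r; have := cos_le1 (a 0%N); have := pi20; nra.
Qed.

(** Changing the sign of all coefficients replaces [U] and [V] by their opposites, and the cosine is
    even. *)
Let meanNV : \int[mu]_(th in J) (expR (- V th) * cos (U th)) <= 2 * pi.
Proof.
have <- : \int[mu]_(th in J)
   (expR (\sum_(k < n) (- a k * sin (k%:R * th) - - b k * cos (k%:R * th))) *
     cos (\sum_(k < n) (- a k * cos (k%:R * th) + - b k * sin (k%:R * th)))) =
   \int[mu]_(th in J) (expR (- V th) * cos (U th)).
  apply: eq_Rintegral => th _; rewrite -(cosN (U th)) /U /V -!sumrN.
  by congr (expR _ * cos _); apply: eq_bigr => k _; rewrite !mulNr ?opprD ?opprK.
rewrite (mean_exp_harmonic n (fun k => - a k) (fun k => - b k)).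
case: n n0 b0 => // m _ ->.
by rewrite !oppr0 expR0 mul1r; have := cos_le1 (- a 0%N); have := pi20; nra.
Qed.

(** It dominates the exponential of [|V|] without a case distinction, and its minimum 2 measures how
    far [V] is from 0. *)
Let G th := expR (V th) + expR (- V th).

Let continuousexpV : continuous (fun th => expR (V th)).
Proof.
move=> th; apply: (@continuous_comp _ _ _ V expR); first exact: continuousV.
exact: continuous_expR.
Qed.

Let continuousexpNV : continuous (fun th => expR (- V th)).
Proof.
move=> th; apply: (@continuous_comp _ _ _ (fun x => - V x) expR).
  by apply: continuousN; exact: continuousV.
exact: continuous_expR.
Qed.

Let continuouscosU : continuous (fun th => cos (U th)).
Proof.
move=> th; apply: (@continuous_comp _ _ _ U cos); first exact: continuousU.
exact: continuous_cos.
Qed.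

Let GI : mu.-integrable J (EFin \o G).
Proof.
by apply: contJ => th; apply: cvgD; [exact: continuousexpV|exact: continuousexpNV].
Qed.

Let GcI : mu.-integrable J (EFin \o (fun th => G th * cos (U th))).
Proof.
apply: contJ => th; apply: cvgM; last exact: continuouscosU.
by apply: cvgD; [exact: continuousexpV|exact: continuousexpNV].
Qed.

Let intGc : \int[mu]_(th in J) (G th * cos (U th)) <= 4 * pi.
Proof.
have i1 : mu.-integrable J (fun th => (expR (V th) * cos (U th))%:E).
  by apply: contJ => th; apply: cvgM; [exact: continuousexpV|exact: continuouscosU].
have i2 : mu.-integrable J (fun th => (expR (- V th) * cos (U th))%:E).
  by apply: contJ => th; apply: cvgM; [exact: continuousexpNV|exact: continuouscosU].
under eq_Rintegral do rewrite /G mulrDl.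
rewrite (RintegralD mJ i1 i2); have := meanV; have := meanNV.
move: (Rintegral _ _ _) (Rintegral _ _ _) => x y; lra.
Qed.

Let G_ge th : 2 + V th ^+ 2 / 4 <= G th.
Proof.
rewrite /G; move: (V th) => {th} v; wlog v0 : v / 0 <= v.
  move=> H; have [|/ltW v0] := leP 0 v; first exact: H.
  by have := H (- v); rewrite opprK sqrrN (addrC (expR _)) oppr_ge0; apply.
(* With [x] the exponential of [v / 2], the excess over 2 is the square of [x - x^-1], which is at
   least [v / 2]. *)
pose x := expR (v / 2); have x1 : 1 + v / 2 <= x by exact: expR_ge1Dx.
have xv : expR v = x ^+ 2 by rewrite /x -expRM_natl; congr expR; field.
have x0 : 0 < x by exact: expR_gt0.
have -> : expR (- v) = x ^- 2 by rewrite expRN xv.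
rewrite xv; have y1 : x^-1 <= 1 by rewrite invf_le1//; lra.
have y0 : 0 < x^-1 by rewrite invr_gt0.
rewrite -exprVn.
have xy : x * x^-1 = 1 by rewrite divff// gt_eqF.
have d : v / 2 <= x - x^-1 by lra.
have : (v / 2) ^+ 2 <= (x - x^-1) ^+ 2.
  by rewrite lerXn2r// nnegrE; lra.
rewrite sqrrB xy; lra.
Qed.

Let cosU_ge th : 1 - U th ^+ 2 / 2 <= cos (U th).
Proof. exact: cos_ge_quadratic. Qed.

Let U2_le th : U th ^+ 2 <= `|U th| /\ U th ^+ 2 <= 1.
Proof.
have u1 := U_le1 th; rewrite -(real_normK (num_real (U th))).
have u0 := normr_ge0 (U th); split; nra.
Qed.

(** [|U| <= 1] gives [cos U >= 1/2], so [G] is at most twice [G * cos U], whose integral is at most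
    [4 * pi]. *)
Let intG : \int[mu]_(th in J) G th <= 8 * pi.
Proof.
apply: (@le_trans _ _ (\int[mu]_(th in J) (2 * (G th * cos (U th))))).
  apply: (le_Rintegral mJ GI (integrable_scale _ mJ GcI)) => th _.
  have := cosU_ge th; have [_] := U2_le th; have := G_ge th.
  have := sqr_ge0 (V th); nra.
rewrite (RintegralZl _ mJ GcI); have := intGc; move: (Rintegral _ _ _) => x; lra.
Qed.

(** The integral of [G * cos U] is at most [4 * pi], exactly that of the constant 2. What is lost in
    replacing [cos U] by 1 is of order [U ^+ 2], hence at most [|U|], whose integral is bounded by
    the mass of [h]. *)
Let intG2 : \int[mu]_(th in J) (G th - 2) <= 2 * mass.
Proof.
have cI (c : R) : mu.-integrable J (EFin \o (fun _ : R => c)).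
  by apply: contJ; exact: cst_continuous.
have i1 := integrable_sub mJ GcI (cI 2).
have i2 := integrable_add mJ i1 absUI.
have i3 := integrable_sub mJ GI (cI 2).
(* Pointwise, [2 * cos U - 1 >= 1 - U ^+ 2 >= 0] and [G >= 2] leave the margin
   [2 * (|U| - U ^+ 2) >= 0]. *)
apply: (@le_trans _ _ (\int[mu]_(th in J) (2 * (G th * cos (U th) - 2 + `|U th|)))).
  apply: (le_Rintegral mJ i3 (integrable_scale _ mJ i2)) => th _.
  have := cosU_ge th; have [] := U2_le th; have := G_ge th.
  have := sqr_ge0 (V th); nra.
rewrite (RintegralZl _ mJ i2) (RintegralD mJ i1 absUI) (RintegralB mJ GcI (cI 2)).
rewrite (Rintegral_cst mu mJ) [X in fine X](_ : _ = (2 * pi)%:E)/=; last exact: mu_pi.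
have := intGc; have := intU_le.
move: (Rintegral _ _ _) (Rintegral _ _ _) => x y; lra.
Qed.

Let T := rtrunc_hilbert n%:R^-1 h.

Let gapI t : mu.-integrable (@I11 R) (fun x => (`|h x| * kernel_gap n (x - t))%:E).
Proof.
apply: (integrable_mul_bounded measurable_I11 ahI (C := 1 + 8 * n%:R)).
  by apply: measurable_cont; exact: continuous_kernel_gap.
by move=> x _; exact: norm_kernel_gap_le.
Qed.

Let TV_le t : I11 t -> `|T t + V t| <=
  pi^-1 * \int[mu]_(x in @I11 R) (`|h x| * kernel_gap n (x - t)).
Proof.
move=> It; have nV : 0 < n%:R^-1 :> R by rewrite invr_gt0 ltr0n.
have i1 := integrable_trunc_hilbert t nV hI.
have i2 : mu.-integrable (@I11 R) (fun x => (h x * conj_fejer n (x - t))%:E).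
  apply: (hgI (C := 2 * n%:R)); last by move=> x _; exact: norm_conj_fejer_le.
  by apply: measurable_cont; exact: continuous_conj_fejer.
have i3 := integrable_scale 2^-1 measurable_I11 i2.
have i4 := integrable_sub measurable_I11 i1 i3.
have -> : T t + V t = pi^-1 * \int[mu]_(x in @I11 R)
    (h x * trunc_inv n%:R^-1 (x - t) - 2^-1 * (h x * conj_fejer n (x - t))).
  rewrite (RintegralB measurable_I11 i1 i3) (RintegralZ _ i2) VE /T /rtrunc_hilbert.
  by rewrite invfM; ring.
have piV : 0 <= pi^-1 :> R by rewrite invr_ge0 pi_ge0.
rewrite normrM (ger0_norm piV) (ler_wpM2l piV)//.
rewrite (le_trans (le_normr_Rintegral measurable_I11 i4))//.
apply: (le_Rintegral measurable_I11 (integrable_norm i4) (gapI t)) => x Ix /=.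
rewrite mulrCA -mulrBr normrM ler_wpM2l// [2^-1 * _]mulrC.
apply: trunc_inv_sub_conj_fejer => //.
move/I11P : It => /andP[t1 t2]; move/I11P : Ix => /andP[x1 x2].
by rewrite ler_norml; lra.
Qed.

(** The bump integral divided by pi bounds [|T + V|]; it does not depend on [n]. *)
Definition trunc_hilbert_gap : R := pi^-1 * (2 + 8 * pi).

Let TV_bound t : I11 t -> `|T t + V t| <= trunc_hilbert_gap.
Proof.
move=> It; rewrite (le_trans (TV_le It))// /trunc_hilbert_gap.
rewrite ler_wpM2l ?invr_ge0 ?pi_ge0//.
rewrite (le_trans _ (kernel_gap_integral_le n t))//.
apply: (le_Rintegral measurable_I11 (gapI t)).
  apply: (@integrable_bounded _ _ _ _ _ _ (1 + 8 * n%:R) measurable_I11 mu_I11_fin).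
    by apply: measurable_cont; exact: continuous_kernel_gap.
  by move=> x _; exact: norm_kernel_gap_le.
by move=> x Ix; rewrite ler_piMl ?kernel_gap_ge0// h1.
Qed.

Let nV0 : 0 < n%:R^-1 :> R.
Proof. by rewrite invr_gt0 ltr0n. Qed.

Let mT : measurable_fun (@I11 R) T.
Proof. exact: measurable_trunc_hilbert. Qed.

Let expT_le t : I11 t -> expR `|T t| <= expR trunc_hilbert_gap * G t.
Proof.
move=> It; apply: (@le_trans _ _ (expR (trunc_hilbert_gap + `|V t|))).
  rewrite ler_expR; have := TV_bound It; have := ler_normB (T t + V t) (V t).
  rewrite addrK; lra.
rewrite expRD ler_wpM2l ?expR_ge0// /G; case: (ger0P (V t)) => _.
  by rewrite lerDl expR_ge0.
by rewrite lerDr expR_ge0.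
Qed.

Let GI11 : mu.-integrable (@I11 R) (EFin \o G).
Proof. exact: (integrableS mJ measurable_I11 I11_sub_pi GI). Qed.

Let G0 th : 0 <= G th.
Proof. by rewrite addr_ge0// expR_ge0. Qed.

Lemma trunc_hilbert_exp_integrable :
  mu.-integrable (@I11 R) (EFin \o (fun t => expR `|T t|)).
Proof.
apply: (integrable_le measurable_I11
  (integrable_scale (expR trunc_hilbert_gap) measurable_I11 GI11)).
  by apply: measurableT_comp => //; apply: measurableT_comp.
by move=> t It; rewrite ger0_norm ?expR_ge0//; exact: expT_le.
Qed.

Lemma trunc_hilbert_exp_le :
  \int[mu]_(t in @I11 R) expR `|T t| <= expR trunc_hilbert_gap * (8 * pi).
Proof.
apply: le_trans (le_Rintegral measurable_I11 trunc_hilbert_exp_integrable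
  (integrable_scale (expR trunc_hilbert_gap) measurable_I11 GI11) expT_le) _.
rewrite (RintegralZ _ GI11) ler_wpM2l ?expR_ge0// (le_trans _ intG)//.
by apply: ge0_subset_Rintegral => //; [exact: measurable_I11|exact: I11_sub_pi].
Qed.

Let cstI (c : R) : mu.-integrable (@I11 R) (EFin \o (fun _ : R => c)).
Proof.
apply: (@integrable_bounded _ _ _ _ _ _ `|c| measurable_I11 mu_I11_fin) => //.
Qed.

Let gapoutI :
  mu.-integrable (@I11 R)
   (fun t => (1 * \int[mu]_(x in @I11 R) (`|h x| * kernel_gap n (x - t)))%:E).
Proof.
have mK : measurable_fun setT (fun z : RT * RT => kernel_gap n (z.2 - z.1)).
  apply: measurable_fun_translates; apply: continuous_measurable_fun => x.
  by have := @continuous_kernel_gap R n 0 x; under eq_fun do rewrite subr0.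
have KC := fun t x : R => norm_kernel_gap_le n (x - t).
exact: (@kernel_integrable _ _ RT RT R mu mu (@I11 R) (@I11 R) (fun=> 1)
  (fun x => `|h x|) (fun t x => kernel_gap n (x - t)) _ measurable_I11
  measurable_I11 (cstI 1) ahI mK KC).
Qed.

(** Exchanging the integrals, the bump is integrated in [t] first, and its evenness reduces this to
    [kernel_gap_integral_le]. *)
Let gapout_le : \int[mu]_(t in @I11 R)
    (1 * \int[mu]_(x in @I11 R) (`|h x| * kernel_gap n (x - t))) <=
  (2 + 8 * pi) * mass.
Proof.
have mK : measurable_fun setT (fun z : RT * RT => kernel_gap n (z.2 - z.1)).
  apply: measurable_fun_translates; apply: continuous_measurable_fun => x.
  by have := @continuous_kernel_gap R n 0 x; under eq_fun do rewrite subr0.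
have mK' : measurable_fun setT (fun z : RT * RT => kernel_gap n (z.1 - z.2)).
  by under eq_fun do rewrite -kernel_gapN opprB.
have KC := fun t x : R => norm_kernel_gap_le n (x - t).
have KC' := fun x t : R => norm_kernel_gap_le n (x - t).
have -> := @kernel_fubini _ _ RT RT R mu mu (@I11 R) (@I11 R) (fun=> 1)
  (fun x => `|h x|) (fun t x => kernel_gap n (x - t)) _ measurable_I11
  measurable_I11 (cstI 1) ahI mK KC.
have ki := @kernel_integrable _ _ RT RT R mu mu (@I11 R) (@I11 R)
  (fun x => `|h x|) (fun=> 1) (fun x t => kernel_gap n (x - t)) _ measurable_I11
  measurable_I11 ahI (cstI 1) mK' KC'.
have <- := RintegralZ (2 + 8 * pi) ahI.
apply: (le_Rintegral measurable_I11 ki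
  (integrable_scale (2 + 8 * pi) measurable_I11 ahI)) => x _.
rewrite mulrC ler_wpM2r// (le_trans _ (kernel_gap_integral_le n x))//.
rewrite le_eqVlt; apply/orP; left; apply/eqP; apply: eq_Rintegral => t _.
by rewrite mul1r -kernel_gapN opprB.
Qed.

(** Only [V ^+ 2] is controlled by the mass, through [G - 2], so [|V|] is split with a free
    parameter: [d] is to be made small first, then the mass. *)
Lemma trunc_hilbert_small (d : R) : 0 < d ->
  \int[mu]_(t in @I11 R) `|T t| <= 2 * d + (2 / d + trunc_hilbert_gap) * mass.
Proof.
move=> d0; pose W t := 1 * \int[mu]_(x in @I11 R) (`|h x| * kernel_gap n (x - t)).
have TI : mu.-integrable (@I11 R) (fun t => `|T t|%:E).
  apply: integrable_le measurable_I11 trunc_hilbert_exp_integrable _ _.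
    by apply: measurableT_comp.
  move=> t _; rewrite normr_id; have := expR_ge1Dx `|T t|; lra.
have i1 := integrable_sub measurable_I11 GI11 (cstI 2).
have i2 := integrable_scale d^-1 measurable_I11 i1.
have i3 := integrable_add measurable_I11 (cstI d) i2.
have i4 := integrable_scale pi^-1 measurable_I11 gapoutI.
apply: (@le_trans _ _ (\int[mu]_(t in @I11 R)
    (d + d^-1 * (G t - 2) + pi^-1 * W t))).
  apply: (le_Rintegral measurable_I11 TI (integrable_add measurable_I11 i3 i4)).
  move=> t It; rewrite -lerBlDr.
  apply: (@le_trans _ _ `|V t|).
    rewrite mul1r lerBlDr addrC -lerBlDr (le_trans _ (TV_le It))// lerBlDr.
    by rewrite -{1}[T t](addrK (V t)) ler_normB.
  have V2 : `|V t| ^+ 2 = V t ^+ 2 by rewrite real_normK ?num_real.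
  (* The arithmetic-geometric mean inequality, from the square of [|V| / 2 - d]. *)
  apply: (@le_trans _ _ (d + d^-1 * (`|V t| ^+ 2 / 4))).
    rewrite -(ler_pM2l d0) (_ : d * (d + _) = d ^+ 2 + `|V t| ^+ 2 / 4); last first.
      by field; rewrite gt_eqF.
    have := sqr_ge0 (`|V t| / 2 - d); nra.
  rewrite lerD2l ler_wpM2l ?invr_ge0 ?(ltW d0)// V2; have := G_ge t; lra.
rewrite (RintegralD measurable_I11 i3 i4) (RintegralZ _ gapoutI).
rewrite (RintegralD measurable_I11 (cstI d) i2) (RintegralZ _ i1).
rewrite Rintegral_cst_I11.
have e1 : pi^-1 * \int[mu]_(t in @I11 R) W t <= trunc_hilbert_gap * mass.
  by rewrite /trunc_hilbert_gap -mulrA ler_wpM2l ?invr_ge0 ?pi_ge0.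
have e2 : d^-1 * \int[mu]_(t in @I11 R) (G t - 2) <= d^-1 * (2 * mass).
  rewrite ler_wpM2l ?invr_ge0 ?(ltW d0)// (le_trans _ intG2)//.
  apply: ge0_subset_Rintegral => //; [exact: measurable_I11| |
    |exact: I11_sub_pi].
    have c2 : mu.-integrable J (EFin \o (fun _ : R => 2)).
      by apply: contJ; exact: cst_continuous.
    exact: (integrable_sub mJ GI c2).
  by move=> t _; have := G_ge t; have := sqr_ge0 (V t); lra.
apply: le_trans (lerD (lerD (lexx _) e2) e1) _.
rewrite le_eqVlt; apply/orP; left; apply/eqP; ring.
Qed.

End exponential_integrability.

(** * Passage to the limit in the pairing with a bounded function *)

Section pairing_limit.
Context {R : realType}.
Notation mu := (@lebesgue_measure R).
Notation RT := (measurableTypeR R).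

(* The duality between L log L and the exponential class, in the form of an
   equi-integrability statement. *)
Definition zygmund_tail (C : R) (f : R -> R) : Prop :=
  forall eta : R, 0 < eta -> exists2 M : R, 0 <= M &
    forall v : R -> R, mu.-integrable (@I11 R) (EFin \o (fun t => expR `|v t|)) ->
      measurable_fun (@I11 R) v ->
      mu.-integrable (@I11 R) (fun t => (f t * v t)%:E) ->
      \int[mu]_(t in @I11 R) expR `|v t| <= C ->
      \int[mu]_(t in @I11 R) `|f t * v t| <=
        M * \int[mu]_(t in @I11 R) `|v t| + eta.

Let C0 : R := expR (@trunc_hilbert_gap R) * (8 * pi).

Lemma trunc_hilbert_pairing_cvg0 (f g : R -> R) :
  mu.-integrable (@I11 R) (EFin \o f) -> zygmund_tail C0 f ->
  measurable_fun (@I11 R) g -> (forall t, I11 t -> `|g t| <= 1) ->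
  {ae mu, forall t, I11 t -> rtrunc_hilbert n.+1%:R^-1 f t @[n --> \oo] --> 0} ->
  \int[mu]_(t in @I11 R) (g t * rtrunc_hilbert n.+1%:R^-1 f t) @[n --> \oo] --> 0.
Proof.
move=> fI ft mg g1 T0.
have gap0 : 0 <= @trunc_hilbert_gap R.
  by apply: mulr_ge0; [rewrite invr_ge0 pi_ge0|have := pi_ge0 R; lra].
have e0 n : 0 < n.+1%:R^-1 :> R by rewrite invr_gt0.
have gI : mu.-integrable (@I11 R) (EFin \o g).
  exact: (integrable_bounded measurable_I11 mu_I11_fin mg g1).
(* Of the five parts, two are spent off the exceptional set, on an interval of length 2, and three
   on it. *)
apply/cvgrPdist_le => eps eps0; pose eta : R := eps / 5.
have eta0 : 0 < eta by rewrite divr_gt0.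
have [M M0 HM] := ft _ eta0.
(* [d] and the measure [a] allowed to the exceptional set are chosen so that
   [2 * d + L * a = 2 * eta / (M + 1)]; [M + 1] because [M] may be 0. *)
pose d : R := eta / (2 * (M + 1)).
have d0 : 0 < d by rewrite divr_gt0// mulr_gt0// ltr_wpDl.
pose L : R := 2 / d + @trunc_hilbert_gap R.
have L0 : 0 < L by rewrite ltr_wpDr// divr_gt0.
pose a : R := eta / (L * (M + 1)).
have a0 : 0 < a by rewrite divr_gt0// mulr_gt0// ltr_wpDl.
have mT n : measurable_fun (@I11 R) (rtrunc_hilbert n.+1%:R^-1 f).
  exact: measurable_trunc_hilbert.
(* Egorov's theorem: convergence is uniform off a set [B] of measure less than [a]. *)
have [B [mB muB ucv]] := @ae_pointwise_almost_uniform _ R RT mu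
  (fun n => rtrunc_hilbert n.+1%:R^-1 f) (cst 0) (@I11 R) a mT
  (measurable_cst (0 : R)) measurable_I11 mu_I11_fin T0 a0.
have unif : \forall n \near \oo, forall t, (@I11 R `\` B) t ->
    `|rtrunc_hilbert n.+1%:R^-1 f t| <= eta.
  apply: (ucv [set k : R -> R | forall t, (@I11 R `\` B) t -> `|k t| <= eta]).
  apply/uniform_nbhs.
  exists [set xy : R * R | ball xy.1 eta xy.2]; split.
    exact: (entourage_ball _ (PosNum eta0)).
  move=> h /= hball t Bt; have := hball t Bt.
  by rewrite /ball/= sub0r normrN => /ltW.
near=> n.
rewrite sub0r normrN.
have Tn : forall t, (@I11 R `\` B) t -> `|rtrunc_hilbert n.+1%:R^-1 f t| <= eta.
  by near: n; exact: unif.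
pose T := rtrunc_hilbert n.+1%:R^-1 f.
pose h := fun t => g t * \1_B t : R.
have mh : measurable_fun (@I11 R) h.
  apply: measurable_funM => //; exact: measurable_indic.
have h1 t : I11 t -> `|h t| <= 1.
  move=> It; rewrite /h normrM -[leRHS]mulr1 ler_pM ?g1//.
  by rewrite indicE; case: (t \in B); rewrite ?normr1 ?normr0.
have hI : mu.-integrable (@I11 R) (EFin \o h).
  exact: (integrable_bounded measurable_I11 mu_I11_fin mh h1).
have gTI := trunc_hilbert_mul_integrable (e0 n) fI gI.
have hTI := trunc_hilbert_mul_integrable (e0 n) fI hI.
have fTI := trunc_hilbert_mul_integrable (e0 n) hI fI.
have ghI := integrable_sub measurable_I11 gTI hTI.
have -> : \int[mu]_(t in @I11 R) (g t * T t) =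
    \int[mu]_(t in @I11 R) (g t * T t - h t * T t) +
    \int[mu]_(t in @I11 R) (h t * T t).
  by rewrite (RintegralB measurable_I11 gTI hTI) subrK.
have part1 : `|\int[mu]_(t in @I11 R) (g t * T t - h t * T t)| <= 2 * eta.
  rewrite (le_trans (le_normr_Rintegral measurable_I11 ghI))//.
  apply: (@le_trans _ _ (\int[mu]_(t in @I11 R) eta)).
    apply: (le_Rintegral measurable_I11 (integrable_norm ghI)).
      apply: (@integrable_bounded _ _ _ _ _ _ eta measurable_I11 mu_I11_fin) => //.
      by move=> x _; rewrite ger0_norm// ltW.
    move=> t It /=; rewrite -mulrBl normrM /h.
    rewrite indicE; have [tB|tB] := boolP (t \in B).
      by rewrite mulr1 subrr normr0 mul0r ltW.
    rewrite mulr0 subr0 -[leRHS]mul1r ler_pM ?g1// Tn//; split => //.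
    by move=> Bt; move: tB; rewrite mem_set.
  by rewrite Rintegral_cst_I11 mulrC.
have mass : \int[mu]_(x in @I11 R) `|h x| <= a.
  have indI : mu.-integrable (@I11 R) (EFin \o (\1_B : R -> R)).
    apply: (@integrable_bounded _ _ _ _ _ _ 1 measurable_I11 mu_I11_fin).
      exact: measurable_indic.
    by move=> t _; rewrite indicE; case: (t \in B); rewrite ?normr1 ?normr0.
  apply: (@le_trans _ _ (\int[mu]_(x in @I11 R) \1_B x)).
    apply: (le_Rintegral measurable_I11 (integrable_norm hI) indI) => t It /=.
    rewrite normrM -[leRHS]mul1r ler_pM ?g1//.
    by rewrite ger0_norm.
  rewrite /Rintegral integral_indic//; last exact: measurable_I11.
  have BI : (mu (B `&` @I11 R) <= mu B)%E.
    by apply: le_measure; rewrite ?inE//; apply: measurableI => //; exact: measurable_I11.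
  rewrite -lee_fin fineK; first exact: (le_trans BI (ltW muB)).
  by rewrite ge0_fin_numE// (le_lt_trans BI)// (lt_le_trans muB)// leey.
(* On [B] the operator is moved to [h], bounded by 1 and of mass at most [a]: the exponential bound
   admits it to the tail estimate for [f], and its small mass controls the term with [M]. *)
have part2 : `|\int[mu]_(t in @I11 R) (h t * T t)| <= 3 * eta.
  rewrite (trunc_hilbert_parseval (e0 n) fI hI) normrN.
  rewrite (le_trans (le_normr_Rintegral measurable_I11 fTI))//.
  have := HM _ (trunc_hilbert_exp_integrable (ltn0Sn n) mh h1)
    (measurable_trunc_hilbert (e0 n) hI) fTI
    (trunc_hilbert_exp_le (ltn0Sn n) mh h1).
  move=> h3; apply: (le_trans h3).
  have h4 := trunc_hilbert_small (ltn0Sn n) mh h1 d0.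
  have h5 : M * \int[mu]_(t in @I11 R) `|rtrunc_hilbert n.+1%:R^-1 h t| <=
      M * (2 * d + L * a).
    rewrite ler_wpM2l// (le_trans h4)// lerD2l.
    by rewrite ler_wpM2l// ltW.
  suff : M * (2 * d + L * a) <= 2 * eta by move: h5; lra.
  have -> : 2 * d + L * a = 2 * eta / (M + 1).
    by rewrite /d /a; field; rewrite !gt_eqF//; lra.
  by rewrite mulrA ler_pdivrMr ?ltr_wpDl//; nra.
rewrite (le_trans (ler_normD _ _))//.
apply: (le_trans (lerD part1 part2)); rewrite /eta; lra.
Unshelve. all: by end_near.
Qed.

End pairing_limit.

(** * The arcsine density *)

Section improper_FTC.
Context {R : realType}.
Notation mu := (@lebesgue_measure R).
Notation RT := (measurableTypeR R).

(** Monotone convergence along closed subintervals: [phi] may blow up at the ends, where only [F]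
    has to be continuous. *)
Lemma improper_FTC (F phi : R -> R) (a b : R) : a < b ->
  {for a, continuous F} -> {for b, continuous F} ->
  (forall x, a < x < b -> is_derive x 1 F (phi x)) ->
  (forall x, a < x < b -> {for x, continuous phi}) ->
  (forall x, a < x < b -> 0 <= phi x) ->
  (\int[mu]_(x in `]a, b[) (phi x)%:E)%E = (F b - F a)%:E.
Proof.
move=> ab Fa Fb dF cphi phi0.
(* Half the length at [n = 0], so the first subinterval is reduced to the midpoint and none is
   empty. *)
pose d n : R := (b - a) / 2 * n.+1%:R^-1.
have ba0 : 0 < (b - a) / 2 by rewrite divr_gt0// subr_gt0.
have d0 n : 0 < d n by rewrite /d divr_gt0.
have dhalf n : 2 * d n <= b - a.
  rewrite /d mulrA mulrCA mulfV// mulr1 ler_piMr ?subr_ge0 ?(ltW ab)//.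
  by rewrite invf_le1// ler1n.
have dcvg : d n @[n --> \oo] --> 0.
  rewrite -(mulr0 ((b - a) / 2)); apply: cvgM; first exact: cvg_cst.
  exact: cvg_harmonic.
pose A n : set R := `[a + d n, b - d n]%classic.
have mA n : measurable (A n : set RT) by exact: measurable_itv.
have AE : \bigcup_n A n = `]a, b[%classic.
  apply/seteqP; split => [x [n _]|x].
    rewrite /A/= !in_itv/= => /andP[h1 h2]; have := d0 n => ?.
    by apply/andP; split; lra.
  rewrite /= in_itv/= => /andP[h1 h2].
  have e0 : 0 < Num.min (x - a) (b - x) by rewrite lt_min !subr_gt0 h1.
  have /cvgrPdist_lt/(_ _ e0)[n _ /(_ n (leqnn _))] := dcvg.
  rewrite /= sub0r normrN gtr0_norm// lt_min => /andP[h3 h4].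
  by exists n => //; rewrite /A/= in_itv/=; apply/andP; split; lra.
have ndA : nondecreasing_seq A.
  move=> n m nm; apply/subsetPset => x; rewrite /A/= !in_itv/= => /andP[h1 h2].
  have : d m <= d n.
    rewrite /d ler_wpM2l ?(ltW ba0)// lef_pV2 ?posrE//.
    by rewrite ler_nat.
  by move=> h; apply/andP; split; lra.
have mphi : measurable_fun `]a, b[%classic phi.
  apply: open_continuous_measurable_fun => // x; rewrite inE/= in_itv/=.
  exact: cphi.
have cvg1 : (\int[mu]_(x in A n) (phi x)%:E)%E @[n --> \oo] -->
    (\int[mu]_(x in `]a, b[) (phi x)%:E)%E.
  rewrite -AE; apply: ge0_nondecreasing_set_cvg_integral => //.
  - move=> n; apply/measurable_EFinP; apply: measurable_funS mphi => //.
    by rewrite -AE; exact: bigcup_sup.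
  - move=> n x Anx; rewrite lee_fin phi0//.
    have : (\bigcup_n A n) x by exists n.
    by rewrite AE/= in_itv.
have FE n : (\int[mu]_(x in A n) (phi x)%:E)%E = (F (b - d n) - F (a + d n))%:E.
  have := dhalf n; have := d0 n; rewrite /A => dn0 dn.
  have [h|h] := eqVneq (a + d n) (b - d n).
    by rewrite -h set_interval.set_itv1 integral_set1 subrr.
  have lt : a + d n < b - d n by rewrite lt_neqAle h/=; lra.
  have inab x : a + d n <= x <= b - d n -> a < x < b.
    by move=> /andP[? ?]; apply/andP; split; lra.
  have FC x : a + d n <= x <= b - d n -> {for x, continuous F}.
    by move=> /inab xab; exact: (isder_continuous (dF x xab)).
  rewrite (@continuous_FTC2 _ phi F)//.
  - apply: continuous_in_subspaceT => x; rewrite inE/= in_itv/= => /inab.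
    exact: cphi.
  - split => [x||].
    + rewrite in_itv/= => /andP[h1 h2].
      have xab : a < x < b by apply/andP; split; lra.
      exact: (isder_derivable (dF x xab)).
    + by apply: cvg_at_right_filter; apply: FC; apply/andP; split; lra.
    + by apply: cvg_at_left_filter; apply: FC; apply/andP; split; lra.
  - move=> x; rewrite in_itv/= => /andP[h1 h2].
    have xab : a < x < b by apply/andP; split; lra.
    exact: (isder_derive1 (dF x xab)).
have cvg2 : (F (b - d n) - F (a + d n))%:E @[n --> \oo] --> (F b - F a)%:E.
  apply: cvg_EFin; first by near=> n.
  apply: cvgB.
    apply: (@cvg_comp _ _ _ (fun n => b - d n) F _ (nbhs b)) => //.
    by rewrite -{2}(subr0 b); apply: cvgB => //; exact: cvg_cst.
  apply: (@cvg_comp _ _ _ (fun n => a + d n) F _ (nbhs a)) => //.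
  by rewrite -{2}(addr0 a); apply: cvgD => //; exact: cvg_cst.
rewrite (_ : (fun n => _) = (fun n => (F (b - d n) - F (a + d n))%:E)) in cvg1.
  exact: (cvg_unique _ cvg1 cvg2).
by apply/funext => n; exact: FE.
Unshelve. all: by end_near. Qed.

Lemma improper_FTC_integrable (F phi : R -> R) (a b : R) : a < b ->
  {for a, continuous F} -> {for b, continuous F} ->
  (forall x, a < x < b -> is_derive x 1 F (phi x)) ->
  (forall x, a < x < b -> {for x, continuous phi}) ->
  (forall x, a < x < b -> 0 <= phi x) ->
  mu.-integrable `]a, b[ (EFin \o phi).
Proof.
move=> ab Fa Fb dF cphi phi0; apply/integrableP; split.
  apply/measurable_EFinP; apply: open_continuous_measurable_fun => // x.
  by rewrite inE/= in_itv/=; exact: cphi.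
rewrite (_ : (\int[mu]_(x in `]a, b[) `|(EFin \o phi) x|)%E = (F b - F a)%:E).
  by rewrite ltry.
rewrite -(improper_FTC ab Fa Fb dF cphi phi0); apply: eq_integral => x.
rewrite inE/= in_itv/= => xab; rewrite ger0_norm//.
exact: phi0.
Qed.

End improper_FTC.

Section arcsine_density.
Context {R : realType}.
Notation mu := (@lebesgue_measure R).
Notation RT := (measurableTypeR R).

Implicit Types x : R.

Definition semicircle (x : R) : R := Num.sqrt (1 - x ^+ 2).

Lemma semicircle_gt0 x : -1 < x < 1 -> 0 < semicircle x.
Proof. by move=> /andP[x1 x2]; rewrite sqrtr_gt0; nra. Qed.

Lemma semicircle_ge0 x : 0 <= semicircle x.
Proof. exact: sqrtr_ge0. Qed.

Lemma semicircle_le1 x : semicircle x <= 1.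
Proof. by rewrite -[leRHS]sqrtr1 ler_wsqrtr// lerBlDr lerDl sqr_ge0. Qed.

Lemma sqr_semicircle x : -1 <= x <= 1 -> semicircle x ^+ 2 = 1 - x ^+ 2.
Proof. by move=> /andP[x1 x2]; rewrite sqr_sqrtr//; nra. Qed.

Lemma continuous_semicircle : continuous semicircle.
Proof.
move=> x; rewrite (_ : semicircle = Num.sqrt \o (fun x : R => 1 - x ^+ 2))//.
apply: continuous_comp.
  apply: cvgB; first exact: cvg_cst.
  exact: exprn_continuous.
exact: sqrt_continuous.
Qed.

Lemma isder_semicircle x : -1 < x < 1 ->
  is_derive x 1 semicircle (- x / semicircle x).
Proof.
move=> x1; have w0 := semicircle_gt0 x1.
rewrite /semicircle; isder_auto => /=.
  by move: w0; rewrite sqrtr_gt0.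
by rewrite -/(semicircle x); field; rewrite gt_eqF.
Qed.

(** The density of the arcsine law without its factor 1/pi, not the inverse sine. *)
Definition arcsine (x : R) : R := (semicircle x)^-1.

Lemma continuous_arcsine x : -1 < x < 1 -> {for x, continuous arcsine}.
Proof.
move=> x1; apply: cvgV; first by rewrite gt_eqF// semicircle_gt0.
exact: continuous_semicircle.
Qed.

Lemma arcsine_gt0 x : -1 < x < 1 -> 0 < arcsine x.
Proof. by move=> x1; rewrite invr_gt0 semicircle_gt0. Qed.

(** The inverse sine by the half-angle formula, in a form that is continuous up to both
    endpoints. *)
Let asinF x : R := 2 * atan (x / (1 + semicircle x)).

Let continuous_asinF : continuous asinF.
Proof.
move=> x; apply: cvgM; first exact: cvg_cst.
apply: (@continuous_comp _ _ _ (fun x => x / (1 + semicircle x)) atan).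
  apply: cvgM; first exact: cvg_id.
  apply: cvgV; first by rewrite gt_eqF// ltr_wpDr// semicircle_ge0.
  by apply: cvgD; [exact: cvg_cst|exact: continuous_semicircle].
exact: continuous_atan.
Qed.

Let der_asinF x : -1 < x < 1 -> is_derive x 1 asinF (arcsine x).
Proof.
move=> x1; have w0 := semicircle_gt0 x1.
have x1' : -1 <= x <= 1 by move/andP : x1 => [? ?]; rewrite !ltW.
have w2 := sqr_semicircle x1'.
have dw := isder_semicircle x1.
have n0 : 1 + semicircle x != 0 by rewrite gt_eqF// ltr_wpDr// ltW.
have h := isder_mul (isder_cst 2 x) (isder_atan
  (isder_mul (isder_id x) (@isder_inv _ (fun y => 1 + semicircle y) x _ n0
    (isder_add (isder_cst 1 x) dw)))).
simple notypeclasses refine (is_derive_eq h _).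
rewrite /arcsine /=; move: (semicircle x) w0 w2 n0 => w w0 w2 n0.
have x2 : x ^+ 2 = 1 - w ^+ 2 by rewrite w2; ring.
have wn0 : w != 0 by rewrite gt_eqF.
have -> : 1 + (x / (1 + w)) ^+ 2 = 2 / (1 + w).
  by rewrite expr_div_n x2; field.
transitivity ((x ^+ 2 + w * (1 + w)) / (w * (1 + w))).
  by field; rewrite n0 wn0.
by rewrite x2; field; rewrite n0 wn0.
Qed.

Let n11 : -1 < 1 :> R. Proof. by lra. Qed.

Lemma arcsine_ge0 x : -1 < x < 1 -> 0 <= arcsine x.
Proof. by move=> /arcsine_gt0/ltW. Qed.

Lemma arcsine_integrable : mu.-integrable (@I11 R) (EFin \o arcsine).
Proof.
exact: (improper_FTC_integrable n11 (@continuous_asinF (-1))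
  (@continuous_asinF 1) der_asinF continuous_arcsine arcsine_ge0).
Qed.

Lemma arcsine_mass_gt0 : 0 < \int[mu]_(x in @I11 R) arcsine x.
Proof.
have h := improper_FTC n11 (@continuous_asinF (-1))
  (@continuous_asinF 1) der_asinF continuous_arcsine arcsine_ge0.
rewrite /Rintegral (_ : (\int[mu]_(x in @I11 R) _)%E = (asinF 1 - asinF (-1))%:E); last exact: h.
rewrite /= /asinF /semicircle sqrrN expr1n subrr sqrtr0 addr0 !divr1 atanN.
have : 0 < atan 1 :> R by rewrite atan1 divr_gt0// pi_gt0.
lra.
Qed.

Lemma trunc_hilbert_split (f : R -> R) (e t : R) : 0 < e ->
  mu.-integrable (@I11 R) (EFin \o f) -> I11 t ->
  \int[mu]_(x in @I11 R) (f x * trunc_inv e (x - t)) =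
  \int[mu]_(x in `]-1, t - e[) (f x / (x - t)) +
  \int[mu]_(x in `]t + e, 1[) (f x / (x - t)).
Proof.
move=> e0 fI /I11P /andP[t1 t2].
have FI := integrable_trunc_hilbert t e0 fI.
have inL x : (`]-1, t - e[ : set R)%classic x -> I11 x /\ e < `|x - t|.
  rewrite /= in_itv/= => /andP[x1 x2]; split.
    by apply/I11P; apply/andP; split; lra.
  by rewrite ltr0_norm; lra.
have inR x : (`]t + e, 1[ : set R)%classic x -> I11 x /\ e < `|x - t|.
  rewrite /= in_itv/= => /andP[x1 x2]; split.
    by apply/I11P; apply/andP; split; lra.
  by rewrite gtr0_norm; lra.
have Iin x : I11 x -> e < `|x - t| ->
    (`]-1, t - e[ `|` `]t + e, 1[ : set R)%classic x.
  move=> /I11P /andP[x1 x2]; rewrite ltr_normr => /orP[h|h].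
    by right; rewrite /= in_itv/=; apply/andP; split; lra.
  by left; rewrite /= in_itv/=; apply/andP; split; lra.
set F := fun x => f x * trunc_inv e (x - t).
transitivity (\int[mu]_(x in `]-1, t - e[ `|` `]t + e, 1[) F x).
  rewrite Rintegral_mkcond [RHS]Rintegral_mkcond; apply: eq_Rintegral => x _.
  rewrite !patchE /F; case: ifPn => [/set_mem Ix|nIx].
    case: ifPn => // nU; rewrite /trunc_inv; case: ifP => [eu|_]; last by rewrite mulr0.
    by move: nU; rewrite mem_set//; exact: Iin.
  case: ifPn => // /set_mem [/inL[Ix _]|/inR[Ix _]];
    by move: nIx; rewrite mem_set.
rewrite Rintegral_setU.
- by congr +%R; apply: eq_Rintegral => x; rewrite inE /F /trunc_inv;
    [move=> /inL[_ ->]|move=> /inR[_ ->]].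
- exact: measurable_itv.
- exact: measurable_itv.
- apply: (@integrableS _ _ _ mu (@I11 R)) FI.
  + exact: measurable_I11.
  + by apply: measurableU; exact: measurable_itv.
  + by move=> x [/inL[]|/inR[]].
- apply/eqP; rewrite -subset0 => x [].
  by rewrite /= !in_itv/= => /andP[_ h1] /andP[h2 _]; lra.
Qed.

End arcsine_density.

(** * The transform of the arcsine density *)

Section hilbert_arcsine.
Context {R : realType}.
Notation mu := (@lebesgue_measure R).
Notation RT := (measurableTypeR R).
Implicit Types x e : R.
Context (t : R) (t1 : -1 < t < 1).

Let s := semicircle t.

Let s0 : 0 < s. Proof. exact: semicircle_gt0. Qed.

Let s1 : s <= 1. Proof. exact: semicircle_le1. Qed.

Let s2 : s ^+ 2 = 1 - t ^+ 2.
Proof. by apply: sqr_semicircle; move/andP : t1 => [? ?]; rewrite !ltW. Qed.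

(* [ln (|x - t| / N x) / s] is an antiderivative of [arcsine x / (x - t)] that
   vanishes at both endpoints. *)
Let N x : R := 1 - x * t + s * semicircle x.

Let N_ge x : -1 <= x <= 1 -> 1 - `|t| <= N x.
Proof.
move=> /andP[x1 x2]; have w0 := semicircle_ge0 x.
have h : x * t <= `|t|.
  rewrite (le_trans (ler_norm _))// normrM ler_piMl// ler_norml x1//.
rewrite /N; have := mulr_ge0 (ltW s0) w0; lra.
Qed.

Let nt : 0 < 1 - `|t|.
Proof. by rewrite subr_gt0 ltr_norml. Qed.

Let N_gt0 x : -1 <= x <= 1 -> 0 < N x.
Proof. by move=> /N_ge; apply: lt_le_trans. Qed.

Let N_le3 x : -1 <= x <= 1 -> N x <= 3.
Proof.
move=> /andP[x1 x2]; have w0 := semicircle_ge0 x; have w1 := semicircle_le1 x.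
have h : - (x * t) <= 1.
  rewrite (le_trans (ler_norm _))// normrN normrM mulr_ile1//.
    by rewrite ler_norml x1.
  by move: nt; rewrite subr_gt0 => /ltW.
have : s * semicircle x <= 1 by rewrite mulr_ile1// ltW.
rewrite /N; lra.
Qed.

Let continuousN : continuous N.
Proof.
move=> x; apply: cvgD.
  apply: cvgB; first exact: cvg_cst.
  by apply: cvgM; [exact: cvg_id|exact: cvg_cst].
by apply: cvgM; [exact: cvg_cst|exact: continuous_semicircle].
Qed.

Let isderN x : -1 < x < 1 -> is_derive x 1 N (- t - s * (x / semicircle x)).
Proof.
move=> x1; have dw := isder_semicircle x1.
have h := isder_add (isder_add (isder_cst 1 x)
  (isder_opp (isder_mul (isder_id x) (isder_cst t x))))
  (isder_mul (isder_cst s x) dw).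
by simple notypeclasses refine (is_derive_eq h _); ring.
Qed.

Let log_derivative x : -1 < x < 1 -> x != t ->
  (x - t)^-1 - (- t - s * (x / semicircle x)) / N x = s * (arcsine x / (x - t)).
Proof.
move=> x1 xt; have w0 := semicircle_gt0 x1.
have x1' : -1 <= x <= 1 by move/andP : x1 => [? ?]; rewrite !ltW.
have w2 := sqr_semicircle x1'; have n0 := N_gt0 x1'.
rewrite /arcsine; move: n0; rewrite /N; move: (semicircle x) w0 w2 => w w0 w2 n0.
have e1 : s ^+ 2 * w = (1 - t ^+ 2) * w by rewrite s2.
have e2 : s * w ^+ 2 = s * (1 - x ^+ 2) by rewrite w2.
have wn0 : w != 0 by rewrite gt_eqF.
have nn0 : 1 - x * t + s * w != 0 by rewrite gt_eqF.
have xtn0 : x - t != 0 by rewrite subr_eq0.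
(* The numerator left after clearing denominators; it vanishes by [s ^+ 2 = 1 - t ^+ 2] and
   [semicircle x ^+ 2 = 1 - x ^+ 2]. *)
have num0 : (1 - t ^+ 2) * w - s ^+ 2 * w + (s * w ^+ 2 + s * (x ^+ 2 - 1)) = 0.
  by rewrite e1 e2; ring.
apply/eqP; rewrite -subr_eq0; apply/eqP.
transitivity (((1 - t ^+ 2) * w - s ^+ 2 * w + (s * w ^+ 2 + s * (x ^+ 2 - 1))) /
    (w * (1 - x * t + s * w) * (x - t))); last by rewrite num0 mul0r.
by field; rewrite wn0 nn0 xtn0.
Qed.

Let NE1 : N 1 = 1 - t.
Proof. by rewrite /N /semicircle expr1n subrr sqrtr0; ring. Qed.

Let NEN1 : N (-1) = 1 + t.
Proof. by rewrite /N /semicircle sqrrN expr1n subrr sqrtr0; ring. Qed.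

Let continuous_lnN x : -1 <= x <= 1 -> {for x, continuous (fun x => ln (N x))}.
Proof.
move=> x1; have : {for x, continuous (@ln R \o N)}; last by [].
apply: continuous_comp; first exact: continuousN.
exact/continuous_ln/N_gt0.
Qed.

Let continuous_kernel x : -1 < x < 1 -> x != t ->
  {for x, continuous (fun x => arcsine x / (x - t))}.
Proof.
move=> x1 xt; apply: cvgM; first exact: continuous_arcsine.
apply: cvgV; first by rewrite subr_eq0.
by apply: cvgB; [exact: cvg_id|exact: cvg_cst].
Qed.

Lemma arcsine_integral_right e : 0 < e -> t + e < 1 ->
  \int[mu]_(x in `]t + e, 1[) (arcsine x / (x - t)) = s^-1 * (ln (N (t + e)) - ln e).
Proof.
move=> e0 te; move/andP : t1 => [t1l t1r].
pose F x := s^-1 * (ln (x - t) - ln (N x)).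
have cF x : t < x <= 1 -> {for x, continuous F}.
  move=> /andP[tx x1]; apply: cvgM; first exact: cvg_cst.
  apply: cvgB; last by apply: continuous_lnN; apply/andP; split; lra.
  have : {for x, continuous (@ln R \o (fun x => x - t))}; last by [].
  apply: continuous_comp.
    by apply: cvgB; [exact: cvg_id|exact: cvg_cst].
  by apply: continuous_ln; rewrite subr_gt0.
have dF x : t + e < x < 1 -> is_derive x 1 F (arcsine x / (x - t)).
  move=> /andP[tx x1].
  have xt : 0 < x - t by lra.
  have x1' : -1 < x < 1 by apply/andP; split; lra.
  have Nx : 0 < N x by apply: N_gt0; apply/andP; split; lra.
  have h := isder_mul (isder_cst s^-1 x) (isder_add
    (@isder_ln _ (fun x => x - t) x _ xt
      (isder_add (isder_id x) (isder_cst (- t) x)))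
    (isder_opp (@isder_ln _ N x _ Nx (isderN x1')))).
  simple notypeclasses refine (is_derive_eq h _).
  have xnt : x != t by rewrite -subr_eq0 gt_eqF.
  have := log_derivative x1' xnt => ld.
  apply: (@mulfI _ s); first by rewrite gt_eqF.
  rewrite -ld mulr0 !addr0 mulr1 mulVKf ?gt_eqF//.
  by rewrite [(N x)^-1 * _]mulrC.
have cphi x : t + e < x < 1 -> {for x, continuous (fun x => arcsine x / (x - t))}.
  move=> /andP[tx x1]; apply: continuous_kernel; first by apply/andP; split; lra.
  by rewrite -subr_eq0 gt_eqF//; lra.
have phi0 x : t + e < x < 1 -> 0 <= arcsine x / (x - t).
  move=> /andP[tx x1]; rewrite divr_ge0//; last by lra.
  by apply: arcsine_ge0; apply/andP; split; lra.
have cFa : {for t + e, continuous F} by apply: cF; apply/andP; split; lra.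
have cFb : {for 1, continuous F} by apply: cF; apply/andP; split; lra.
have h := improper_FTC te cFa cFb dF cphi phi0.
rewrite /Rintegral (_ : (\int[mu]_(x in _) _)%E = (F 1 - F (t + e))%:E); last exact: h.
by rewrite /= /F NE1 subrr mulr0 sub0r (addrC t e) addrK -mulrN opprB.
Qed.

Lemma arcsine_integral_left e : 0 < e -> -1 < t - e ->
  \int[mu]_(x in `]-1, t - e[) (arcsine x / (x - t)) = s^-1 * (ln e - ln (N (t - e))).
Proof.
move=> e0 te; move/andP : t1 => [t1l t1r].
(* To the left of [t] the integrand is negative, so its opposite is integrated. *)
pose F x := - (s^-1 * (ln (t - x) - ln (N x))).
have cF x : -1 <= x < t -> {for x, continuous F}.
  move=> /andP[x1 tx]; apply: cvgN; apply: cvgM; first exact: cvg_cst.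
  apply: cvgB; last by apply: continuous_lnN; apply/andP; split; lra.
  have : {for x, continuous (@ln R \o (fun x => t - x))}; last by [].
  apply: continuous_comp.
    by apply: cvgB; [exact: cvg_cst|exact: cvg_id].
  by apply: continuous_ln; rewrite subr_gt0.
have dF x : -1 < x < t - e -> is_derive x 1 F (- (arcsine x / (x - t))).
  move=> /andP[x1 tx].
  have xt : 0 < t - x by lra.
  have x1' : -1 < x < 1 by apply/andP; split; lra.
  have Nx : 0 < N x by apply: N_gt0; apply/andP; split; lra.
  have h := isder_opp (isder_mul (isder_cst s^-1 x) (isder_add
    (@isder_ln _ (fun x => t - x) x _ xt
      (isder_add (isder_cst t x) (isder_opp (isder_id x))))
    (isder_opp (@isder_ln _ N x _ Nx (isderN x1'))))).
  simple notypeclasses refine (is_derive_eq h _).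
  have xnt : x != t by rewrite eq_sym -subr_eq0 gt_eqF.
  have := log_derivative x1' xnt => ld; congr (- _).
  apply: (@mulfI _ s); first by rewrite gt_eqF.
  rewrite -ld mulr0 addr0 mulVKf ?gt_eqF// add0r mulrN1.
  by rewrite [(N x)^-1 * _]mulrC -(opprB t x) invrN.
have cphi x : -1 < x < t - e ->
    {for x, continuous (fun x => - (arcsine x / (x - t)))}.
  move=> /andP[x1 tx]; apply: cvgN; apply: continuous_kernel.
    by apply/andP; split; lra.
  by rewrite eq_sym -subr_eq0 gt_eqF//; lra.
have phi0 x : -1 < x < t - e -> 0 <= - (arcsine x / (x - t)).
  move=> /andP[x1 tx]; rewrite -mulrN -invrN opprB divr_ge0//; last by lra.
  by apply: arcsine_ge0; apply/andP; split; lra.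
have cFa : {for -1, continuous F} by apply: cF; apply/andP; split; lra.
have cFb : {for t - e, continuous F} by apply: cF; apply/andP; split; lra.
have h := improper_FTC te cFa cFb dF cphi phi0.
have hI := improper_FTC_integrable te cFa cFb dF cphi phi0.
transitivity (- 1 * \int[mu]_(x in `]-1, t - e[) (- (arcsine x / (x - t)))).
  have mL : measurable (`]-1, t - e[%classic : set RT) by exact: measurable_itv.
  have <- := RintegralZl (-1) mL hI.
  by apply: eq_Rintegral => x _; rewrite mulN1r opprK.
rewrite /Rintegral (_ : (\int[mu]_(x in _) _)%E = (F (t - e) - F (-1))%:E); last exact: h.
by rewrite /= /F NEN1 !opprK subKr (addrC t 1) subrr mulr0 addr0 mulN1r opprK.
Qed.

(** From [1 - t ^+ 2 <= 4 * x] and [ln y < y] at the inverse square root of [x], the logarithm costs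
    a single factor [1 / s]. The resulting bound [8 / (1 - t ^+ 2)] becomes integrable after
    multiplication by the semicircle. *)
Let ln_bound x : 1 - `|t| <= x -> x <= 3 -> `|ln x| <= 4 / s.
Proof.
move=> x1 x3; have x0 : 0 < x by apply: lt_le_trans x1.
have sV : 1 <= s^-1 by rewrite invf_ge1.
rewrite ler_norml; apply/andP; split; last first.
  by have := ln_sublinear x0; lra.
have q0 : 0 < Num.sqrt x by rewrite sqrtr_gt0.
have sx : s <= 2 * Num.sqrt x.
  rewrite -(ler_pXn2r (n := 2)) ?nnegrE ?(ltW s0) ?mulr_ge0 ?(ltW q0)//.
  rewrite s2 exprMn sqr_sqrtr ?(ltW x0)//.
  have : t ^+ 2 = `|t| ^+ 2 by rewrite real_normK ?num_real.
  have := nt; have := normr_ge0 t; nra.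
have : - ln x <= 2 / Num.sqrt x.
  have -> : - ln x = 2 * ln (Num.sqrt x)^-1.
    rewrite lnV ?posrE// mulrN; congr (- _).
    by rewrite -{1}(sqr_sqrtr (ltW x0)) lnXn// mulr_natl.
  by rewrite ler_wpM2l// ltW// ln_sublinear// invr_gt0.
have : 2 / Num.sqrt x <= 4 / s.
  rewrite ler_pdivrMr// mulrAC ler_pdivlMr//; lra.
lra.
Qed.

Let pieceL e := if -1 < t - e then ln e - ln (N (t - e)) else 0.
Let pieceR e := if t + e < 1 then ln (N (t + e)) - ln e else 0.

Let trunc_hilbert_arcsineE e : 0 < e ->
  rtrunc_hilbert e arcsine t = pi^-1 * (s^-1 * (pieceL e + pieceR e)).
Proof.
move=> e0; rewrite /rtrunc_hilbert.
have It : I11 t by apply/I11P.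
rewrite (trunc_hilbert_split e0 arcsine_integrable It).
congr (_ * _); rewrite mulrDr; congr (_ + _).
- rewrite /pieceL; case: ltP => h; first exact: arcsine_integral_left.
  by rewrite set_itv_ge ?bnd_simp -?leNgt// Rintegral_set0 mulr0.
- rewrite /pieceR; case: ltP => h; first exact: arcsine_integral_right.
  by rewrite set_itv_ge ?bnd_simp -?leNgt// Rintegral_set0 mulr0.
Qed.

Lemma norm_trunc_hilbert_arcsine_le e : 0 < e ->
  `|rtrunc_hilbert e arcsine t| <= 8 / (1 - t ^+ 2).
Proof.
move=> e0; rewrite (trunc_hilbert_arcsineE e0).
have sV : 0 < s^-1 by rewrite invr_gt0.
have p1 : pi^-1 <= 1 :> R.
  by rewrite invf_le1 ?pi_gt0// (le_trans _ (pi_ge2 R))// ler1n.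
suff h : `|pieceL e + pieceR e| <= 8 / s.
  rewrite normrM ger0_norm ?invr_ge0 ?pi_ge0// -[leRHS]mul1r ler_pM//.
    by rewrite invr_ge0 pi_ge0.
  by rewrite normrM (ger0_norm (ltW sV)) -s2 expr2 invfM mulrCA ler_wpM2l// ltW.
move/andP : t1 => [t1l t1r].
have tb : - t <= `|t| /\ t <= `|t| by split; [rewrite -normrN|]; rewrite ler_norm.
have b1 : -1 < t - e -> `|ln (N (t - e))| <= 4 / s.
  by move=> h; apply: ln_bound; [apply: N_ge|apply: N_le3]; apply/andP; split; lra.
have b2 : t + e < 1 -> `|ln (N (t + e))| <= 4 / s.
  by move=> h; apply: ln_bound; [apply: N_ge|apply: N_le3]; apply/andP; split; lra.
have s4 : 0 <= 4 / s by rewrite divr_ge0// ltW.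
rewrite (_ : 8 / s = 4 / s + 4 / s); last by field; rewrite gt_eqF.
(* With both pieces present the terms [ln e] cancel. With one only, [e] is at least the distance
   from [t] to an endpoint, and [ln_bound] applies to [e] itself. *)
rewrite /pieceL /pieceR; case: ltP => hL; case: ltP => hR.
- rewrite (_ : _ + _ = ln (N (t + e)) - ln (N (t - e))); last by ring.
  by rewrite (le_trans (ler_normB _ _))// lerD ?b1 ?b2.
- rewrite addr0 (le_trans (ler_normB _ _))// lerD ?b1//.
  by apply: ln_bound; lra.
- rewrite add0r (le_trans (ler_normB _ _))// lerD ?b2//.
  by apply: ln_bound; lra.
- by rewrite addr0 normr0 addr_ge0.
Qed.

(** For small [e] both intervals are present and what remains is a difference of values of [ln N] on
    either side of [t]. *)
Lemma trunc_hilbert_arcsine_cvg0 :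
  rtrunc_hilbert e arcsine t @[e --> 0^'+] --> 0.
Proof.
move/andP : (t1) => [t1l t1r].
have t11 : -1 <= t <= 1 by rewrite !ltW.
have c1 : {for 0, continuous ((fun x => ln (N x)) \o (fun e : R => t + e))}.
  apply: continuous_comp; first by apply: cvgD; [exact: cvg_cst|exact: cvg_id].
  by rewrite addr0; exact: continuous_lnN.
have c2 : {for 0, continuous ((fun x => ln (N x)) \o (fun e : R => t - e))}.
  apply: continuous_comp; first by apply: cvgB; [exact: cvg_cst|exact: cvg_id].
  by rewrite subr0; exact: continuous_lnN.
have {}c1 : ln (N (t + e)) @[e --> (0 : R)] --> ln (N (t + 0)) := c1.
have {}c2 : ln (N (t - e)) @[e --> (0 : R)] --> ln (N (t - 0)) := c2.
rewrite addr0 in c1; rewrite subr0 in c2.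
have cN : ln (N (t + e)) - ln (N (t - e)) @[e --> 0^'+] --> 0.
  rewrite -[X in _ --> X](subrr (ln (N t))).
  by apply: cvgB; [exact: (cvg_at_right_filter c1)|exact: (cvg_at_right_filter c2)].
have h : pi^-1 * (s^-1 * (ln (N (t + e)) - ln (N (t - e)))) @[e --> 0^'+] --> 0.
  rewrite -[X in _ --> X](mulr0 pi^-1); apply: cvgM; first exact: cvg_cst.
  by rewrite -[X in _ --> X](mulr0 s^-1); apply: cvgM; first exact: cvg_cst.
apply: cvg_trans h; apply: near_eq_cvg; near=> e.
have e0 : 0 < e by near: e; exact: nbhs_right_gt.
have eL : e < t + 1 by near: e; apply: nbhs_right_lt; lra.
have eR : e < 1 - t by near: e; apply: nbhs_right_lt; lra.
rewrite (trunc_hilbert_arcsineE e0) /pieceL /pieceR ifT; last by lra.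
rewrite ifT; last by lra.
by congr (_ * (_ * _)); ring.
Unshelve. all: by end_near. Qed.

End hilbert_arcsine.

(** * Orthogonality and vanishing moments *)

Section dominated_real.
Context d {T : measurableType d} {R : realType} (mu : {measure set T -> \bar R}).

Lemma ae_imply (P Q : T -> Prop) : (forall x, P x -> Q x) ->
  {ae mu, forall x, P x} -> {ae mu, forall x, Q x}.
Proof.
move=> PQ [N [mN N0 PN]]; exists N; split => // x nQ.
by apply: PN => /PQ.
Qed.

Lemma Rdominated_cvg (D : set T) (f_ : nat -> T -> R) (f g : T -> R) :
  measurable D -> (forall n, measurable_fun D (f_ n)) -> measurable_fun D f ->
  {ae mu, forall x, D x -> f_ n x @[n --> \oo] --> f x} ->
  mu.-integrable D (EFin \o g) -> (forall n x, D x -> `|f_ n x| <= g x) ->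
  \int[mu]_(x in D) f_ n x @[n --> \oo] --> \int[mu]_(x in D) f x.
Proof.
move=> mD mf_ mf ff gI fg.
have h1 n : measurable_fun D (EFin \o f_ n) by exact/measurable_EFinP.
have h2 : measurable_fun D (EFin \o f) by exact/measurable_EFinP.
have h3 : {ae mu, forall x, D x -> (f_ n x)%:E @[n --> \oo] --> (f x)%:E}.
  apply: filterS ff => x h Dx; apply: cvg_EFin; first by near=> n.
  exact: h.
have h4 : {ae mu, forall x, forall n, D x -> (`|(EFin \o f_ n) x| <= (EFin \o g) x)%E}.
  by apply: aeW => x n Dx; rewrite lee_fin; exact: fg.
have [fI _ h] := dominated_convergence mD h1 h2 h3 gI h4.
have ffin : (\int[mu]_(x in D) (f x)%:E)%E \is a fin_num.
  exact: integrable_fin_num.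
rewrite /Rintegral; apply: fine_cvg.
by rewrite fineK//; exact: h.
Unshelve. all: by end_near. Qed.

End dominated_real.

Section polynomial_test_functions.
Context {R : realType}.
Notation mu := (@lebesgue_measure R).
Notation RT := (measurableTypeR R).
Implicit Types (x t e u : R) (k : nat).

Let I := @I11 R.

Lemma ae_neq (t : R) : {ae mu, forall x : R, x != t}.
Proof.
exists [set t]; split => /=.
- exact: measurable_set1.
- exact: lebesgue_measure_set1.
- by move=> x /= /negP; rewrite negbK => /eqP.
Qed.

(** This is [u * trunc_inv e u] for [e > 0]: what a factor [x - t] leaves of the truncated
    kernel. *)
Definition far (e u : R) : R := if e < `|u| then 1 else 0.

Let measurable_far e : measurable_fun setT (far e).
Proof.
apply: measurable_fun_ifT; [|exact: measurable_cst|exact: measurable_cst].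
by apply: measurable_fun_ltr => //; exact: normr_measurable.
Qed.

Let far_le1 e u : `|far e u| <= 1.
Proof. by rewrite /far; case: ifP; rewrite ?normr1 ?normr0. Qed.

Let farI (G : R -> R) e t : mu.-integrable I (EFin \o G) ->
  mu.-integrable I (fun x => (G x * far e (x - t))%:E).
Proof.
move=> GI; apply: (integrable_mul_bounded measurable_I11 GI (C := 1)).
  by apply: measurable_funTS; apply: measurable_translate; exact: measurable_far.
by move=> x _; exact: far_le1.
Qed.

Let far_cvg (G : R -> R) t : mu.-integrable I (EFin \o G) ->
  \int[mu]_(x in I) (G x * far n.+1%:R^-1 (x - t)) @[n --> \oo] -->
  \int[mu]_(x in I) G x.
Proof.
move=> GI; apply: (@Rdominated_cvg _ _ _ mu I _ G (fun x => `|G x|)).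
- exact: measurable_I11.
- by move=> n; exact: integrable_EFin_measurable (farI n.+1%:R^-1 t GI).
- exact: integrable_EFin_measurable GI.
- apply: ae_imply (ae_neq t) => x xt _.
  apply: cvg_near_cst; near=> n; rewrite /far ifT ?mulr1//.
  near: n; have h : 0 < `|x - t| by rewrite normr_gt0 subr_eq0.
  by have /= := near_infty_natSinv_lt (PosNum h).
- exact: integrable_norm GI.
- by move=> n x _; rewrite normrM ler_piMr.
Unshelve. all: by end_near. Qed.

Let far_bound (G : R -> R) e t : mu.-integrable I (EFin \o G) ->
  `|\int[mu]_(x in I) (G x * far e (x - t))| <= \int[mu]_(x in I) `|G x|.
Proof.
move=> GI; have h := farI e t GI.
rewrite (le_trans (le_normr_Rintegral measurable_I11 h))//.
apply: (le_Rintegral measurable_I11 (integrable_norm h) (integrable_norm GI)).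
by move=> x _ /=; rewrite normrM ler_piMr.
Qed.

Definition semicircle_monomial k x : R := semicircle x * x ^+ k.
Local Notation g := semicircle_monomial.

Lemma norm_semicircle_monomial_le k x : I x -> `|g k x| <= semicircle x.
Proof.
move=> /I11P /andP[x1 x2]; rewrite normrM (ger0_norm (semicircle_ge0 x)).
rewrite ler_piMr ?semicircle_ge0// normrX exprn_ile1// ler_norml.
by rewrite !ltW.
Qed.

Lemma norm_semicircle_monomial_le1 k x : I x -> `|g k x| <= 1.
Proof.
by move=> Ix; rewrite (le_trans (norm_semicircle_monomial_le k Ix))// semicircle_le1.
Qed.

Lemma measurable_semicircle_monomial k : measurable_fun I (g k).
Proof.
apply: measurable_funTS; apply: continuous_measurable_fun => x.
by apply: cvgM; [exact: continuous_semicircle|exact: exprn_continuous].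
Qed.

Lemma semicircle_monomial_integrable k : mu.-integrable I (EFin \o g k).
Proof.
exact: (integrable_bounded measurable_I11 mu_I11_fin
  (measurable_semicircle_monomial k) (@norm_semicircle_monomial_le1 k)).
Qed.

Let xarcsineI t : mu.-integrable I (fun x => (arcsine x * (x + t))%:E).
Proof.
apply: (integrable_mul_bounded measurable_I11 arcsine_integrable (C := 1 + `|t|)).
  apply: measurable_funTS; apply: continuous_measurable_fun => x.
  by apply: cvgD; [exact: cvg_id|exact: cvg_cst].
move=> x /I11P /andP[x1 x2]; rewrite (le_trans (ler_normD _ _))// lerD2r.
by rewrite ler_norml !ltW.
Qed.

Let RintegralZ (c : R) (F : R -> R) : mu.-integrable I (fun x => (F x)%:E) ->
  \int[mu]_(x in I) (c * F x) = c * \int[mu]_(x in I) F x.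
Proof. exact: (RintegralZl c measurable_I11). Qed.

(** The semicircle is [(1 - x ^+ 2) * arcsine x], and [1 - x ^+ 2 = (1 - t ^+ 2) - (x - t) * (x +
    t)]. *)
Let trunc_hilbert_g0 e t : 0 < e -> I t ->
  rtrunc_hilbert e (g 0) t = (1 - t ^+ 2) * rtrunc_hilbert e arcsine t -
    pi^-1 * \int[mu]_(x in I) (arcsine x * (x + t) * far e (x - t)).
Proof.
move=> e0 It.
have i1 := integrable_trunc_hilbert t e0 arcsine_integrable.
have i2 := integrable_scale (1 - t ^+ 2) measurable_I11 i1.
have i3 := farI e t (xarcsineI t).
rewrite /rtrunc_hilbert mulrCA -mulrBr; congr *%R.
rewrite -(RintegralZ _ i1) -(RintegralB measurable_I11 i2 i3).
apply: eq_Rintegral => x; rewrite inE => /I11P x1.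
have w0 := semicircle_gt0 x1.
have x1' : -1 <= x <= 1 by move/andP : x1 => [? ?]; rewrite !ltW.
have w2 := sqr_semicircle x1'.
rewrite /semicircle_monomial /arcsine expr0 mulr1 /trunc_inv /far.
case: ifPn => [xt|_]; last by rewrite !mulr0 subrr.
have xt0 : x - t != 0 by rewrite -normr_gt0 (lt_trans e0).
have -> : semicircle x = semicircle x ^+ 2 / semicircle x.
  by rewrite expr2 mulfK// gt_eqF.
rewrite {1}w2; move: (semicircle x) w0 => w w0.
have wn0 : w != 0 by rewrite gt_eqF.
by field; rewrite wn0 xt0.
Qed.

Let trunc_hilbert_gS e t k : 0 < e ->
  rtrunc_hilbert e (g k.+1) t = t * rtrunc_hilbert e (g k) t +
    pi^-1 * \int[mu]_(x in I) (g k x * far e (x - t)).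
Proof.
move=> e0.
have i1 := integrable_trunc_hilbert t e0 (semicircle_monomial_integrable k).
have i2 := integrable_scale t measurable_I11 i1.
have i3 := farI e t (semicircle_monomial_integrable k).
rewrite /rtrunc_hilbert mulrCA -mulrDr; congr *%R.
rewrite -(RintegralZ _ i1) -(RintegralD measurable_I11 i2 i3).
apply: eq_Rintegral => x _.
rewrite /semicircle_monomial /trunc_inv /far.
case: ifPn => [xt|_]; last by rewrite !mulr0 addr0.
have xt0 : x - t != 0 by rewrite -normr_gt0 (lt_trans e0).
by rewrite exprS; field.
Qed.

(* The finite Hilbert transform of [semicircle x * x ^+ k], a polynomial of
   degree [k.+1]. *)
Fixpoint hilbert_poly k : {poly R} :=
  match k with
  | 0%N => - (pi^-1)%:P * ((\int[mu]_(x in I) (arcsine x * x))%:P +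
                          (\int[mu]_(x in I) arcsine x)%:P * 'X)
  | k.+1 => 'X * hilbert_poly k + (pi^-1 * \int[mu]_(x in I) g k x)%:P
  end.

Let pV1 : 0 <= (@pi R)^-1 <= 1.
Proof.
rewrite invr_ge0 pi_ge0/= invf_le1 ?pi_gt0// (le_trans _ (pi_ge2 R))//.
by rewrite ler1n.
Qed.

Let e_ n : 0 < n.+1%:R^-1 :> R. Proof. by rewrite invr_gt0. Qed.

Lemma trunc_hilbert_arcsine_cvg t : I t ->
  rtrunc_hilbert n.+1%:R^-1 arcsine t @[n --> \oo] --> 0.
Proof.
move=> /I11P t1; have /cvg_at_rightP := trunc_hilbert_arcsine_cvg0 t1.
by apply; split => [n|]; [exact: e_|exact: cvg_harmonic].
Qed.

Lemma trunc_hilbert_monomial_cvg k t : I t ->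
  rtrunc_hilbert n.+1%:R^-1 (g k) t @[n --> \oo] --> (hilbert_poly k).[t].
Proof.
move=> It; elim: k => [|k IH].
  rewrite [X in _ --> X](_ : _ = (1 - t ^+ 2) * 0 -
      pi^-1 * \int[mu]_(x in I) (arcsine x * (x + t))).
    under eq_fun do rewrite (trunc_hilbert_g0 (e_ _) It).
    apply: cvgB; apply: cvgM; try exact: cvg_cst.
      exact: trunc_hilbert_arcsine_cvg.
    exact: far_cvg (xarcsineI t).
  have i1 : mu.-integrable I (fun x => (arcsine x * x)%:E).
    have := xarcsineI 0; apply: integrable_ext; first exact: measurable_I11.
    by move=> x _; rewrite addr0.
  have i2 := integrable_scale t measurable_I11 arcsine_integrable.
  have -> : \int[mu]_(x in I) (arcsine x * (x + t)) =
      \int[mu]_(x in I) (arcsine x * x) + t * \int[mu]_(x in I) arcsine x.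
    rewrite -(RintegralZ t arcsine_integrable) -(RintegralD measurable_I11 i1 i2).
    by apply: eq_Rintegral => x _; rewrite mulrDr [t * _]mulrC.
  by rewrite /= !hornerE; ring.
rewrite /= !hornerE.
under eq_fun do rewrite (trunc_hilbert_gS t k (e_ _)).
apply: cvgD; apply: cvgM; try exact: cvg_cst.
  exact: IH.
exact: far_cvg (semicircle_monomial_integrable k).
Qed.

(** Uniformity in both [e] and [t] allows dominated convergence against a merely integrable [f]; the
    factor [1 - t ^+ 2] absorbs the blow-up of the arcsine bound at the ends. *)
Lemma trunc_hilbert_monomial_bounded k : exists C : R, forall e t, 0 < e -> I t ->
  `|rtrunc_hilbert e (g k) t| <= C.
Proof.
elim: k => [|k [C IH]].
  exists (8 + 2 * \int[mu]_(x in I) arcsine x) => e t e0 It.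
  rewrite (trunc_hilbert_g0 e0 It) (le_trans (ler_normB _ _))// lerD//.
    have t1 : -1 < t < 1 by exact/I11P.
    have t2 : 0 < 1 - t ^+ 2.
      by rewrite -sqr_semicircle ?exprn_gt0 ?semicircle_gt0//; move/andP : t1 => [? ?]; rewrite !ltW.
    rewrite normrM (gtr0_norm t2) mulrC -ler_pdivlMr//.
    exact: norm_trunc_hilbert_arcsine_le.
  rewrite normrM -[leRHS]mul1r ler_pM//.
    by case/andP : pV1 => p0 p1; rewrite ger0_norm.
  rewrite (le_trans (far_bound e t (xarcsineI t)))// -(RintegralZ 2 arcsine_integrable).
  apply: (le_Rintegral measurable_I11 (integrable_norm (xarcsineI t))
    (integrable_scale 2 measurable_I11 arcsine_integrable)) => x /I11P x1 /=.
  rewrite normrM (ger0_norm (arcsine_ge0 x1)) mulrC ler_wpM2r ?arcsine_ge0//.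
  move/I11P : It => /andP[? ?]; move/andP : x1 => [? ?].
  by rewrite ler_norml; apply/andP; split; lra.
exists (C + 2) => e t e0 It.
rewrite (trunc_hilbert_gS t k e0) (le_trans (ler_normD _ _))// lerD//.
  rewrite normrM -[leRHS]mul1r ler_pM ?IH//.
  by move/I11P : It => /andP[? ?]; rewrite ler_norml !ltW.
rewrite normrM -[leRHS]mul1r ler_pM//.
  by case/andP : pV1 => p0 p1; rewrite ger0_norm.
rewrite (le_trans (far_bound e t (semicircle_monomial_integrable k)))//.
rewrite -[leRHS]mul1r -Rintegral_cst_I11.
apply: (le_Rintegral measurable_I11 (integrable_norm (semicircle_monomial_integrable k))).
  apply: (@integrable_bounded _ _ _ _ _ _ 1 measurable_I11 mu_I11_fin) => // x _.
  by rewrite normr1.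
by move=> x Ix; exact: norm_semicircle_monomial_le1.
Qed.

Let measurable_poly (p : {poly R}) : measurable_fun I (fun x => p.[x]).
Proof.
by apply: measurable_funTS; apply: continuous_measurable_fun; exact: continuous_horner.
Qed.

Let pairing_cvg (f : R -> R) k : mu.-integrable I (EFin \o f) ->
  \int[mu]_(x in I) (g k x * rtrunc_hilbert n.+1%:R^-1 f x) @[n --> \oo] -->
  - \int[mu]_(x in I) (f x * (hilbert_poly k).[x]).
Proof.
move=> fI; have [C HC] := trunc_hilbert_monomial_bounded k.
have gI := semicircle_monomial_integrable k.
have -> : (fun n => \int[mu]_(x in I) (g k x * rtrunc_hilbert n.+1%:R^-1 f x)) =
    (fun n => - \int[mu]_(x in I) (f x * rtrunc_hilbert n.+1%:R^-1 (g k) x)).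
  by apply/funext => n; exact: (trunc_hilbert_parseval (e_ n) fI gI).
have mf := integrable_EFin_measurable fI.
apply: cvgN; apply: (@Rdominated_cvg _ _ _ mu I _ _ (fun x => C * `|f x|)).
- exact: measurable_I11.
- move=> n; apply: measurable_funM => //.
  exact: (measurable_trunc_hilbert (e_ n) gI).
- by apply: measurable_funM => //; exact: measurable_poly.
- apply: aeW => x Ix; apply: cvgM; first exact: cvg_cst.
  exact: trunc_hilbert_monomial_cvg.
- exact: (integrable_scale C measurable_I11 (integrable_norm fI)).
- by move=> n x Ix; rewrite normrM mulrC ler_wpM2r// HC.
Qed.

(** One sequence, two limits: 0 by the pairing estimate, and minus the integral after moving the
    operator to the monomial. *)
Lemma zygmund_orthogonal (f : R -> R) k : mu.-integrable I (EFin \o f) ->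
  zygmund_tail (expR (@trunc_hilbert_gap R) * (8 * pi)) f ->
  {ae mu, forall t, I t -> rtrunc_hilbert n.+1%:R^-1 f t @[n --> \oo] --> 0} ->
  \int[mu]_(x in I) (f x * (hilbert_poly k).[x]) = 0.
Proof.
move=> fI ft T0; apply: oppr_inj; rewrite oppr0.
have h := trunc_hilbert_pairing_cvg0 fI ft (measurable_semicircle_monomial k)
  (@norm_semicircle_monomial_le1 k) T0.
have <- := cvg_lim (@Rhausdorff R) (pairing_cvg (k := k) fI).
exact: (cvg_lim (@Rhausdorff R) h).
Qed.

(** Here plain dominated convergence gives the limit 0: the semicircle times [8 / (1 - x ^+ 2)] is
    [8 * arcsine x]. *)
Lemma arcsine_orthogonal k :
  \int[mu]_(x in I) (arcsine x * (hilbert_poly k).[x]) = 0.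
Proof.
apply: oppr_inj; rewrite oppr0.
have gI := semicircle_monomial_integrable k.
suff h : \int[mu]_(x in I) (g k x * rtrunc_hilbert n.+1%:R^-1 arcsine x)
    @[n --> \oo] --> (0 : R).
  have <- := cvg_lim (@Rhausdorff R) (pairing_cvg (k := k) arcsine_integrable).
  exact: (cvg_lim (@Rhausdorff R) h).
rewrite [X in _ --> X](_ : 0 = \int[mu]_(x in I) 0); last first.
  by rewrite Rintegral_cst_I11 mul0r.
apply: (@Rdominated_cvg _ _ _ mu I _ _ (fun x => 8 * arcsine x)).
- exact: measurable_I11.
- move=> n; apply: measurable_funM; first exact: measurable_semicircle_monomial.
  exact: (measurable_trunc_hilbert (e_ n) arcsine_integrable).
- exact: measurable_cst.
- apply: aeW => x Ix; rewrite -(mulr0 (g k x)); apply: cvgM; first exact: cvg_cst.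
  exact: trunc_hilbert_arcsine_cvg.
- exact: (integrable_scale 8 measurable_I11 arcsine_integrable).
- move=> n x Ix; have x1 : -1 < x < 1 by exact/I11P.
  have w0 := semicircle_gt0 x1.
  have x1' : -1 <= x <= 1 by move/andP : x1 => [? ?]; rewrite !ltW.
  rewrite normrM (@le_trans _ _ (semicircle x * (8 / (1 - x ^+ 2))))//.
    rewrite ler_pM// ?norm_semicircle_monomial_le//.
    exact: norm_trunc_hilbert_arcsine_le.
  rewrite -(sqr_semicircle x1') /arcsine le_eqVlt; apply/orP; left; apply/eqP.
  by field; rewrite gt_eqF.
Qed.

End polynomial_test_functions.

(** * Integrable functions with vanishing moments *)

Section vanishing_moments.
Context {R : realType}.
Notation mu := (@lebesgue_measure R).
Notation RT := (measurableTypeR R).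

Let I := @I11 R.

Lemma bernoulli_ineq (u : R) m : -1 <= u -> 1 + m%:R * u <= (1 + u) ^+ m.
Proof.
move=> u1; elim: m => [|m IH]; first by rewrite mul0r addr0 expr0.
have h : 0 <= 1 + u by lra.
rewrite exprS (le_trans _ (ler_wpM2l h IH))// -natr1.
have : 0 <= m%:R * u ^+ 2 by rewrite mulr_ge0// sqr_ge0.
lra.
Qed.

(* With [y] affine in [x], these polynomials tend boundedly to the indicator
   function of a half-line, so that vanishing moments give vanishing primitives. *)
Lemma step_cvg1 (y : R) : 0 <= y -> y < 2^-1 ->
  (1 - y ^+ n) ^+ (2 ^ n) @[n --> \oo] --> (1 : R).
Proof.
move=> y0 y2; have q : `|2 * y| < 1 by rewrite ger0_norm ?mulr_ge0//; lra.
have yn n : 0 <= y ^+ n <= 1.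
  by rewrite exprn_ge0//= exprn_ile1//; lra.
apply: (@squeeze_cvgr _ _ _ _ (fun n => 1 - (2 * y) ^+ n) (cst 1)).
- near=> n; have /andP[a0 a1] := yn n; apply/andP; split.
    have := @bernoulli_ineq (- y ^+ n) (2 ^ n); rewrite lerN2 a1 => /(_ isT).
    by rewrite natrX mulrN -exprMn.
  by rewrite exprn_ile1//; lra.
- rewrite -[X in _ --> X]subr0; apply: cvgB; first exact: cvg_cst.
  exact: cvg_expr.
- exact: cvg_cst.
Unshelve. all: by end_near. Qed.

(** By Bernoulli, [(1 + y ^+ n) ^+ (2 ^ n)] is at least [(2 * y) ^+ n], and its product with the
    quantity in question is at most 1. *)
Lemma step_cvg0 (y : R) : 2^-1 < y -> y <= 1 ->
  (1 - y ^+ n) ^+ (2 ^ n) @[n --> \oo] --> (0 : R).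
Proof.
move=> y2 y1; have y0 : 0 < 2 * y by lra.
have q : `|(2 * y)^-1| < 1.
  by rewrite ger0_norm ?invr_ge0 ?(ltW y0)// invf_lt1//; lra.
have yn n : 0 <= y ^+ n <= 1.
  by rewrite exprn_ge0 ?exprn_ile1//; lra.
apply: (@squeeze_cvgr _ _ _ _ (cst 0) (fun n => (2 * y)^-1 ^+ n)).
- near=> n; have /andP[a0 a1] := yn n; apply/andP; split.
    by rewrite exprn_ge0//; lra.
  rewrite exprVn -[leRHS]mul1r ler_pdivlMr ?exprn_gt0//.
  apply: (@le_trans _ _ ((1 - y ^+ n) ^+ (2 ^ n) * (1 + y ^+ n) ^+ (2 ^ n))).
    rewrite ler_wpM2l ?exprn_ge0//; first by lra.
    have := @bernoulli_ineq (y ^+ n) (2 ^ n); rewrite natrX -exprMn => h.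
    by have := h ltac:(lra); lra.
  by rewrite -exprMn -subr_sqr expr1n exprn_ile1//; nra.
- exact: cvg_cst.
- exact: cvg_expr.
Unshelve. all: by end_near. Qed.

Let RintegralZ (c : R) (F : R -> R) : mu.-integrable I (fun x => (F x)%:E) ->
  \int[mu]_(x in I) (c * F x) = c * \int[mu]_(x in I) F x.
Proof. exact: (RintegralZl c measurable_I11). Qed.

Let polyI (K : R -> R) (p : {poly R}) : mu.-integrable I (EFin \o K) ->
  mu.-integrable I (fun x => (K x * p.[x])%:E).
Proof.
move=> KI; apply: (integrable_mul_bounded measurable_I11 KI
    (C := \sum_(i < size p) `|p`_i|)).
  apply: measurable_funTS; apply: continuous_measurable_fun.
  exact: continuous_horner.
move=> x /I11P /andP[x1 x2]; rewrite horner_coef (le_trans (ler_norm_sum _ _ _))//.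
apply: ler_sum => i _; rewrite normrM ler_piMr// normrX exprn_ile1//.
by rewrite ler_norml !ltW.
Qed.

(** The leading coefficient is always the mass of the arcsine density divided by [- pi], hence
    nonzero; every positive degree is reached. *)
Lemma size_hilbert_poly k : size (@hilbert_poly R k) = k.+2.
Proof.
elim: k => [|k IH].
  rewrite /= (_ : _ * _ =
    (- (pi^-1 * \int[mu]_(x in I) arcsine x))%:P * 'X +
    (- (pi^-1 * \int[mu]_(x in I) (arcsine x * x)))%:P); last first.
    by rewrite !polyCN !polyCM; ring.
  have h : - (pi^-1 * \int[mu]_(x in I) arcsine x) != 0.
    by rewrite oppr_eq0 mulf_neq0 ?invr_eq0 ?gt_eqF ?pi_gt0 ?arcsine_mass_gt0.
  by rewrite size_MXaddC polyC_eq0 (negbTE h)/= size_polyC h.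
rewrite /= mulrC size_MXaddC IH -size_poly_eq0 IH.
by [].
Qed.

Lemma orthogonal_all_poly (K : R -> R) : mu.-integrable I (EFin \o K) ->
  \int[mu]_(x in I) K x = 0 ->
  (forall k, \int[mu]_(x in I) (K x * (@hilbert_poly R k).[x]) = 0) ->
  forall p : {poly R}, \int[mu]_(x in I) (K x * p.[x]) = 0.
Proof.
move=> KI K0 Kq p.
have cst0 (c : R) : \int[mu]_(x in I) (K x * c%:P.[x]) = 0.
  under eq_Rintegral do rewrite hornerC mulrC.
  by rewrite (RintegralZ c KI) K0 mulr0.
elim: (size p) {-2}p (leqnn (size p)) => {p} [|n IH] p.
  by rewrite leqn0 size_poly_eq0 => /eqP ->; rewrite -polyC0; exact: cst0.
move=> sp; case: n IH sp => [_ sp|n IH sp].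
  by rewrite (size1_polyC sp); exact: cst0.
pose q := @hilbert_poly R n; pose c := p`_n.+1 / q`_n.+1.
have qn0 : q`_n.+1 != 0.
  have : lead_coef q != 0 by rewrite lead_coef_eq0 -size_poly_eq0 size_hilbert_poly.
  by rewrite lead_coefE size_hilbert_poly.
have sr : (size (p - c *: q)%R <= n.+1)%N.
  apply/leq_sizeP => j; rewrite leq_eqVlt => /predU1P[<-|nj].
    by rewrite coefB coefZ /c divfK// subrr.
  rewrite coefB coefZ !nth_default ?mulr0 ?subr0//.
    by rewrite size_hilbert_poly.
  exact: leq_trans sp nj.
have i1 := polyI (p - c *: q) KI.
have i2 := polyI q KI.
have i3 := integrable_scale c measurable_I11 i2.
transitivity (\int[mu]_(x in I) (K x * (p - c *: q).[x] + c * (K x * q.[x]))).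
  by apply: eq_Rintegral => x _; rewrite hornerD hornerN hornerZ; ring.
rewrite (RintegralD measurable_I11 i1 i3) (RintegralZ c i2) (IH _ sr) Kq.
by rewrite mulr0 addr0.
Qed.

Let vanishing_primitive (K : R -> R) (a : R) : mu.-integrable I (EFin \o K) ->
  (forall p : {poly R}, \int[mu]_(x in I) (K x * p.[x]) = 0) -> -1 < a < 1 ->
  \int[mu]_(x in I) (K x * (x <= a)%R%:R) = 0.
Proof.
move=> KI Kp /andP[a1 a2].
(* The value at [a] is the threshold 1/2, and the slope 1/4 keeps [Y] between 0 and 1 since points
   of the interval are less than 2 away from [a]. *)
pose Y : {poly R} := (2^-1 - a / 4)%:P + 4^-1 *: 'X.
pose P n : {poly R} := (1 - Y ^+ n) ^+ (2 ^ n).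
have YE x : Y.[x] = 2^-1 + (x - a) / 4.
  by rewrite /Y !hornerE; field.
have PE n x : (P n).[x] = (1 - Y.[x] ^+ n) ^+ (2 ^ n).
  by rewrite /P horner_exp hornerD hornerN horner_exp hornerC.
have Y01 x : I x -> 0 <= Y.[x] <= 1.
  by move=> /I11P /andP[x1 x2]; rewrite YE; apply/andP; split; lra.
have h : \int[mu]_(x in I) (K x * (P n).[x]) @[n --> \oo] -->
    \int[mu]_(x in I) (K x * (x <= a)%R%:R).
  apply: (@Rdominated_cvg _ _ _ mu I _ _ (fun x => `|K x|)).
  - exact: measurable_I11.
  - by move=> n; exact: integrable_EFin_measurable (polyI (P n) KI).
  - apply: measurable_funM; first exact: integrable_EFin_measurable KI.
    have -> : (fun x : R => (x <= a)%R%:R) = (\1_(`]-oo, a]) : R -> R).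
      by apply/funext => x; rewrite indicE mem_setE in_itv.
    exact: measurable_indic.
  - apply: ae_imply (ae_neq a) => x xa Ix; apply: cvgM; first exact: cvg_cst.
    have /andP[Y0 Y1] := Y01 x Ix.
    under eq_fun do rewrite PE.
    case: (ltgtP x a) xa => // xa _.
      by apply: step_cvg1 => //; rewrite YE; lra.
    by apply: step_cvg0 => //; rewrite YE; lra.
  - exact: integrable_norm KI.
  - move=> n x Ix; have /andP[Y0 Y1] := Y01 x Ix.
    have yn0 : 0 <= Y.[x] ^+ n by rewrite exprn_ge0.
    have yn1 : Y.[x] ^+ n <= 1 by rewrite exprn_ile1.
    by rewrite PE normrM ler_piMr// normrX exprn_ile1// ler_norml; lra.
rewrite -(cvg_lim (@Rhausdorff R) h).
by under eq_fun do rewrite Kp; rewrite lim_cst.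
Qed.

(** The primitive of [K] vanishes on the whole interval, and by Lebesgue differentiation its
    derivative is [K] almost everywhere. *)
Lemma vanishing_moments_ae0 (K : R -> R) : mu.-integrable I (EFin \o K) ->
  (forall p : {poly R}, \int[mu]_(x in I) (K x * p.[x]) = 0) ->
  {ae mu, forall x, I x -> K x = 0}.
Proof.
move=> KI Kp; pose Kt := K \_ I.
have KtI : mu.-integrable setT (EFin \o Kt).
  have := KI; rewrite (integrable_mkcond _ measurable_I11).
  by rewrite restrict_EFin.
have h1 y : mu.-integrable `]-oo, y] (EFin \o Kt).
  by apply: (@integrableS _ RT _ _ setT) KtI.
have h2 : locally_integrable setT Kt by exact: integrable_locally measurable_I11 KI.
have := FTC1Ny h1 h2; apply: ae_imply => x [_ Fx] Ix.
have FE a : I a -> \int[mu]_(t in `]-oo, a]) Kt t = 0.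
  move=> /I11P a1; rewrite -(vanishing_primitive KI Kp a1).
  rewrite Rintegral_mkcond [RHS]Rintegral_mkcond; apply: eq_Rintegral => t _.
  rewrite /Kt !patchE mem_setE in_itv/=.
  by case: ifP; case: ifP; rewrite ?mulr1 ?mulr0.
have KtE : Kt x = K x by rewrite /Kt patchE mem_set.
rewrite -KtE -Fx derive1E (@near_eq_derive _ _ _ _ (cst 0)) ?derive_cst//.
have xI : x \in `]-1, 1[%R by exact: Ix.
apply: filterS (near_in_itvoo xI) => y yI; apply: FE.
by rewrite /I /I11.
Qed.

End vanishing_moments.

(** * L log L *)

Section real_kernel.
Context {R : realType}.
Notation mu := (@lebesgue_measure R).
Notation RT := (measurableTypeR R).
Let I := @I11 R.

Lemma real_hilbert_kernel (f : R -> R) : mu.-integrable I (EFin \o f) ->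
  zygmund_tail (expR (@trunc_hilbert_gap R) * (8 * pi)) f ->
  {ae mu, forall t, I t -> rtrunc_hilbert n.+1%:R^-1 f t @[n --> \oo] --> 0} ->
  exists c : R, {ae mu, forall x, I x -> f x = c * arcsine x}.
Proof.
move=> fI ft T0; pose m := \int[mu]_(x in I) arcsine x.
have m0 : m != 0 by rewrite gt_eqF// arcsine_mass_gt0.
pose c := (\int[mu]_(x in I) f x) / m; exists c.
pose K x := f x - c * arcsine x.
have aI := integrable_scale c measurable_I11 (@arcsine_integrable R).
have KI : mu.-integrable I (EFin \o K) := integrable_sub measurable_I11 fI aI.
have K0 : \int[mu]_(x in I) K x = 0.
  rewrite (RintegralB measurable_I11 fI aI).
  rewrite (RintegralZl c measurable_I11 (@arcsine_integrable R)).
  by rewrite /c divfK// subrr.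
have bq k : exists C, forall x, I x -> `|(@hilbert_poly R k).[x]| <= C.
  exists (\sum_(i < size (@hilbert_poly R k)) `|(@hilbert_poly R k)`_i|).
  move=> x /I11P /andP[x1 x2]; rewrite horner_coef.
  rewrite (le_trans (ler_norm_sum _ _ _))//.
  apply: ler_sum => i _; rewrite normrM ler_piMr// normrX exprn_ile1//.
  by rewrite ler_norml !ltW.
have mq k : measurable_fun I (fun x => (@hilbert_poly R k).[x]).
  apply: measurable_funTS; apply: continuous_measurable_fun.
  exact: continuous_horner.
have Kq k : \int[mu]_(x in I) (K x * (@hilbert_poly R k).[x]) = 0.
  have [C HC] := bq k.
  have i1 := integrable_mul_bounded measurable_I11 fI (mq k) HC.
  have i2 := integrable_mul_bounded measurable_I11 (@arcsine_integrable R) (mq k) HC.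
  have i3 := integrable_scale c measurable_I11 i2.
  transitivity (\int[mu]_(x in I) (f x * (@hilbert_poly R k).[x] -
      c * (arcsine x * (@hilbert_poly R k).[x]))).
    by apply: eq_Rintegral => x _; rewrite /K; ring.
  rewrite (RintegralB measurable_I11 i1 i3) (RintegralZl c measurable_I11 i2).
  by rewrite (zygmund_orthogonal k fI ft T0) arcsine_orthogonal mulr0 subrr.
have := vanishing_moments_ae0 KI (orthogonal_all_poly KI K0 Kq).
by apply: ae_imply => x Kx Ix; apply/eqP; rewrite -subr_eq0; apply/eqP/Kx.
Qed.

End real_kernel.

Section zygmund_weight.
Context {R : realType}.
Notation mu := (@lebesgue_measure R).
Notation RT := (measurableTypeR R).
Let I := @I11 R.

(** Up to a summand [d], the L log L norm of the indicator function of a set of measure [d]; the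
    factor [d] makes it 0 for null sets. *)
Definition zygmund_weight (d : R) : R := d * ln (2 * expR 1 / d).

Lemma zygmund_weight_ge (d : R) : 0 <= d <= 2 -> d <= zygmund_weight d.
Proof.
move=> /andP[d0 d2]; rewrite /zygmund_weight.
move: d0; rewrite le_eqVlt => /predU1P[<-|d0]; first by rewrite mul0r.
rewrite -{1}[d]mulr1 ler_wpM2l ?(ltW d0)// -{1}[1](@expRK R) ler_ln ?posrE ?expR_gt0//.
  by rewrite ler_pdivlMr// mulrC ler_wpM2r// expR_ge0.
by rewrite divr_gt0// mulr_gt0// expR_gt0.
Qed.

Lemma young_indic_pairing (v : R -> R) (A : set R) (a C : R) :
  measurable (A : set RT) -> A `<=` I -> 0 < a -> measurable_fun I v ->
  mu.-integrable I (EFin \o (fun t => expR `|v t|)) ->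
  \int[mu]_(t in I) expR `|v t| <= C ->
  \int[mu]_(t in I) (\1_A t * `|v t|) <= - ln a * fine (mu A) + a * C.
Proof.
move=> mA AI a0 mv eI eC.
(* Young's inequality [y <= - ln a + a * expR y], integrated over [A]. *)
have m1 : measurable_fun I (\1_A : R -> R) by exact: measurable_indic.
have i1 : mu.-integrable I (EFin \o (\1_A : R -> R)).
  apply: (integrable_bounded measurable_I11 mu_I11_fin m1 (C := 1)) => x _.
  by rewrite indicE; case: (_ \in _); rewrite ?normr1 ?normr0.
have i2 := integrable_scale (- ln a) measurable_I11 i1.
have i3 := integrable_scale a measurable_I11 eI.
have mvv : measurable_fun I (fun t => \1_A t * `|v t|).
  by apply: measurable_funM m1 _; apply: measurableT_comp mv; exact: normr_measurable.
have vexp t : `|v t| <= expR `|v t| by have := expR_ge1Dx `|v t|; lra.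
have i4 : mu.-integrable I (EFin \o (fun t => \1_A t * `|v t|)).
  apply: (integrable_le measurable_I11 eI mvv) => t _.
  rewrite normrM normr_id indicE; case: (_ \in _); rewrite ?normr1 ?normr0 ?mul1r ?mul0r.
    exact: vexp.
  exact: expR_ge0.
apply: (@le_trans _ _ (\int[mu]_(t in I) (- ln a * \1_A t + a * expR `|v t|))).
  apply: le_Rintegral; [exact: measurable_I11|exact: i4
    |exact: integrable_add measurable_I11 i2 i3|].
  move=> t _; rewrite indicE; have e0 := expR_gt0 `|v t|.
  have ae0 : 0 < a * expR `|v t| by rewrite mulr_gt0.
  case: (_ \in _); rewrite ?(mul1r, mulr1, mul0r, mulr0); last by lra.
  have := le_ln1Dx (x := a * expR `|v t| - 1).
  rewrite [1 + _]addrC subrK lnM ?posrE// expRK.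
  by move=> /(_ ltac:(lra)); lra.
rewrite (RintegralD measurable_I11 i2 i3).
have z1 : \int[mu]_(t in I) (- ln a * \1_A t) = - ln a * \int[mu]_(t in I) \1_A t.
  exact: RintegralZl measurable_I11 i1.
have z2 : \int[mu]_(t in I) (a * expR `|v t|) = a * \int[mu]_(t in I) expR `|v t|.
  exact: RintegralZl measurable_I11 eI.
have z3 : \int[mu]_(t in I) \1_A t = fine (mu A).
  by rewrite /Rintegral (integral_indic _ measurable_I11 mA) setIidl.
rewrite z1 z2 z3.
by rewrite lerD2l ler_wpM2l ?(ltW a0).
Qed.

(** Young's parameter [a] is taken to be the measure of [A], which balances the two terms. *)
Lemma zygmund_weight_pairing (v : R -> R) (A : set R) (C : R) :
  measurable (A : set RT) -> A `<=` I -> fine (mu A) <= 2 -> measurable_fun I v ->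
  mu.-integrable I (EFin \o (fun t => expR `|v t|)) ->
  \int[mu]_(t in I) expR `|v t| <= C ->
  \int[mu]_(t in I) (\1_A t * `|v t|) <= (1 + C) * zygmund_weight (fine (mu A)).
Proof.
move=> mA AI d2 mv eI eC; have Y a a0 := @young_indic_pairing v A a C mA AI a0 mv eI eC.
have d0 : 0 <= fine (mu A) by rewrite fine_ge0// measure_ge0.
have C0 : 0 <= C.
  apply: le_trans eC; apply: Rintegral_ge0 => t _; exact: expR_ge0.
have wd : fine (mu A) <= zygmund_weight (fine (mu A)).
  by apply: zygmund_weight_ge; rewrite d0 d2.
move: (fine (mu A)) d0 d2 Y wd => d; rewrite {1}le_eqVlt => /predU1P[<-|d0] d2 Y wd.
  (* For a null set that choice is not positive; arbitrarily small parameters are used instead. *)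
  rewrite /zygmund_weight mul0r mulr0; apply/ler_addgt0Pr => e e0.
  rewrite add0r; have e1 : 0 < e / (C + 1) by rewrite divr_gt0//; lra.
  have := Y _ e1; rewrite mulr0 add0r => /le_trans; apply.
  rewrite mulrAC ler_pdivrMr; last by lra.
  by rewrite ler_wpM2l ?(ltW e0)//; lra.
apply: (le_trans (Y _ d0)).
rewrite mulrDl mul1r lerD//; last by rewrite mulrC ler_wpM2l.
rewrite /zygmund_weight mulrC ler_wpM2l ?(ltW d0)//.
rewrite ln_div ?posrE ?mulr_gt0 ?expR_gt0// lnM ?posrE ?expR_gt0// expRK.
have := ln_ge0 (x := 2 : R); lra.
Qed.

End zygmund_weight.

(** * From sums over superlevel sets to the tail estimate *)

Section zygmund_from_superlevels.
Context {R : realType}.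
Notation mu := (@lebesgue_measure R).
Notation RT := (measurableTypeR R).
Let I := @I11 R.

Context (f : R -> R) (E : nat -> set R) (S : R).
Context (mf : measurable_fun I f)
  (mE : forall k, measurable (E k : set RT)) (EI : forall k, E k `<=` I)
  (fE : forall k x, I x -> 2 ^+ k < `|f x| -> E k x).

Let d k : R := fine (mu (E k)).

Context (dS : forall n, \sum_(k < n) 2 ^+ k * zygmund_weight (d k) <= S).

Let muE k : (mu (E k) <= 2%:E)%E.
Proof.
rewrite -(@mu_I11 R); apply: (@le_measure _ _ _ mu).
- by rewrite inE; exact: mE.
- by rewrite inE; exact: measurable_I11.
- exact: EI.
Qed.

Let muEd k : mu (E k) = (d k)%:E.
Proof.
by rewrite /d fineK// ge0_fin_numE// (le_lt_trans (muE k))// ltry.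
Qed.

Let d02 k : 0 <= d k <= 2.
Proof. by rewrite -!lee_fin -muEd measure_ge0 muE. Qed.

Let w0 k : 0 <= zygmund_weight (d k).
Proof.
by have := zygmund_weight_ge (d02 k); have /andP[] := d02 k; lra.
Qed.

Let trunc (a : R) n := Num.min a (2 ^+ n).

(** A dyadic layer cake: doubling the truncation level [2 ^+ n] adds at most [2 ^+ n], and only
    where [|f|] exceeds it. *)
Let trunc_le x n : I x ->
  trunc `|f x| n <= 1 + \sum_(k < n) 2 ^+ k * \1_(E k) x.
Proof.
move=> Ix; elim: n => [|n IH].
  by rewrite big_ord0 addr0 /trunc expr0 ge_min lexx orbT.
rewrite big_ord_recr/= addrA; apply: le_trans (lerD IH (lexx _)).
rewrite /trunc indicE; case: (ltP (2 ^+ n) `|f x|) => h.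
  rewrite mem_set ?mulr1; last exact: fE.
  by rewrite ge_min exprS; apply/orP; right; lra.
have : 0 <= 2 ^+ n * (x \in E n)%:R :> R by rewrite mulr_ge0 ?exprn_ge0.
rewrite ge_min; move=> h0; apply/orP; left; lra.
Qed.

(** The layers below [K] add up to at most [2 ^+ K - 1]. *)
Let trunc_leK x n K : I x -> (K <= n)%N ->
  trunc `|f x| n <= 2 ^+ K + \sum_(K <= k < n) 2 ^+ k * \1_(E k) x.
Proof.
move=> Ix Kn; rewrite (le_trans (trunc_le n Ix))//.
rewrite -(big_mkord xpredT (fun k => 2 ^+ k * \1_(E k) x)).
rewrite (@big_cat_nat _ _ _ K)//= addrA lerD2r.
elim: K {Kn} => [|K IH]; first by rewrite big_geq// addr0 expr0.
rewrite big_nat_recr//= addrA exprS.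
have : 2 ^+ K * \1_(E K) x <= 2 ^+ K :> R.
  by rewrite ler_piMr ?exprn_ge0// indicE; case: (_ \in _).
lra.
Qed.

Let trunc_near x : \forall n \near \oo, trunc `|f x| n = `|f x|.
Proof.
near=> n; apply/min_idPl; apply: (@le_trans _ _ (n%:R : R)).
  by near: n; exact: nbhs_infty_ger.
by rewrite -natrX ler_nat ltnW// ltn_expl.
Unshelve. all: by end_near. Qed.

Let trunc_ge0 a n : 0 <= a -> 0 <= trunc a n.
Proof. by move=> a0; rewrite le_min a0 exprn_ge0. Qed.

Let trunc_nd a : nondecreasing_seq (trunc a).
Proof.
move=> m n mn; rewrite le_min ge_min lexx/= ge_min; apply/orP; right.
by rewrite ler_weXn2l// ler1n.
Qed.

Let mtrunc n : measurable_fun I (fun x => trunc `|f x| n).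
Proof.
apply: measurable_minr; last exact: measurable_cst.
by apply: measurableT_comp mf; exact: normr_measurable.
Qed.

Let truncI n : mu.-integrable I (EFin \o (fun x => trunc `|f x| n)).
Proof.
apply: (integrable_bounded measurable_I11 mu_I11_fin (mtrunc n) (C := 2 ^+ n)).
by move=> x _; rewrite ger0_norm ?trunc_ge0// ge_min lexx orbT.
Qed.

Let indI k : mu.-integrable I (EFin \o (\1_(E k) : R -> R)).
Proof.
have m1 : measurable_fun I (\1_(E k) : R -> R) by apply: measurable_indic; exact: mE.
apply: (integrable_bounded measurable_I11 mu_I11_fin m1 (C := 1)) => x _.
by rewrite indicE; case: (_ \in _); rewrite ?normr1 ?normr0.
Qed.

Let trunc_mass n : \int[mu]_(x in I) trunc `|f x| n <= 2 + S.
Proof.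
have c1 : mu.-integrable I (EFin \o (fun=> 1 : R)).
  apply: (integrable_bounded measurable_I11 mu_I11_fin (measurable_cst _) (C := 1)).
  by move=> x _; rewrite normr1.
have kI k := integrable_scale (2 ^+ k) measurable_I11 (indI k).
have sI : mu.-integrable I (EFin \o (fun x => \sum_(0 <= k < n) 2 ^+ k * \1_(E k) x)).
  have := integrable_sum measurable_I11 (index_iota 0 n) (P := xpredT) (fun k _ => kI k).
  apply: eq_integrable; first exact: measurable_I11.
  by move=> x _; rewrite /= sumEFin.
apply: (@le_trans _ _ (\int[mu]_(x in I) (1 + \sum_(0 <= k < n) 2 ^+ k * \1_(E k) x))).
  apply: (le_Rintegral measurable_I11 (truncI n) (integrable_add measurable_I11 c1 sI)).
  by move=> x Ix; rewrite big_mkord; exact: trunc_le.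
rewrite (RintegralD measurable_I11 c1 sI) Rintegral_cst_I11 mul1r lerD2l.
rewrite (Rintegral_sum _ measurable_I11 kI) big_mkord.
apply: le_trans (dS n); apply: ler_sum => k _.
have -> : \int[mu]_(x in I) (2 ^+ k * \1_(E k) x) = 2 ^+ k * d k.
  have -> : d k = \int[mu]_(x in I) \1_(E k) x.
    by rewrite /Rintegral (integral_indic _ measurable_I11 (mE k)) setIidl.
  exact: RintegralZl measurable_I11 (indI k).
by rewrite ler_wpM2l ?exprn_ge0// zygmund_weight_ge.
Qed.

Lemma superlevel_integrable : mu.-integrable I (EFin \o f).
Proof.
apply/integrableP; split; first exact/measurable_EFinP.
have E1 : (\int[mu]_(x in I) `|(EFin \o f) x| =
    \int[mu]_(x in I) limn (fun n => (trunc `|f x| n)%:E))%E.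
  apply: eq_integral => x _ /=; apply/esym/cvg_lim => //.
  by apply: cvg_near_cst; apply: filterS (trunc_near x) => n ->.
rewrite E1 monotone_convergence; first last.
- by move=> x _ m n mn; rewrite lee_fin; exact: trunc_nd.
- by move=> n x _; rewrite lee_fin trunc_ge0.
- by move=> n; apply/measurable_EFinP; exact: mtrunc.
- exact: measurable_I11.
apply: (@le_lt_trans _ _ (2 + S)%:E); last exact: ltry.
apply: lime_le.
  apply: ereal_nondecreasing_is_cvgn => m n mn; apply: ge0_le_integral.
  - exact: measurable_I11.
  - by move=> x _; rewrite lee_fin trunc_ge0.
  - by apply/measurable_EFinP; exact: mtrunc.
  - by apply/measurable_EFinP; exact: mtrunc.
  - by move=> x _; rewrite lee_fin; exact: trunc_nd.
apply: nearW => n.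
rewrite -[leLHS]fineK; first by rewrite lee_fin; exact: trunc_mass.
exact: (integrable_fin_num measurable_I11 (truncI n)).
Qed.

Let tail_sum (eta : R) : 0 < eta -> exists K, forall n, (K <= n)%N ->
  \sum_(K <= k < n) 2 ^+ k * zygmund_weight (d k) <= eta.
Proof.
move=> eta0; pose u n := \sum_(0 <= k < n) 2 ^+ k * zygmund_weight (d k).
have und : nondecreasing_seq u.
  apply/nondecreasing_seqP => n; rewrite /u big_nat_recr//= lerDl.
  by rewrite mulr_ge0 ?exprn_ge0 ?w0.
have ucv : cvgn u.
  apply: nondecreasing_is_cvgn => //; exists S => _ [n _ <-].
  by rewrite /u big_mkord; exact: dS.
have /cvgrPdist_le/(_ _ eta0) [K _ /(_ K (leqnn K)) hK] := ucv.
exists K => n Kn; have un := nondecreasing_cvgn_le und ucv n.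
have : u n = u K + \sum_(K <= k < n) 2 ^+ k * zygmund_weight (d k).
  by rewrite /u (@big_cat_nat _ _ _ K).
by have := ler_norm (limn u - u K); lra.
Qed.

(** [M] is [2 ^+ K]. Low layers are bounded by [M * |v|]; each higher layer pairs with [v] at cost
    [(1 + C) * 2 ^+ k] times its weight, and [K] makes the sum of these at most [eta]. *)
Lemma superlevel_zygmund_tail (C : R) : 0 <= C -> zygmund_tail C f.
Proof.
move=> C0 eta eta0; have C1 : 0 < 1 + C by lra.
have [K HK] := tail_sum (divr_gt0 eta0 C1).
exists (2 ^+ K); first by rewrite exprn_ge0.
move=> v eI mv fvI eC.
have mav : measurable_fun I (fun x => `|v x|).
  by apply: measurableT_comp mv; exact: normr_measurable.
have vI : mu.-integrable I (EFin \o (fun x => `|v x|)).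
  apply: (integrable_le measurable_I11 eI mav) => x _; rewrite normr_id.
  by have := expR_ge1Dx `|v x|; lra.
have maf : measurable_fun I (fun x => `|f x|).
  by apply: measurableT_comp mf; exact: normr_measurable.
have mtv n : measurable_fun I (fun x => trunc `|f x| n * `|v x|).
  exact: measurable_funM (mtrunc n) mav.
have mfv : measurable_fun I (fun x => `|f x| * `|v x|).
  exact: measurable_funM maf mav.
have cv : {ae mu, forall x, I x ->
    trunc `|f x| n * `|v x| @[n --> \oo] --> `|f x| * `|v x|}.
  apply: aeW => x _; apply: cvg_near_cst.
  by apply: filterS (trunc_near x) => n ->.
have tv n x : I x -> `|trunc `|f x| n * `|v x| | <= `|f x * v x|.
  move=> _; rewrite !normrM normr_id ler_wpM2r//.
  by rewrite ger0_norm ?trunc_ge0// ge_min lexx.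
have lim := @Rdominated_cvg _ RT R mu I (fun n x => trunc `|f x| n * `|v x|) _ _
  measurable_I11 mtv mfv cv (integrable_norm fvI) tv.
have -> : \int[mu]_(x in I) `|f x * v x| = \int[mu]_(x in I) (`|f x| * `|v x|).
  by apply: eq_Rintegral => x _; rewrite normrM.
apply: (cvgr_to_le lim); exists K => // n /= Kn.
have KI := integrable_scale (2 ^+ K) measurable_I11 vI.
have ivI k : mu.-integrable I (EFin \o (fun x => \1_(E k) x * `|v x|)).
  apply: (integrable_le measurable_I11 vI).
    apply: measurable_funM mav; apply: measurable_indic; exact: mE.
  move=> x _; rewrite normrM normr_id ler_piMl// indicE.
  by case: (_ \in _); rewrite ?normr1 ?normr0.
have jI k := integrable_scale (2 ^+ k) measurable_I11 (ivI k).
have sI : mu.-integrable I (EFin \o (fun x =>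
    \sum_(K <= k < n) 2 ^+ k * (\1_(E k) x * `|v x|))).
  have := integrable_sum measurable_I11 (index_iota K n) (P := xpredT) (fun k _ => jI k).
  apply: eq_integrable; first exact: measurable_I11.
  by move=> x _; rewrite /= sumEFin.
apply: (@le_trans _ _ (\int[mu]_(x in I) (2 ^+ K * `|v x| +
    \sum_(K <= k < n) 2 ^+ k * (\1_(E k) x * `|v x|)))).
  apply: le_Rintegral measurable_I11 _ (integrable_add measurable_I11 KI sI) _.
    exact: (integrable_le measurable_I11 (integrable_norm fvI) (mtv n) (tv n)).
  move=> x Ix; under eq_bigr do rewrite mulrA.
  rewrite -mulr_suml -mulrDl ler_wpM2r//; exact: trunc_leK.
rewrite (RintegralD measurable_I11 KI sI).
have z1 : \int[mu]_(x in I) (2 ^+ K * `|v x|) = 2 ^+ K * \int[mu]_(x in I) `|v x|.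
  exact: RintegralZl measurable_I11 vI.
rewrite z1 lerD2l (Rintegral_sum _ measurable_I11 jI).
apply: (@le_trans _ _ (\sum_(K <= k < n) (1 + C) * (2 ^+ k * zygmund_weight (d k)))).
  apply: ler_sum => k _; rewrite mulrCA.
  have -> : \int[mu]_(x in I) (2 ^+ k * (\1_(E k) x * `|v x|)) =
      2 ^+ k * \int[mu]_(x in I) (\1_(E k) x * `|v x|).
    exact: RintegralZl measurable_I11 (ivI k).
  rewrite ler_wpM2l ?exprn_ge0//; apply: zygmund_weight_pairing mv eI eC => //.
  by have /andP[] := d02 k.
by rewrite -mulr_sumr mulrC -ler_pdivlMr// HK.
Qed.

End zygmund_from_superlevels.

(** * Completed Lebesgue measure *)

Section completion.
Context {R : realType}.
Notation mu := (@lebesgue_measure R).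
Notation RT := (measurableTypeR R).
Notation LT := (lebesgueType R).
Notation lmu := (lebmu R).

Lemma lebesgue_measurable_split (A : set R) : measurable (A : set LT) ->
  exists2 B : set R, measurable (B : set RT) &
    exists2 N : set R, mu.-negligible N & B `|` N = A.
Proof.
move=> mA; have : (completed_algebra_gen mu).-sigma.-measurable A.
  by rewrite completed_caratheodory_measurable.
by rewrite g_sigma_completed_algebra_genE => -[B mB [N nN <-]]; exists B => //; exists N.
Qed.

Lemma borel_lebesgue_measurable (A : set R) :
  measurable (A : set RT) -> measurable (A : set LT).
Proof. exact: sub_caratheodory. Qed.

(** A Lebesgue null set is the union of a Borel set and a Borel-negligible one, and the Borel part
    is null as well. *)
Lemma negligible_lebmu (A : set R) : lmu.-negligible A <-> mu.-negligible A.
Proof.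
split=> [[N [mN N0 AN]]|[N [mN N0 AN]]]; last first.
  by exists N; split => //; exact: borel_lebesgue_measurable.
have [B mB [M nM BM]] := lebesgue_measurable_split mN.
apply: (@negligibleS _ RT R mu _ _ AN); rewrite -BM; apply: negligibleU => //.
apply/negligibleP => //; apply/eqP; rewrite eq_le measure_ge0 andbT.
have BN : B `<=` N by rewrite -BM; exact: subsetUl.
rewrite -N0; apply: (@le_measure _ _ _ lmu) => //; rewrite inE//.
exact: borel_lebesgue_measurable.
Qed.

Lemma ae_lebmu (P : R -> Prop) : {ae lmu, forall x, P x} <-> {ae mu, forall x, P x}.
Proof. exact: negligible_lebmu. Qed.

Lemma borel_lebesgue_measurable_fun (D : set R) (h : R -> R) :
  measurable (D : set RT) -> measurable_fun (D : set RT) (h : RT -> RT) ->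
  measurable_fun (D : set LT) (h : LT -> RT).
Proof.
by move=> mD mh _ Y mY; apply: borel_lebesgue_measurable; exact: mh.
Qed.

(** Lebesgue measure on Borel sets is the image of its completion under the identity. *)
Lemma lebmu_ge0_integral (D : set R) (h : R -> \bar R) :
  measurable (D : set RT) -> measurable_fun (D : set RT) (h : RT -> \bar R) ->
  (forall x, D x -> (0 <= h x)%E) ->
  (\int[lmu]_(x in D) h x = \int[mu]_(x in D) h x)%E.
Proof.
move=> mD mh h0.
have mid : measurable_fun setT (id : LT -> RT).
  by move=> _ Y mY; rewrite setTI; exact: borel_lebesgue_measurable.
have h0' : {in D, forall y, (0 <= h y)%E} by move=> x /set_mem/h0.
have /= <- := ge0_integral_pushforward mid lmu mD mh h0'.
exact: eq_measure_integral.
Qed.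

Lemma lebmu_integral (D : set R) (h : R -> \bar R) :
  measurable (D : set RT) -> measurable_fun (D : set RT) (h : RT -> \bar R) ->
  (\int[lmu]_(x in D) h x = \int[mu]_(x in D) h x)%E.
Proof.
move=> mD mh; rewrite integralE [in RHS]integralE.
by congr (_ - _)%E; apply: lebmu_ge0_integral => //;
  [exact: measurable_funepos|exact: measurable_funeneg].
Qed.

Lemma lebmu_Rintegral_ae (D : set R) (h k : R -> R) : measurable (D : set RT) ->
  measurable_fun (D : set LT) (h : LT -> RT) ->
  measurable_fun (D : set RT) (k : RT -> RT) ->
  {ae mu, forall x, D x -> h x = k x} ->
  \int[lmu]_(x in D) h x = \int[mu]_(x in D) k x.
Proof.
move=> mD mh mk hk; rewrite /Rintegral -lebmu_integral; last 2 first.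
- exact: mD.
- exact/measurable_EFinP.
congr fine; apply: ae_eq_integral.
- exact: borel_lebesgue_measurable.
- exact/measurable_EFinP.
- by apply/measurable_EFinP; exact: borel_lebesgue_measurable_fun.
- by apply/ae_lebmu; apply: ae_imply hk => x hx Dx /=; rewrite hx.
Qed.

(** Each set [f > q], [q] rational, is Borel up to a negligible set. These countably many exceptions
    lie in one Borel null set [N], on which [g] is put equal to 0. *)
Lemma borel_version (D : set R) (f : R -> R) : measurable (D : set RT) ->
  measurable_fun (D : set LT) (f : LT -> RT) ->
  exists2 g : R -> R, measurable_fun (D : set RT) (g : RT -> RT) &
    {ae mu, forall x, D x -> f x = g x}.
Proof.
move=> mD mf.
have split q : exists BN : set R * set R, [/\ measurable (BN.1 : set RT),
    mu.-negligible BN.2 & BN.1 `|` BN.2 = D `&` [set x | ratr q < f x]].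
  have m : measurable ((D `&` [set x | ratr q < f x]) : set LT).
    rewrite -preimage_itvoy; apply: mf; first exact: borel_lebesgue_measurable.
    exact: measurable_itv.
  have [B mB [N nN BN]] := lebesgue_measurable_split m.
  by exists (B, N).
have [F FP] := choice split.
pose G (n : nat) : set R := oapp (fun q => (F q).2) set0 (unpickle n).
have Gq q : G (pickle q) = (F q).2 by rewrite /G pickleK.
have : mu.-negligible (\bigcup_n G n).
  apply: negligible_bigcup => n; rewrite /G; case: (unpickle n) => [q|] /=.
    by have [] := FP q.
  exact: negligible_set0.
move=> [N [mN N0 FN]].
have FNq q : (F q).2 `<=` N.
  rewrite -Gq => x Gx; exact: (FN x (ex_intro2 _ _ (pickle q) I Gx)).
pose g x := if x \in N then 0 else f x.
exists g; last first.
  exists N; split => // x /= /not_implyP[_ gx]; apply: contrapT => Nx.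
  by apply: gx; rewrite /g memNset.
have mDN : measurable (D `\` N : set RT) by exact: measurableD.
have mg : measurable_fun (D `\` N : set RT) (g : RT -> RT).
  move=> _; apply: (measurability _ (RGenOInfty.measurableE R)) => //.
  move=> /= _ [_ [a ->] <-]; rewrite preimage_itvoy.
  (* Off [N], the set [g > a] is the union over rationals [q > a] of the Borel parts of [f > q]. *)
  rewrite [X in measurable X](_ : _ =
      \bigcup_(q : rat) if a < ratr q then (F q).1 `\` N else set0).
    apply: bigcupT_measurable_rat => q; case: ifP => // _.
    by apply: measurableD => //; have [] := FP q.
  apply/seteqP; split => [x /= [[Dx Nx]]|x [q _]].
    rewrite /g memNset// => /rat_in_itvoo[q]; rewrite in_itv/= => /andP[aq qx].
    exists q => //; rewrite aq; split => //.
    have [_ _ /seteqP[_ /(_ x)]] := FP q.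
    by move=> /(_ (conj Dx qx)) [//|/FNq].
  case: ifP => // aq [Fx Nx].
  have [_ _ /seteqP[/(_ x) + _]] := FP q.
  move=> /(_ (or_introl Fx)) [Dx qx].
  by split => //=; rewrite /g memNset//; exact: lt_trans aq qx.
have mg0 : measurable_fun (D `&` N : set RT) (g : RT -> RT).
  apply: (@eq_measurable_fun _ _ RT RT _ (cst 0)); last exact: measurable_cst.
  by move=> x /set_mem[_ Nx]; rewrite /g mem_set.
rewrite (_ : D = (D `\` N) `|` (D `&` N)); last by rewrite setUC setUIDK.
by apply/measurable_funU => //; exact: measurableI.
Qed.

End completion.

(** * From the rearrangement to sums over superlevel sets *)

Section superlevel_sums.
Context {R : realType}.
Notation mu := (@lebesgue_measure R).
Notation RT := (measurableTypeR R).
Notation lmu := (lebmu R).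
Let I := @I11 R.

Context (f : R -> R[i]) (E : nat -> set R).
Context (mE : forall k, measurable (E k : set RT)) (EI : forall k, E k `<=` I)
  (Ef : forall k, mu.-negligible (E k `\` superlevel f (2 ^+ k))).

Let d k : R := fine (mu (E k)).

Let muE k : (mu (E k) <= 2%:E)%E.
Proof.
rewrite -(@mu_I11 R); apply: (@le_measure _ _ _ mu).
- by rewrite inE; exact: mE.
- by rewrite inE; exact: measurable_I11.
- exact: EI.
Qed.

Let muEd k : mu (E k) = (d k)%:E.
Proof.
by rewrite /d fineK// ge0_fin_numE// (le_lt_trans (muE k))// ltry.
Qed.

Let d02 k : 0 <= d k <= 2.
Proof. by rewrite -!lee_fin -muEd measure_ge0 muE. Qed.

(** The completed measure is an outer measure on all sets, so monotonicity and subadditivity apply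
    directly to the superlevel sets. *)
Let mu_superlevel k (l : R) : l <= 2 ^+ k -> (mu (E k) <= lmu (superlevel f l))%E.
Proof.
move=> lk; have [N [mN N0 EN]] := Ef k.
have sub : E k `<=` superlevel f l `|` N.
  move=> x Ex; have [[Ix fx]|nx] := pselect (superlevel f (2 ^+ k) x).
    by left; split => //; exact: le_lt_trans fx.
  by right; apply: EN.
have : (lmu (E k) <= lmu (superlevel f l `|` N))%E by exact: le_outer_measure.
move=> /le_trans; apply.
have : (lmu (superlevel f l `|` N) <= lmu (superlevel f l) + lmu N)%E.
  exact: outer_measureU2.
by rewrite [X in (_ + X)%E](_ : _ = 0)%E ?adde0//.
Qed.

(** A sum of distinct powers of 2 is less than twice the largest one. *)
Let geometric_le (P : pred nat) (l : R) : 0 <= l ->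
  (forall k, P k -> 2 ^+ k <= l) ->
  forall n, \sum_(k < n | P k) 2 ^+ k <= 2 * l.
Proof.
move=> l0 Pl; elim=> [|n IH]; first by rewrite big_ord0 mulr_ge0.
rewrite big_mkcond big_ord_recr -big_mkcond/=; case: ifP => Pn; last by rewrite addr0.
have := Pl n Pn.
have : \sum_(k < n | P k) 2 ^+ k <= 2 ^+ n :> R.
  elim: n {IH Pn} => [|n IH]; first by rewrite big_ord0 expr0.
  rewrite big_mkcond big_ord_recr -big_mkcond/= exprS.
  have : 0 <= 2 ^+ n :> R by rewrite exprn_ge0.
  by case: ifP => _; lra.
lra.
Qed.

(** A level [l] admissible in the infimum at [t] is at least [2 ^+ k] whenever [t < d k]; summing
    these powers costs the factor 2. *)
Let rearrangement_ge n t :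
  ((2^-1 * \sum_(k < n | t < d k) 2 ^+ k)%:E <= rearrangement f t)%E.
Proof.
apply: le_ereal_inf_tmp => _ [l [l0 lt] <-]; rewrite lee_fin.
suff : \sum_(k < n | t < d k) 2 ^+ k <= 2 * l by lra.
apply: (@geometric_le (fun k => t < d k)) => // k tk.
rewrite leNgt; apply/negP => /ltW /mu_superlevel h.
by have := le_trans h lt; rewrite muEd lee_fin leNgt tk.
Qed.

Let rearrangement_nonincr s t : s <= t ->
  (rearrangement f t <= rearrangement f s)%E.
Proof.
move=> st; apply: ereal_inf_le_tmp => _ [l [l0 lt] <-].
by exists l => //; split => //; apply: (le_trans lt); rewrite lee_fin.
Qed.

Let D : set R := [set` `]0, 2[%R].

Let mD : measurable (D : set RT). Proof. exact: measurable_itv. Qed.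

Let DP t : D t <-> 0 < t < 2. Proof. by rewrite /D/= in_itv. Qed.

(** The rearrangement is nonincreasing, so its superlevel sets are intervals. *)
Let measurable_rearrangement : measurable_fun (D : set RT) (rearrangement f).
Proof.
move=> _; apply: (measurability _ (ErealGenOInfty.measurableE R)) => //.
move=> /= _ [_ [a ->] <-]; apply: is_interval_measurable.
move=> x z [/DP/andP[x0 x2] fx] [/DP/andP[z0 z2] fz] y /andP[xy yz].
split; first by apply/DP; rewrite (lt_le_trans x0 xy) (le_lt_trans yz z2).
move: fz; rewrite /= !in_itv/= !andbT => /lt_le_trans; apply.
exact: rearrangement_nonincr.
Qed.

Let lnw t := ln (2 * expR 1 / t) : R.

Let lnw_ge0 t : D t -> 0 <= lnw t.
Proof.
move=> /DP/andP[t0 t2]; apply: ln_ge0; rewrite ler_pdivlMr// mul1r.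
have := expR_ge1Dx (1 : R); lra.
Qed.

Let lnw_le s t : 0 < s -> s <= t -> lnw t <= lnw s.
Proof.
move=> s0 st; have e0 := expR_gt0 (1 : R); have t0 := lt_le_trans s0 st.
rewrite /lnw ler_ln ?posrE ?divr_gt0 ?mulr_gt0//.
by rewrite ler_wpM2l ?mulr_ge0 ?(ltW e0)// lef_pV2.
Qed.

Let measurable_lnw : measurable_fun (D : set RT) (lnw : RT -> RT).
Proof.
apply: measurable_funTS; apply: measurableT_comp; first exact: measurable_ln.
by apply: measurable_funM => //; exact: measurable_invr.
Qed.

Let rearrangement_ge0 t : (0 <= rearrangement f t)%E.
Proof.
by apply: le_ereal_inf_tmp => _ [l [l0 _] <-]; rewrite lee_fin.
Qed.

(** On []0, d k[] the logarithm is at least its value at [d k]; with that value each term integrates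
    to half of [2 ^+ k * zygmund_weight (d k)]. *)
Let step n t : R :=
  \sum_(0 <= k < n) (2^-1 * (2 ^+ k * lnw (d k))) * \1_(`]0, d k[%classic) t.

Let step_le n t : D t ->
  ((step n t)%:E <= rearrangement f t * (lnw t)%:E)%E.
Proof.
move=> Dt; have /DP/andP[t0 t2] := Dt.
apply: (@le_trans _ _ ((2^-1 * \sum_(k < n | t < d k) 2 ^+ k)%:E * (lnw t)%:E)%E).
  rewrite -EFinM lee_fin /step big_mkord mulr_sumr mulr_suml [leRHS]big_mkcond/=.
  apply: ler_sum => k _; rewrite indicE.
  have [tk|kt] := ltP t (d k).
    rewrite mem_set/=; last by rewrite /= in_itv/= t0.
    rewrite mulr1 -mulrA ler_wpM2l// ler_wpM2l ?exprn_ge0//.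
    exact: lnw_le t0 (ltW tk).
  rewrite memNset ?mulr0// /= in_itv/= t0/=.
  by rewrite ltNge kt.
by rewrite lee_wpmul2r ?lee_fin ?lnw_ge0//; exact: rearrangement_ge.
Qed.

Lemma zygmund_superlevel_sum n : (LlogL_norm f < +oo)%E ->
  \sum_(k < n) 2 ^+ k * zygmund_weight (d k) <= 2 * fine (LlogL_norm f).
Proof.
move=> foo.
have F0 t : D t -> (0 <= rearrangement f t * (lnw t)%:E)%E.
  by move=> Dt; rewrite mule_ge0// lee_fin lnw_ge0.
have mF : measurable_fun (D : set RT) (fun t => rearrangement f t * (lnw t)%:E)%E.
  apply: emeasurable_funM => //; exact/measurable_EFinP.
have normE : (LlogL_norm f = \int[mu]_(t in D) (rearrangement f t * (lnw t)%:E))%E.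
  exact: lebmu_ge0_integral.
have norm0 : (0 <= LlogL_norm f)%E by rewrite normE; exact: integral_ge0.
have normK : (fine (LlogL_norm f))%:E = LlogL_norm f by rewrite fineK ?ge0_fin_numE.
have mu_D : (mu D < +oo)%E.
  have /= -> := @lebesgue_measure_itv R `]0, 2[%R.
  by case: ifP => _; rewrite ?oppe0 ?adde0 ltry.
have mi k : measurable_fun (D : set RT) (\1_(`]0, d k[%classic) : RT -> RT).
  by apply: measurable_indic; exact: measurable_itv.
have iI k : mu.-integrable D (EFin \o (\1_(`]0, d k[%classic) : R -> R)).
  apply: (integrable_bounded mD mu_D (mi k) (C := 1)) => x _.
  by rewrite indicE; case: (_ \in _); rewrite ?normr1 ?normr0.
have kI k := integrable_scale (2^-1 * (2 ^+ k * lnw (d k))) mD (iI k).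
have sI : mu.-integrable D (EFin \o step n).
  have := integrable_sum mD (index_iota 0 n) (P := xpredT) (fun k _ => kI k).
  apply: eq_integrable; first exact: mD.
  by move=> x _; rewrite /= /step sumEFin.
have step0 t : D t -> 0 <= step n t.
  move=> Dt; apply: sumr_ge0 => k _; rewrite indicE.
  have [|_] := boolP (t \in _); last by rewrite mulr0.
  rewrite inE/= in_itv/= => /andP[t0 td]; rewrite mulr1 mulr_ge0// mulr_ge0//.
  rewrite ln_ge0// ler_pdivlMr ?(lt_trans t0 td)// mul1r.
  have /andP[_ d2] := d02 k; have := expR_ge1Dx (1 : R); lra.
have sle : (\int[mu]_(t in D) (step n t)%:E <= LlogL_norm f)%E.
  rewrite normE; apply: ge0_le_integral.
  - exact: mD.
  - by move=> t Dt; rewrite lee_fin; exact: step0.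
  - exact: measurable_int sI.
  - exact: mF.
  - by move=> t; exact: step_le.
have sE : (\int[mu]_(t in D) (step n t)%:E)%E =
    (2^-1 * \sum_(k < n) 2 ^+ k * zygmund_weight (d k))%:E.
  rewrite -[LHS]fineK; last exact: (integrable_fin_num mD sI).
  congr EFin; rewrite -/(Rintegral _ _ _) (Rintegral_sum _ mD kI) big_mkord mulr_sumr.
  apply: eq_bigr => k _.
  have z1 : \int[mu]_(t in D) (2^-1 * (2 ^+ k * lnw (d k)) * \1_(`]0, d k[%classic) t) =
      2^-1 * (2 ^+ k * lnw (d k)) * \int[mu]_(t in D) \1_(`]0, d k[%classic) t.
    exact: RintegralZl mD (iI k).
  have z2 : \int[mu]_(t in D) \1_(`]0, d k[%classic) t = d k.
    have mL : measurable (`]0, d k[%classic : set RT) by exact: measurable_itv.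
    rewrite /Rintegral (integral_indic _ mD mL) setIidl; last first.
      move=> t /=; rewrite in_itv/= => /andP[t0 td]; apply/DP.
      by have /andP[_ d2] := d02 k; rewrite t0 (lt_le_trans td d2).
    have /= -> := @lebesgue_measure_itv R `]0, d k[%R.
    rewrite lte_fin; have /andP[dk0 _] := d02 k.
    case: ltP => [_|dk]; first by rewrite -EFinB subr0.
    by apply/eqP; rewrite eq_le dk dk0.
  by rewrite z1 z2 /zygmund_weight /lnw; ring.
by move: sle; rewrite sE -[X in (_ <= X)%E]normK lee_fin; lra.
Qed.

End superlevel_sums.

(** * Reduction of the complex transform to Borel real and imaginary parts *)

Section complex_truncation.
Context {R : realType}.
Notation mu := (@lebesgue_measure R).
Notation RT := (measurableTypeR R).
Notation LT := (lebesgueType R).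
Notation lmu := (lebmu R).
Let I := @I11 R.
Implicit Types (f : R -> R[i]) (u g : R -> R) (z : R[i]) (r : R).

Lemma Re_div_real z r : complex.Re (z / r%:C) = complex.Re z / r.
Proof. by rewrite -fmorphV; case: z => a b /=; rewrite mulr0 subr0. Qed.

Lemma Im_div_real z r : complex.Im (z / r%:C) = complex.Im z / r.
Proof. by rewrite -fmorphV; case: z => a b /=; rewrite mulr0 add0r. Qed.

Lemma normc_ge_absRe z : `|complex.Re z| <= Normc.normc z.
Proof.
case: z => a b /=; rewrite -sqrtr_sqr ler_sqrt ?lerDl ?sqr_ge0//.
by rewrite addr_ge0 ?sqr_ge0.
Qed.

Lemma normc_ge_absIm z : `|complex.Im z| <= Normc.normc z.
Proof.
case: z => a b /=; rewrite -sqrtr_sqr ler_sqrt ?lerDr ?sqr_ge0//.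
by rewrite addr_ge0 ?sqr_ge0.
Qed.

Lemma normc_le_absD z : Normc.normc z <= `|complex.Re z| + `|complex.Im z|.
Proof.
case: z => a b /=; rewrite -[leRHS]ger0_norm ?addr_ge0// -sqrtr_sqr.
rewrite ler_sqrt ?sqr_ge0// sqrrD !real_normK ?num_real//.
have : 0 <= `|a| * `|b| by rewrite mulr_ge0.
rewrite -mulr_natl; lra.
Qed.

(** Up to null sets, the superlevel sets of the real function lie in those of the modulus of [f],
    whose rearrangement is the one controlled. *)
Lemma zygmund_borel_version f u : (LlogL_norm f < +oo)%E ->
  measurable_fun (I : set LT) (u : LT -> RT) ->
  (forall x, `|u x| <= Normc.normc (f x)) ->
  exists g, [/\ mu.-integrable I (EFin \o g),
    forall C, 0 <= C -> zygmund_tail C g &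
    {ae mu, forall x, I x -> u x = g x}].
Proof.
move=> foo mu_ uf; have [g mg ug] := borel_version measurable_I11 mu_.
pose E k : set R := I `&` [set x | 2 ^+ k < `|g x|].
have mE k : measurable (E k : set RT).
  rewrite /E -preimage_itvoy.
  have mag : measurable_fun (I : set RT) (fun x => `|g x|).
    by apply: measurableT_comp mg; exact: normr_measurable.
  by apply: mag; [exact: measurable_I11|exact: measurable_itv].
have EI k : E k `<=` I by exact: subIsetl.
have gE k x : I x -> 2 ^+ k < `|g x| -> E k x by [].
have Ef k : mu.-negligible (E k `\` superlevel f (2 ^+ k)).
  apply: negligibleS ug => x /= [[Ix gx] nf] ux; apply: nf; split => //.
  by rewrite (lt_le_trans _ (uf x))// ux.
have ES n := zygmund_superlevel_sum mE EI Ef n foo.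
exists g; split => //.
- exact: superlevel_integrable mg mE EI gE ES.
- exact: superlevel_zygmund_tail mg mE EI gE ES.
Qed.

Lemma rtrunc_hilbert_version u g (t e : R) : 0 < e -> I t ->
  measurable_fun (I : set LT) (u : LT -> RT) ->
  mu.-integrable I (EFin \o g) -> {ae mu, forall x, I x -> u x = g x} ->
  rtrunc_hilbert e g t = pi^-1 *
    (\int[lmu]_(x in [set` `]-1, t - e[%R]) (u x / (x - t)) +
     \int[lmu]_(x in [set` `]t + e, 1[%R]) (u x / (x - t))).
Proof.
move=> e0 It mu_ gI ug; rewrite /rtrunc_hilbert trunc_hilbert_split//.
have /I11P /andP[t1 t2] := It.
have mg : measurable_fun (I : set RT) (g : RT -> RT) :=
  integrable_EFin_measurable gI.
have minv : measurable_fun setT (fun x : RT => (x - t)^-1 : RT).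
  by apply: measurableT_comp; [exact: measurable_invr|exact: measurable_funB].
have version (D : set R) : measurable (D : set RT) -> D `<=` I ->
    \int[lmu]_(x in D) (u x / (x - t)) = \int[mu]_(x in D) (g x / (x - t)).
  move=> mD DI; apply: lebmu_Rintegral_ae.
  - exact: mD.
  - apply: measurable_funM.
      apply: measurable_funS mu_ => //.
      exact: (borel_lebesgue_measurable measurable_I11).
    apply: borel_lebesgue_measurable_fun => //; exact: measurable_funTS.
  - apply: measurable_funM; last exact: measurable_funTS.
    apply: measurable_funS mg => //; exact: measurable_I11.
  - by apply: ae_imply ug => x ux /DI Ix; rewrite ux.
rewrite !version//.
- by move=> x /=; rewrite in_itv/= => /andP[x1 x2]; apply/I11P; apply/andP; split=> //; lra.
- by move=> x /=; rewrite in_itv/= => /andP[x1 x2]; apply/I11P; apply/andP; split=> //; lra.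
Qed.

(** The almost everywhere equalities are absorbed by the integrals, so this holds at every [t] of
    the interval. *)
Lemma truncated_hilbertE f g h (t e : R) : 0 < e -> I t -> cmeasurable I f ->
  mu.-integrable I (EFin \o g) -> mu.-integrable I (EFin \o h) ->
  {ae mu, forall x, I x -> complex.Re (f x) = g x} ->
  {ae mu, forall x, I x -> complex.Im (f x) = h x} ->
  truncated_hilbert f t e = rtrunc_hilbert e g t +i* rtrunc_hilbert e h t.
Proof.
move=> e0 It [mr mi] gI hI fg fh.
rewrite (rtrunc_hilbert_version e0 It mr gI fg).
rewrite (rtrunc_hilbert_version e0 It mi hI fh).
rewrite /truncated_hilbert /cintegral.
have rE (D : set R) : \int[lmu]_(x in D) complex.Re (f x / (x - t)%:C) =
    \int[lmu]_(x in D) (complex.Re (f x) / (x - t)).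
  by apply: eq_Rintegral => x _; rewrite Re_div_real.
have iE (D : set R) : \int[lmu]_(x in D) complex.Im (f x / (x - t)%:C) =
    \int[lmu]_(x in D) (complex.Im (f x) / (x - t)).
  by apply: eq_Rintegral => x _; rewrite Im_div_real.
rewrite !rE !iE; apply/eqP; rewrite eq_complex /=.
by rewrite !mul0r subr0 addr0 !eqxx.
Qed.

Lemma complex_cvg0P (T : Type) (F : set_system T) (FF : Filter F) (z : T -> R[i]) :
  (z x : R[i]^o) @[x --> F] --> (0 : R[i]^o) <->
  complex.Re (z x) @[x --> F] --> (0 : R) /\ complex.Im (z x) @[x --> F] --> (0 : R).
Proof.
split=> [z0|[r0 i0]].
- have small e : 0 < e -> \forall x \near F, Normc.normc (z x) < e.
    move=> e0; have e0' : 0 < e%:C :> R[i] by rewrite ltcE /= eqxx.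
    have /cvgr0Pnorm_lt/(_ _ e0') := z0; apply: filterS => x.
    by rewrite normc_def ltcE /= eqxx /=; case: (z x).
  split; apply/cvgr0Pnorm_lt => e e0; apply: filterS (small e e0) => x.
    exact: le_lt_trans (normc_ge_absRe _).
  exact: le_lt_trans (normc_ge_absIm _).
(* A positive element of [R[i]] has imaginary part 0, so the complex tolerance is a real one. *)
- apply/cvgr0Pnorm_lt => e; case: e => e e'; rewrite ltcE /= => /andP[/eqP -> e0].
  have e2 : 0 < e / 2 by rewrite divr_gt0.
  move/cvgr0Pnorm_lt/(_ _ e2) : r0 => r0; move/cvgr0Pnorm_lt/(_ _ e2) : i0 => i0.
  apply: filterS2 r0 i0 => x rx ix; rewrite normc_def ltcE /= eqxx /=.
  have := normc_le_absD (z x); case: (z x) rx ix => a b /= rx ix; lra.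
Qed.

End complex_truncation.

Lemma ae_and d (T : measurableType d) (R : realType) (m : {measure set T -> \bar R})
    (P Q : T -> Prop) :
  {ae m, forall x, P x} -> {ae m, forall x, Q x} -> {ae m, forall x, P x /\ Q x}.
Proof. exact: filterI. Qed.

(** * The two implications for complex functions *)

Section kernel_of_finite_hilbert.
Context {R : realType}.
Notation mu := (@lebesgue_measure R).
Notation RT := (measurableTypeR R).
Notation LT := (lebesgueType R).
Let I := @I11 R.

Let harmonic_cvg (u : R -> R) : u e @[e --> 0^'+] --> (0 : R) ->
  u n.+1%:R^-1 @[n --> \oo] --> (0 : R).
Proof.
move=> u0; move/cvg_at_rightP: u0 => /(_ (fun n => n.+1%:R^-1)); apply.
by split=> [n|]; [rewrite invr_gt0|exact: cvg_harmonic].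
Qed.

Let arcsineE (c : R[i]) (x : R) : c / (Num.sqrt (1 - x ^+ 2))%:C =
  (complex.Re c * arcsine x) +i* (complex.Im c * arcsine x).
Proof.
apply/eqP; rewrite eq_complex Re_div_real Im_div_real.
by rewrite /arcsine /semicircle !eqxx.
Qed.

Lemma finite_hilbert_eq0_arcsine (f : R -> R[i]) : LlogL f ->
  {ae mu, forall t, I t -> hilbert_exists f t /\ finite_hilbert f t = 0} ->
  exists c : R[i], {ae mu, forall x, I x -> f x = c / (Num.sqrt (1 - x ^+ 2))%:C}.
Proof.
move=> [mf foo] Tf0; have [mr mi] := mf.
have [g [gI gz fg]] := zygmund_borel_version foo mr (fun x => normc_ge_absRe (f x)).
have [h [hI hz fh]] := zygmund_borel_version foo mi (fun x => normc_ge_absIm (f x)).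
have C0 : 0 <= expR (@trunc_hilbert_gap R) * (8 * pi).
  by rewrite mulr_ge0 ?expR_ge0// mulr_ge0// pi_ge0.
have both : {ae mu, forall t, I t ->
    rtrunc_hilbert e g t @[e --> 0^'+] --> (0 : R) /\
    rtrunc_hilbert e h t @[e --> 0^'+] --> (0 : R)}.
  apply: ae_imply Tf0 => t Tt It; have [ex lim0] := Tt It.
  (* [lim] is total; existence of the limit is what turns the value 0 into convergence. *)
  have : truncated_hilbert f t e @[e --> 0^'+] --> (0 : R[i]^o).
    by rewrite -[X in _ --> X]lim0; exact: ex.
  move=> /complex_cvg0P [r0 i0]; split.
    apply: cvg_trans r0; apply: near_eq_cvg; near=> e.
    by rewrite (truncated_hilbertE _ It mf gI hI fg fh).
  apply: cvg_trans i0; apply: near_eq_cvg; near=> e.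
  by rewrite (truncated_hilbertE _ It mf gI hI fg fh).
have both1 : {ae mu, forall t, I t ->
    rtrunc_hilbert n.+1%:R^-1 g t @[n --> \oo] --> (0 : R)}.
  apply: ae_imply both => t H It; have [H1 _] := H It.
  exact: (harmonic_cvg H1).
have both2 : {ae mu, forall t, I t ->
    rtrunc_hilbert n.+1%:R^-1 h t @[n --> \oo] --> (0 : R)}.
  apply: ae_imply both => t H It; have [_ H2] := H It.
  exact: (harmonic_cvg H2).
have [a ga] := real_hilbert_kernel gI (gz _ C0) both1.
have [b hb] := real_hilbert_kernel hI (hz _ C0) both2.
exists (a +i* b); have := ae_and (ae_and fg fh) (ae_and ga hb).
apply: ae_imply => x [[fgx fhx] [gax hbx]] Ix.
rewrite arcsineE /= -(gax Ix) -(hbx Ix) -(fgx Ix) -(fhx Ix).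
by apply/eqP; rewrite eq_complex !eqxx.
Unshelve. all: by end_near. Qed.

(** The truncated integrals ignore null sets and those of the arcsine density converge at each
    point, so the conclusion holds everywhere on the interval. *)
Lemma arcsine_finite_hilbert_eq0 (f : R -> R[i]) (c : R[i]) : cmeasurable I f ->
  {ae mu, forall x, I x -> f x = c / (Num.sqrt (1 - x ^+ 2))%:C} ->
  forall t, I t -> hilbert_exists f t /\ finite_hilbert f t = 0.
Proof.
move=> mf fc t It.
have gI (a : R) := integrable_scale a measurable_I11 (@arcsine_integrable R).
have fg : {ae mu, forall x, I x -> complex.Re (f x) = complex.Re c * arcsine x}.
  by apply: ae_imply fc => x fx /fx ->; rewrite arcsineE.
have fh : {ae mu, forall x, I x -> complex.Im (f x) = complex.Im c * arcsine x}.
  by apply: ae_imply fc => x fx /fx ->; rewrite arcsineE.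
have t1 : -1 < t < 1 by exact/I11P.
have T0 (a : R) :
    rtrunc_hilbert e (fun x => a * arcsine x) t @[e --> 0^'+] --> (0 : R).
  have : a * rtrunc_hilbert e arcsine t @[e --> 0^'+] --> a * 0.
    by apply: cvgM; [exact: cvg_cst|exact: trunc_hilbert_arcsine_cvg0].
  move=> aT; rewrite [X in _ --> X]mulr0 in aT.
  apply: cvg_trans aT; apply: near_eq_cvg; near=> e.
  have e0 : 0 < e by near: e; exact: nbhs_right_gt.
  have aI := integrable_trunc_hilbert t e0 (@arcsine_integrable R).
  have z1 : \int[mu]_(x in I) (a * (arcsine x * trunc_inv e (x - t))) =
      a * \int[mu]_(x in I) (arcsine x * trunc_inv e (x - t)).
    exact: RintegralZl measurable_I11 aI.
  rewrite /rtrunc_hilbert mulrCA -z1; congr (_ * _).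
  by apply: eq_Rintegral => x _; rewrite mulrA.
have lim0 : truncated_hilbert f t e @[e --> 0^'+] --> (0 : R[i]^o).
  apply/complex_cvg0P; split.
    apply: cvg_trans (T0 (complex.Re c)); apply: near_eq_cvg; near=> e.
    by rewrite (truncated_hilbertE _ It mf (gI _) (gI _) fg fh).
  apply: cvg_trans (T0 (complex.Im c)); apply: near_eq_cvg; near=> e.
  by rewrite (truncated_hilbertE _ It mf (gI _) (gI _) fg fh).
split; first by apply/cvg_ex; exists 0.
exact: (cvg_lim (@norm_hausdorff _ R[i]^o) lim0).
Unshelve. all: by end_near. Qed.

End kernel_of_finite_hilbert.

Unset Implicit Arguments.

Theorem theorem3p4 (R : realType) (f : R -> R[i]) (hf : LlogL f) :
  {ae lebmu R, forall t : R,
     I11 t -> hilbert_exists f t /\ finite_hilbert f t = 0} <->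
  exists c : R[i],
    {ae lebmu R, forall x : R,
       I11 x -> f x = c / (Num.sqrt (1 - x ^+ 2))%:C}.
Proof.
split=> [/ae_lebmu Tf0|[c /ae_lebmu fc]].
- have [c fc] := finite_hilbert_eq0_arcsine hf Tf0.
  by exists c; apply/ae_lebmu.
- by apply: aeW => t It; exact: (arcsine_finite_hilbert_eq0 hf.1 fc It).
Qed.
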